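(* Let $Z$ be a random $n\times n$ Wigner matrix (for each $n \ge 0$, as defined in the context) with arbitrary entry distributions of expected value $0$, with moments $\mu_q,\nu_q,\kappa_q$. For $a_1,a_2,c_1,c_2\in\mathbb{R}$ let $$H_2(t,a_1,a_2,c_1,c_2)=\sum_{n=0}^\infty \frac{t^n}{n!}\,\mathbb{E}\big[\det(Z+a_1J+c_1\mathrm{Id})\det(Z+a_2J+c_2\mathrm{Id})\big].$$ Then $$H_2(t,a_1,a_2,c_1,c_2)=P(t)\,Q(t),$$ where $$\begin{aligned}P(t)={}&1+(a_1+a_2)\mu_3t^2+\frac{(a_1c_2+a_2c_1)t}{1-(\mu_2+\nu_2)^2t^2}-\frac{(\mu_2+\nu_2)(a_1c_1+a_2c_2)t^2}{1-(\mu_2+\nu_2)^2t^2}\\&+a_1a_2\Bigg(\frac{2t^2(\mu_2-\mu_2^2t+\nu_2^2t)}{1-2\mu_2t+(\mu_2^2-\nu_2^2)t^2}+\frac{t}{1-(\mu_2+\nu_2)^2t^2}\\&\quad+\Big(\mu_3t^2+\frac{c_2t}{1-(\mu_2+\nu_2)^2t^2}-\frac{c_1(\mu_2+\nu_2)t^2}{1-(\mu_2+\nu_2)^2t^2}\Big)\Big(\mu_3t^2+\frac{c_1t}{1-(\mu_2+\nu_2)^2t^2}-\frac{c_2(\mu_2+\nu_2)t^2}{1-(\mu_2+\nu_2)^2t^2}\Big)\Bigg)\end{aligned}$$ and $$Q(t)=\frac{\exp\left(t(c_1c_2+\kappa_2-2\mu_2)+\frac{t^2}{2}(\mu_4-3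\nu_2^2-3\mu_2^2+\nu_4)-\frac{t^2}{2}\frac{(c_1^2+c_2^2)(\mu_2+\nu_2)}{1-(\mu_2+\nu_2)^2t^2}+\frac{c_1c_2(\mu_2+\nu_2)^2t^3}{1-(\mu_2+\nu_2)^2t^2}\right)}{\left(1-2\mu_2t+(\mu_2^2-\nu_2^2)t^2\right)\sqrt{1-(\mu_2+\nu_2)^2t^2}}.$$
   Context: A random $n\times n$ Wigner matrix $Z$ has entries $Z_{jj'}=Z^{\mathrm{Re}}_{jj'}+\mathbf{i}Z^{\mathrm{Im}}_{jj'}$ ($\mathbf{i}=\sqrt{-1}$) with real random variables $Z^{\mathrm{Re}}_{jj'},Z^{\mathrm{Im}}_{jj'}$ such that: $\{Z^{\mathrm{Re}}_{jj'}:j<j'\}$ are i.i.d., $\{Z^{\mathrm{Im}}_{jj'}:j<j'\}$ are i.i.d., $\{Z^{\mathrm{Re}}_{jj}\}$ are i.i.d., $Z^{\mathrm{Im}}_{jj}=0$; these three families are independent of each other; and for $j>j'$, $Z^{\mathrm{Re}}_{jj'}=Z^{\mathrm{Re}}_{j'j}$ and $Z^{\mathrm{Im}}_{jj'}=-Z^{\mathrm{Im}}_{j'j}$. The three distributions do not depend on $n$. For $j<j'$, $\mu_q=\mathbb{E}[(Z^{\mathrm{Re}}_{jj'})^q]$ and $\nu_q=\mathbb{E}[(Z^{\mathrm{Im}}_{jj'})^q]$; $\kappa_q=\mathbb{E}[Z_{jj}^q]$. It is assumed that $\mu_1=\nu_1=\kappa_1=0$, that the off-diagonal real and imaginary parts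 have finite fourth moments, and that the diagonal entries have finite second moment. $J$ is the $n\times n$ all-ones matrix and $\mathrm{Id}$ is the identity matrix. The determinant of the $0\times0$ matrix is $1$. The identity is one of formal power series in $t$, with $\sqrt{1-x}$ the power series with constant term $1$. *)

(* Defs.v *)
From HB Require Import structures.
From mathcomp Require Import all_boot all_order all_algebra.
From mathcomp Require Import all_classical all_reals all_analysis.
From mathcomp.real_closed Require Import complex.

Set Implicit Arguments.
Unset Strict Implicit.
Unset Printing Implicit Defensive.

Import Order.TTheory GRing.Theory Num.Theory.
Local Open Scope classical_set_scope.
Local Open Scope ring_scope.

Record fps (F : Type) : Type := FPS { coefs : nat -> F }.

Lemma fpsP (F : Type) (f g : fps F) :
  (forall n, coefs f n = coefs g n) -> f = g.
Proof. by case: f g => [f] [g] /= fg; congr FPS; apply/funext. Qed.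

HB.instance Definition _ (F : Type) := gen_eqMixin (fps F).
HB.instance Definition _ (F : Type) := gen_choiceMixin (fps F).

Section FpsRing.
Variable F : fieldType.
Implicit Types f g h : fps F.

Definition fps_zero : fps F := FPS (fun=> 0).
Definition fps_opp f : fps F := FPS (fun n => - coefs f n).
Definition fps_add f g : fps F := FPS (fun n => coefs f n + coefs g n).

Let fps_addA : associative fps_add.
Proof. by move=> f g h; apply: fpsP => n /=; rewrite addrA. Qed.
Let fps_addC : commutative fps_add.
Proof. by move=> f g; apply: fpsP => n /=; rewrite addrC. Qed.
Let fps_add0 : left_id fps_zero fps_add.
Proof. by move=> f; apply: fpsP => n /=; rewrite add0r. Qed.
Let fps_addN : left_inverse fps_zero fps_opp fps_add.
Proof. by move=> f; apply: fpsP => n /=; rewrite addNr. Qed.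

HB.instance Definition _ :=
  GRing.isZmodule.Build (fps F) fps_addA fps_addC fps_add0 fps_addN.

Definition fpsC (c : F) : fps F := FPS (fun n => if n == 0%N then c else 0).
Definition fps_mul f g : fps F :=
  FPS (fun n => \sum_(i < n.+1) coefs f i * coefs g (n - i)).

Definition fps_trunc (n : nat) f : {poly F} := \poly_(i < n.+1) coefs f i.

Lemma coef_fps_trunc n f i :
  (i <= n)%N -> (fps_trunc n f)`_i = coefs f i.
Proof. by move=> lein; rewrite coef_poly ltnS lein. Qed.

Lemma coef_fps_mul n f g i : (i <= n)%N ->
  coefs (fps_mul f g) i = (fps_trunc n f * fps_trunc n g)`_i.
Proof.
move=> lein; rewrite coefM; apply: eq_bigr => j _ /=.
rewrite !coef_fps_trunc //; first exact: leq_trans (leq_subr _ _) lein.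
by apply: leq_trans lein; rewrite -ltnS.
Qed.

Let fps_mulC : commutative fps_mul.
Proof.
by move=> f g; apply: fpsP => n; rewrite !(@coef_fps_mul n) // mulrC.
Qed.

Let fps_mulA : associative fps_mul.
Proof.
move=> f g h; apply: fpsP => n.
transitivity (fps_trunc n f * (fps_trunc n g * fps_trunc n h))`_n.
  rewrite coefM; apply: eq_bigr => j _.
  rewrite coef_fps_trunc -1?ltnS // (@coef_fps_mul n) //.
  exact: leq_subr.
rewrite mulrA coefM; apply: eq_bigr => j _.
rewrite (coef_fps_trunc h (leq_subr _ _)) -(@coef_fps_mul n) //.
by rewrite -ltnS.
Qed.

Let fps_mul1 : left_id (fpsC 1) fps_mul.
Proof.
move=> f; apply: fpsP => n /=.
rewrite big_ord_recl /= mul1r subn0 big1 ?addr0 // => i _.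
by rewrite mul0r.
Qed.

Let fps_mulDl : left_distributive fps_mul fps_add.
Proof.
move=> f g h; apply: fpsP => n /=; rewrite -big_split /=.
by apply: eq_bigr => i _; rewrite mulrDl.
Qed.

Let fps_1neq0 : fpsC 1 != 0.
Proof.
apply/eqP => /(congr1 (fun f => coefs f 0%N)) /= /eqP.
by rewrite oner_eq0.
Qed.

HB.instance Definition _ := GRing.Zmodule_isComNzRing.Build (fps F)
  fps_mulA fps_mulC fps_mul1 fps_mulDl fps_1neq0.

(* Course-of-values recursion: the coefficient of index n is [next] applied
   to the sequence of the coefficients of index < n. *)
Fixpoint fps_prefix (next : seq F -> F) (n : nat) : seq F :=
  if n is m.+1 then rcons (fps_prefix next m) (next (fps_prefix next m))
  else [::].
Definition fps_rec (next : seq F -> F) : fps F :=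
  FPS (fun n => next (fps_prefix next n)).

Lemma size_fps_prefix next n : size (fps_prefix next n) = n.
Proof. by elim: n => //= n IHn; rewrite size_rcons IHn. Qed.

Lemma nth_fps_prefix next n i : (i < n)%N ->
  (fps_prefix next n)`_i = coefs (fps_rec next) i.
Proof.
elim: n => // n IHn; rewrite ltnS leq_eqVlt /= nth_rcons size_fps_prefix.
by case/predU1P => [->|ltin]; rewrite ?ltnn ?eqxx // ltin IHn.
Qed.

Definition fps_inv_next f (s : seq F) : F :=
  if size s == 0%N then (coefs f 0)^-1
  else - (coefs f 0)^-1 *
       \sum_(i < size s) s`_i * coefs f (size s - i).
Definition fps_unit : pred (fps F) := fun f => coefs f 0 != 0.
Definition fps_inv f : fps F :=
  if fps_unit f then fps_rec (fps_inv_next f) else f.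

Let fps_mulVf : {in fps_unit, left_inverse 1 fps_inv *%R}.
Proof.
move=> f f_unit; have f0 : coefs f 0 != 0 := f_unit.
rewrite /fps_inv /fps_unit f0; apply: fpsP => n /=.
rewrite big_ord_recr /= subnn [X in _ + X * _]/fps_inv_next size_fps_prefix.
have [->|n0] := eqVneq n 0%N; first by rewrite big_ord0 add0r mulVf.
rewrite !mulNr mulrAC mulVf // mul1r.
under [X in _ - X]eq_bigr => i _ do rewrite nth_fps_prefix //.
exact: subrr.
Qed.

Let fps_unitP f g : g * f = 1 -> fps_unit f.
Proof.
move/(congr1 (fun h => coefs h 0%N)) => /=.
rewrite big_ord_recl big_ord0 addr0 subnn => gf; apply/eqP => f0.
by move/eqP: gf; rewrite f0 mulr0 eq_sym oner_eq0.
Qed.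

Let fps_inv_out : {in [predC fps_unit], fps_inv =1 id}.
Proof.
by move=> f f_out; rewrite /fps_inv (negbTE (f_out : ~~ fps_unit f)).
Qed.

HB.instance Definition _ := GRing.ComNzRing_hasMulInverse.Build (fps F)
  fps_mulVf fps_unitP fps_inv_out.

Definition fpsX : fps F := FPS (fun n => (n == 1%N)%:R).

(* Meaningful when [coefs f 0 = 0]: then [f ^+ k] has no term of degree < k,
   so the sum over k <= n is the full sum over k. *)
Definition fps_exp f : fps F :=
  FPS (fun n => \sum_(k < n.+1) coefs (f ^+ k) n / (k`!)%:R).

(* The square root with constant term 1 of a series with constant term 1;
   see [fps_sqrtK]. *)
Definition fps_sqrt_next f (s : seq F) : F :=
  if size s == 0%N then 1
  else (coefs f (size s) - \sum_(1 <= i < size s) s`_i * s`_(size s - i)) / 2.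
Definition fps_sqrt f : fps F := fps_rec (fps_sqrt_next f).

Lemma fps_sqrt0 f : coefs (fps_sqrt f) 0 = 1.
Proof. by []. Qed.

Lemma coef_fps_sqrtS f n : coefs (fps_sqrt f) n.+1 =
  (coefs f n.+1 - \sum_(1 <= i < n.+1)
     coefs (fps_sqrt f) i * coefs (fps_sqrt f) (n.+1 - i)) / 2.
Proof.
transitivity (fps_sqrt_next f (fps_prefix (fps_sqrt_next f) n.+1)); first by [].
rewrite [LHS]/fps_sqrt_next -/(fps_sqrt_next f) size_fps_prefix.
congr ((_ - _) / _); apply: eq_big_nat => i /andP[i0 ltin].
by rewrite !nth_fps_prefix // ltn_subrL i0.
Qed.

Lemma fps_sqrtK f : (2 : F) != 0 -> coefs f 0 = 1 -> fps_sqrt f ^+ 2 = f.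
Proof.
move=> two0 f0; rewrite expr2; apply: fpsP => -[|n].
  by rewrite /= big_ord_recl big_ord0 addr0 f0; exact: mulr1.
transitivity (\sum_(0 <= i < n.+2)
    coefs (fps_sqrt f) i * coefs (fps_sqrt f) (n.+1 - i)).
  by rewrite big_mkord.
rewrite big_nat_recr // big_ltn // subn0 subnn fps_sqrt0 mulr1 mul1r.
rewrite [in LHS]coef_fps_sqrtS [LHS]addrAC -mulrDl -mulr2n -(mulr_natr (_ - _)).
by rewrite mulfK // subrK.
Qed.

End FpsRing.

Definition fps_map (F G : Type) (h : F -> G) (f : fps F) : fps G :=
  FPS (fun n => h (coefs f n)).

Section Independence.
Context {d : measure_display} {T : measurableType d} {R : realType}.
Variable P : probability T R.

Definition mutually_independent (I : finType) (D : {pred I})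
    (X : I -> T -> R) : Prop :=
  forall (J : {set I}) (B : I -> set (measurableTypeR R)),
    {subset J <= D} -> (forall i, i \in J -> measurable (B i)) ->
    P (\bigcap_(i in [set` J]) (X i @^-1` B i)) =
    (\prod_(i in J) P (X i @^-1` B i))%E.

Definition sigma_family (I : finType) (D : {pred I}) (X : I -> T -> R) :
    set (set T) :=
  <<s \bigcup_(i in [set` D])
        preimage_set_system setT (X i : T -> measurableTypeR R) measurable >>.

Definition independent_sigma3 (G1 G2 G3 : set (set T)) : Prop :=
  forall A1 A2 A3, G1 A1 -> G2 A2 -> G3 A3 ->
    P (A1 `&` A2 `&` A3) = (P A1 * P A2 * P A3)%E.

Definition iid_with_law (I : finType) (D : {pred I}) (X : I -> T -> R)
    (law : probability (measurableTypeR R) R) : Prop :=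
  [/\ forall i, i \in D ->
        measurable_fun setT (X i : T -> measurableTypeR R),
      forall i, i \in D -> forall B : set (measurableTypeR R),
        measurable B -> P (X i @^-1` B) = law B
    & mutually_independent D X].

End Independence.

Section ComplexExpectation.
Context {d : measure_display} {T : measurableType d} {R : realType}.
Variable P : probability T R.

Definition complex_integrable (X : T -> R[i]) : Prop :=
  P.-integrable setT (fun w => (complex.Re (X w))%:E) /\
  P.-integrable setT (fun w => (complex.Im (X w))%:E).

Definition complex_expectation (X : T -> R[i]) : R[i] :=
  Complex (fine 'E_P[fun w => complex.Re (X w)])
          (fine 'E_P[fun w => complex.Im (X w)]).

End ComplexExpectation.

Section Wigner.
Variable R : realType.

Definition moment (law : probability (measurableTypeR R) R) (q : nat) : R :=
  fine (\int[law]_x (x ^+ q)%:E).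

Definition finite_moment (law : probability (measurableTypeR R) R)
    (q : nat) : Prop :=
  law.-integrable setT (fun x => (x ^+ q)%:E).

Definition upper_pair (n : nat) : {pred 'I_n * 'I_n} :=
  [pred jk : 'I_n * 'I_n | (jk.1 < jk.2)%N].

Definition entry_re (T : Type) (n : nat) (Z : T -> 'M[R[i]]_n)
    (jk : 'I_n * 'I_n) (w : T) : R := complex.Re (Z w jk.1 jk.2).

Definition entry_im (T : Type) (n : nat) (Z : T -> 'M[R[i]]_n)
    (jk : 'I_n * 'I_n) (w : T) : R := complex.Im (Z w jk.1 jk.2).

Definition entry_diag (T : Type) (n : nat) (Z : T -> 'M[R[i]]_n)
    (j : 'I_n) (w : T) : R := complex.Re (Z w j j).

(* The laws do not depend on the size n, the probability space may. *)
Record wigner (lawRe lawIm lawD : probability (measurableTypeR R) R)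
    (d : measure_display) (T : measurableType d) (P : probability T R)
    (n : nat) (Z : T -> 'M[R[i]]_n) : Prop := Wigner {
  wigner_re : iid_with_law P (@upper_pair n) (entry_re Z) lawRe;
  wigner_im : iid_with_law P (@upper_pair n) (entry_im Z) lawIm;
  wigner_diag : iid_with_law P predT (entry_diag Z) lawD;
  wigner_diag_im : forall j w, entry_im Z (j, j) w = 0;
  wigner_indep : independent_sigma3 P
    (sigma_family (@upper_pair n) (entry_re Z))
    (sigma_family (@upper_pair n) (entry_im Z))
    (sigma_family predT (entry_diag Z));
  wigner_re_sym : forall j j' : 'I_n, (j' < j)%N ->
    forall w, entry_re Z (j, j') w = entry_re Z (j', j) w;
  wigner_im_sym : forall j j' : 'I_n, (j' < j)%N ->
    forall w, entry_im Z (j, j') w = - entry_im Z (j', j) w }.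

Local Open Scope complex_scope.

Definition det_prod (n : nat) (a1 a2 c1 c2 : R) (M : 'M[R[i]]_n) : R[i] :=
  \det (M + a1%:C *: const_mx 1 + c1%:C *: 1%:M) *
  \det (M + a2%:C *: const_mx 1 + c2%:C *: 1%:M).

Definition H2 (d : nat -> measure_display) (T : forall n, measurableType (d n))
    (P : forall n, probability (T n) R) (Z : forall n, T n -> 'M[R[i]]_n)
    (a1 a2 c1 c2 : R) : fps R[i] :=
  FPS (fun n =>
    complex_expectation (P n) (fun w => det_prod a1 a2 c1 c2 (Z n w))
    / (n`!)%:R).

End Wigner.

Section ClosedForm.
Variable F : fieldType.

Definition H2_P (t mu2 mu3 nu2 a1 a2 c1 c2 : fps F) : fps F :=
  1 + (a1 + a2) * mu3 * t ^+ 2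
  + (a1 * c2 + a2 * c1) * t / (1 - (mu2 + nu2) ^+ 2 * t ^+ 2)
  - (mu2 + nu2) * (a1 * c1 + a2 * c2) * t ^+ 2
      / (1 - (mu2 + nu2) ^+ 2 * t ^+ 2)
  + a1 * a2 *
    (2 * t ^+ 2 * (mu2 - mu2 ^+ 2 * t + nu2 ^+ 2 * t)
       / (1 - 2 * mu2 * t + (mu2 ^+ 2 - nu2 ^+ 2) * t ^+ 2)
     + t / (1 - (mu2 + nu2) ^+ 2 * t ^+ 2)
     + (mu3 * t ^+ 2 + c2 * t / (1 - (mu2 + nu2) ^+ 2 * t ^+ 2)
        - c1 * (mu2 + nu2) * t ^+ 2 / (1 - (mu2 + nu2) ^+ 2 * t ^+ 2))
       * (mu3 * t ^+ 2 + c1 * t / (1 - (mu2 + nu2) ^+ 2 * t ^+ 2)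
          - c2 * (mu2 + nu2) * t ^+ 2 / (1 - (mu2 + nu2) ^+ 2 * t ^+ 2))).

Definition H2_Q (t mu2 mu4 nu2 nu4 kappa2 c1 c2 : fps F) : fps F :=
  fps_exp
    (t * (c1 * c2 + kappa2 - 2 * mu2)
     + t ^+ 2 / 2 * (mu4 - 3 * nu2 ^+ 2 - 3 * mu2 ^+ 2 + nu4)
     - t ^+ 2 / 2 * ((c1 ^+ 2 + c2 ^+ 2) * (mu2 + nu2)
                       / (1 - (mu2 + nu2) ^+ 2 * t ^+ 2))
     + c1 * c2 * (mu2 + nu2) ^+ 2 * t ^+ 3
         / (1 - (mu2 + nu2) ^+ 2 * t ^+ 2))
  / ((1 - 2 * mu2 * t + (mu2 ^+ 2 - nu2 ^+ 2) * t ^+ 2)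
     * fps_sqrt (1 - (mu2 + nu2) ^+ 2 * t ^+ 2)).

End ClosedForm.

(* Main.v *)
Require Import Defs.
From HB Require Import structures.
From mathcomp Require Import all_boot all_order all_algebra perm.
From mathcomp Require Import all_classical all_reals all_analysis.
From mathcomp Require Import measurable_realfun.
From mathcomp.real_closed Require Import complex.
From mathcomp Require Import ring zify.

(**
  Each determinant is affine in every row and in every column, so the product has
  degree at most 4 in the real and imaginary parts of an entry above the diagonal
  and at most 2 in a diagonal entry.  By independence its mean only depends on the
  moments up to these orders, and every law can be replaced by a signed measure
  supported by {-2, ..., 2}, which turns the expectation into a finite sum.

  As J has rank one, det (M + a J) = det M + a * (the sum of all cofactors of M),
  so with M_k = Z + c_k Id one needs the means of det M_1 det M_2 and of this
  product with one or both factors replaced by a sum of cofactors.  Expanding both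
  factors along the row and the column of one site and averaging over its entries
  reduces such a sum to sums of the same kind on one site less, and a small family
  of sums is closed under this step.  The resulting recurrences say that all the
  exponential generating functions are rational multiples of the one, e, of
  E[det M_1 det M_2], and that e' = r e with an explicit rational r.  This gives
  e = Q, because r is the logarithmic derivative of Q, and the rational multiples
  add up to P.
*)

Set Implicit Arguments.
Unset Strict Implicit.
Unset Printing Implicit Defensive.

Import Order.TTheory GRing.Theory Num.Theory.
Local Open Scope ring_scope.

(** * Determinants with a bordered row and column *)

(** The entries (i, j) and (j, i) are dependent, so an expansion along a row alone does not leave
    independent factors. Deleting the row and the column of one site together does: what remains is
    a model of the same kind, one size smaller. In the finite model this independence is a
    factorisation of weights, and averaging over a site is a reindexing of a finite sum, so that
    integrals occur only when the two means are compared. The weights may be negative, since the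
    recurrences use only linearity and moments; five nodes suffice because the moments 0 to 4 are
    prescribed.

    The family of sums closes because the entries are centred: an index that occurs once kills the
    mean, so the indices of the row and the column must meet. They meet in pairs, with mean [sg]
    across row and column and [dl] within one of them, or all at one site, with a third or fourth
    moment. The third moments are not the same for the two orders of a pair, which is why a site
    keeps its position in the order of the sites and is not moved to the front. *)

Section Insert.
Variable F : Type.

Definition bordered_mx n (i : 'I_n.+1) (z : F) (r s : 'I_n -> F) (M : 'M[F]_n) :
    'M[F]_n.+1 :=
  \matrix_(k, l) match unlift i k, unlift i l with
                 | None, None => z
                 | None, Some l' => r l'
                 | Some k', None => s k'
                 | Some k', Some l' => M k' l'
                 end.

Lemma bordered_mx00 n (i : 'I_n.+1) (z : F) (r s : 'I_n -> F) (M : 'M[F]_n) :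
  bordered_mx i z r s M i i = z.
Proof. by rewrite mxE unlift_none. Qed.
Lemma bordered_mx0l n (i : 'I_n.+1) (z : F) (r s : 'I_n -> F) (M : 'M[F]_n) l :
  bordered_mx i z r s M i (lift i l) = r l.
Proof. by rewrite mxE unlift_none liftK. Qed.
Lemma bordered_mxl0 n (i : 'I_n.+1) (z : F) (r s : 'I_n -> F) (M : 'M[F]_n) k :
  bordered_mx i z r s M (lift i k) i = s k.
Proof. by rewrite mxE unlift_none liftK. Qed.
Lemma bordered_mxll n (i : 'I_n.+1) (z : F) (r s : 'I_n -> F) (M : 'M[F]_n) k l :
  bordered_mx i z r s M (lift i k) (lift i l) = M k l.
Proof. by rewrite mxE !liftK. Qed.
Let bordered_mxE := (bordered_mx00, bordered_mx0l, bordered_mxl0, bordered_mxll).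

Lemma bordered_mxP n (i : 'I_n.+1) (z : F) (r s : 'I_n -> F) (M : 'M[F]_n)
  (A : 'M[F]_n.+1) :
  A i i = z -> (forall l, A i (lift i l) = r l) ->
  (forall k, A (lift i k) i = s k) ->
  (forall k l, A (lift i k) (lift i l) = M k l) -> A = bordered_mx i z r s M.
Proof.
move=> h00 h0l hl0 hll; apply/matrixP => k l.
by case: (unliftP i k) => [k'|] ->; case: (unliftP i l) => [l'|] ->;
  rewrite bordered_mxE.
Qed.

End Insert.

Definition bordered_mxE := (bordered_mx00, bordered_mx0l, bordered_mxl0, bordered_mxll).

Section InsertSite.
Variable F : comNzRingType.

Lemma bordered_mx_add_scalar n (i : 'I_n.+1) (z : F) (r s : 'I_n -> F) (M : 'M[F]_n) c :
  bordered_mx i z r s M + c%:M = bordered_mx i (z + c) r s (M + c%:M).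
Proof.
apply: bordered_mxP => [|l|k|k l];
  rewrite !mxE ?bordered_mxE ?unlift_none ?liftK ?eqxx //=.
- by rewrite eq_liftF addr0.
- by rewrite lift_eqF addr0.
- by rewrite (inj_eq lift_inj).
Qed.

Lemma mul_bordered_mx n (i : 'I_n.+1) (z : F) (r s : 'I_n -> F) (M : 'M[F]_n)
  (z' : F) (r' s' : 'I_n -> F) (M' : 'M[F]_n) :
  bordered_mx i z r s M *m bordered_mx i z' r' s' M' =
  bordered_mx i (z * z' + \sum_j r j * s' j)
    (fun l => z * r' l + \sum_j r j * M' j l)
    (fun k => s k * z' + \sum_j M k j * s' j)
    (\matrix_(k, l) (s k * r' l) + M *m M').
Proof.
apply: bordered_mxP => [|l|k|k l]; rewrite !mxE (bigD1_ord i) //= ?bordered_mxE.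
- by congr (_ + _); apply: eq_bigr => j _; rewrite !bordered_mxE.
- by congr (_ + _); apply: eq_bigr => j _; rewrite !bordered_mxE.
- by congr (_ + _); apply: eq_bigr => j _; rewrite !bordered_mxE.
- by rewrite ?mxE; congr (_ + _); apply: eq_bigr => j _; rewrite !bordered_mxE.
Qed.

Lemma cofactor_bordered_mx n (i : 'I_n.+1) (z : F) (r s : 'I_n -> F) (M : 'M[F]_n) :
  cofactor (bordered_mx i z r s M) i i = \det M.
Proof.
rewrite /cofactor addnn -signr_odd odd_double expr0 mul1r; congr (\det _).
by apply/matrixP => k l; rewrite !mxE !liftK.
Qed.

Lemma det_bordered_row0 n (i : 'I_n.+1) (z : F) (r s : 'I_n -> F) (M : 'M[F]_n) :
  r =1 (fun=> 0) -> \det (bordered_mx i z r s M) = z * \det M.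
Proof.
move=> r0; rewrite (expand_det_row _ i) (bigD1_ord i)
  //= bordered_mxE cofactor_bordered_mx.
by rewrite big1 ?addr0 // => l _; rewrite bordered_mxE r0 mul0r.
Qed.

Lemma det_bordered_col0 n (i : 'I_n.+1) (z : F) (r s : 'I_n -> F) (M : 'M[F]_n) :
  s =1 (fun=> 0) -> \det (bordered_mx i z r s M) = z * \det M.
Proof.
move=> s0; rewrite (expand_det_col _ i) (bigD1_ord i)
  //= bordered_mxE cofactor_bordered_mx.
by rewrite big1 ?addr0 // => l _; rewrite bordered_mxE s0 mul0r.
Qed.

(* Multiply on the right by the matrix bordering the identity with the corner
   [\det M], a zero row and the column [- \adj M s]: this clears the column of
   the left factor.  The spare factor [\det M] is cancelled in [det_bordered] by
   perturbing [M] to [M + 'X]. *)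
Lemma det_bordered_mul n (i : 'I_n.+1) (z : F) (r s : 'I_n -> F) (M : 'M[F]_n) :
  \det (bordered_mx i z r s M) * \det M =
  (z * \det M - \sum_k \sum_l r k * s l * \adj M k l) * \det M.
Proof.
pose v := fun k => - \sum_l \adj M k l * s l.
have detv : \det (bordered_mx i (\det M) (fun=> 0) v 1%:M) = \det M.
  by rewrite det_bordered_row0 // det1 mulr1.
rewrite -{1}detv -det_mulmx mul_bordered_mx det_bordered_col0; last first.
  move=> k /=; apply/eqP; rewrite addr_eq0; apply/eqP.
  transitivity ((M *m \adj M *m \col_j s j) k 0).
    by rewrite mul_mx_adj mul_scalar_mx !mxE mulrC.
  rewrite -mulmxA mxE -sumrN; apply: eq_bigr => j _.
  by rewrite /v mulrN opprK mxE; congr (_ * _); apply: eq_bigr => l _; rewrite !mxE.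
congr (_ * _).
  congr (_ + _); rewrite -sumrN; apply: eq_bigr => k _.
  rewrite mulrN mulr_sumr; congr (- _); apply: eq_bigr => l _.
  by rewrite -mulrA (mulrC (s l)).
rewrite mulmx1; congr (\det _).
by apply/matrixP => k l; rewrite !mxE mulr0 add0r.
Qed.

End InsertSite.

(** * Cofactors of a bordered matrix *)

Section SiteExpansion.
Variable F : fieldType.

Lemma det_bordered n (i : 'I_n.+1) (z : F) (r s : 'I_n -> F) (M : 'M[F]_n) :
  \det (bordered_mx i z r s M) = z * \det M - \sum_k \sum_l r k * s l * \adj M k l.
Proof.
pose M' := map_mx polyC M + 'X%:M.
pose h : {rmorphism {poly F} -> F} := horner_eval (0 : F).
have hM : map_mx h M' = M.
  by apply/matrixP => k l; rewrite !mxE /h /= /horner_eval hornerD hornerC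
    hornerMn hornerX mul0rn addr0.
(* A monic determinant is regular, so it can be cancelled even when [\det M = 0]; evaluation at 0
   then returns to [M]. *)
have nz : \det M' != 0.
  have -> : M' = char_poly_mx (- M).
    by rewrite /M' /char_poly_mx map_mxN opprK addrC.
  exact: monic_neq0 (char_poly_monic _).
have /(mulIf nz) := @det_bordered_mul {poly F} n i z%:P
  (fun k => (r k)%:P) (fun k => (s k)%:P) M'.
move/(congr1 h); rewrite rmorphB rmorphM -!det_map_mx hM rmorph_sum /= => e.
have hC x : h x%:P = x by rewrite /h /= /horner_eval hornerC.
transitivity (\det (map_mx h (bordered_mx i z%:P (fun k => (r k)%:P)
  (fun k => (s k)%:P) M'))).
  congr (\det _); symmetry; apply: bordered_mxP => [|l|k|k l];
    rewrite mxE bordered_mxE ?hC //.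
  by have := congr1 (fun A : 'M[F]_n => A k l) hM; rewrite mxE.
rewrite e hC; congr (_ - _); apply: eq_bigr => k _.
rewrite rmorph_sum; apply: eq_bigr => l _.
have -> : \adj M = map_mx h (\adj M') by rewrite map_mx_adj hM.
by rewrite !rmorphM /= !horner_evalE !hornerC [X in _ = _ * X]mxE.
Qed.

Definition delta_row n (i k : 'I_n) (M : 'M[F]_n) : 'M[F]_n :=
  \matrix_(a, b) if a == i then (b == k)%:R else M a b.

(* Replacing a row by a basis vector gives the cofactor without its sign
   bookkeeping, and composes to second-order minors. *)
Definition cof n (M : 'M[F]_n) (i k : 'I_n) : F := \det (delta_row i k M).
Definition cof2 n (M : 'M[F]_n) (i k j l : 'I_n) : F :=
  \det (delta_row i k (delta_row j l M)).

(** Two rows are the same basis vector. *)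
Lemma cof2_same_col n (M : 'M[F]_n) i j k : i != j -> cof2 M i k j k = 0.
Proof.
move=> ij; apply: (determinant_alternate ij) => b.
by rewrite !mxE (eq_sym j) (negbTE ij) !eqxx.
Qed.

Lemma adj_cof n (M : 'M[F]_n) k l : \adj M k l = cof M l k.
Proof.
rewrite mxE /cof (expand_det_row _ l) (bigD1 k) //= mxE !eqxx mul1r.
rewrite big1 => [|b /negbTE bk]; last by rewrite mxE eqxx bk mul0r.
rewrite addr0 /cofactor; congr (_ * \det _); apply/matrixP => a b.
by rewrite !mxE eq_sym (negbTE (neq_lift _ _)).
Qed.

Lemma det_row0 n (M : 'M[F]_n) j : (forall b, M j b = 0) -> \det M = 0.
Proof.
by move=> M0; rewrite (expand_det_row _ j) big1 // => b _; rewrite M0 mul0r.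
Qed.

Section Expansions.
Variables (n : nat) (i : 'I_n.+1) (z : F) (r s : 'I_n -> F) (M : 'M[F]_n).
Let A := bordered_mx i z r s M.

Lemma det_site :
  \det A = z * \det M - \sum_k \sum_l r k * s l * cof M l k.
Proof.
by rewrite /A det_bordered; congr (_ - _); do 2!apply: eq_bigr => ? _; rewrite adj_cof.
Qed.

Lemma cof_site00 : cof A i i = \det M.
Proof.
rewrite -[RHS]mul1r -(@det_bordered_row0 _ _ i 1 (fun=> 0) s) //; congr (\det _).
apply: bordered_mxP => [|l|k|k l]; rewrite !mxE ?eqxx ?lift_eqF ?unlift_none ?liftK //.
Qed.

(** Replacing the row of the site by a basis vector gives another bordered matrix, with corner 0, to
    which [det_bordered] applies. *)
Lemma cof_site0l k : cof A i (lift i k) = - \sum_l s l * cof M l k.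
Proof.
transitivity (\det (bordered_mx i 0 (fun l => (l == k)%:R) s M)).
  congr (\det _); apply: bordered_mxP => [|l|k'|k' l];
    rewrite !mxE ?eqxx ?lift_eqF ?eq_liftF ?unlift_none ?liftK //.
  by rewrite (inj_eq lift_inj).
rewrite det_bordered mul0r add0r (bigD1 k) //= eqxx [X in _ + X]big1 ?addr0.
  by congr (- _); apply: eq_bigr => l _; rewrite mul1r adj_cof.
by move=> l /negbTE ->; rewrite big1 // => a _; rewrite !mul0r.
Qed.

Lemma cof_sitel0 j : cof A (lift i j) i = - \sum_l r l * cof M j l.
Proof.
(* The basis row has its 1 in the column of the site, so row [j] of the block is zero: the
   determinant of the block vanishes, and so do its cofactors outside row [j]. *)
pose M0 := \matrix_(a, b) if a == j then 0 else M a b.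
transitivity (\det (bordered_mx i z r (fun a => if a == j then 1 else s a) M0)).
  congr (\det _); apply: bordered_mxP => [|l|k'|k' l];
   rewrite !mxE ?(inj_eq lift_inj)
     ?eqxx ?lift_eqF ?eq_liftF ?unlift_none ?liftK ?mxE //.
rewrite det_bordered (@det_row0 _ M0 j) => [|b]; last by rewrite mxE eqxx.
rewrite mulr0 add0r; congr (- _); apply: eq_bigr => k _.
rewrite (bigD1 j) //= eqxx mulr1 big1 ?addr0.
  rewrite adj_cof; congr (_ * \det _); apply/matrixP => a b; rewrite !mxE.
  by case: eqP.
move=> l lj; rewrite adj_cof [cof _ _ _](@det_row0 _ _ j) ?mulr0 // => b.
by rewrite !mxE eqxx eq_sym (negbTE lj).
Qed.

(** The replaced row has a 0 in the column of the site, so the entry [s j] is lost: hence the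
    restriction [q != j]. *)
Lemma cof_sitell j k : cof A (lift i j) (lift i k) =
  z * cof M j k - \sum_p \sum_(q | q != j) r p * s q * cof2 M q p j k.
Proof.
transitivity (\det (bordered_mx i z r (fun a => if a == j then 0 else s a)
  (delta_row j k M))).
  congr (\det _); apply: bordered_mxP => [|l|k'|k' l];
   rewrite !mxE ?(inj_eq lift_inj)
     ?eqxx ?lift_eqF ?eq_liftF ?unlift_none ?liftK ?mxE //.
rewrite det_bordered; congr (_ - _); apply: eq_bigr => p _.
rewrite (bigD1 j) //= eqxx mulr0 mul0r add0r; apply: eq_bigr => q /negbTE ->.
by rewrite adj_cof.
Qed.

Lemma cof2_site00ll j k : cof2 A i i (lift i j) (lift i k) = cof M j k.
Proof.
rewrite -[RHS]mul1r -(@det_bordered_row0 _ _ i 1 (fun=> 0)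
  (fun a => if a == j then 0 else s a)) //; congr (\det _).
apply: bordered_mxP => [|l|k'|k' l];
  rewrite !mxE ?(inj_eq lift_inj) ?eqxx ?lift_eqF ?eq_liftF ?unlift_none ?liftK //.
Qed.

End Expansions.
End SiteExpansion.

(** * A finite model of the random matrix *)

Section FiniteModel.
Variables (F : fieldType) (U : finType) (wp wd zp zm zd : U -> F).

(* [U] carries signed weights: [wp] for a pair i < j, with [zp] and [zm] the values
   of the entries (i, j) and (j, i), and [wd] for the diagonal.  The samples below
   the diagonal are not used; they also have weight [wd], of total mass 1. *)
Definition sampleZ n (w : 'M[U]_n) : 'M[F]_n :=
  \matrix_(i, j) if (i < j)%N then zp (w i j)
                 else if (j < i)%N then zm (w j i) else zd (w i i).
Definition weight n (w : 'M[U]_n) : F :=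
  \prod_(i < n) \prod_(j < n) (if (i < j)%N then wp else wd) (w i j).
Definition model_mean n (f : 'M[F]_n -> F) : F :=
  \sum_(w : 'M[U]_n) weight w * f (sampleZ w).

(** Here [u.1] is the sample at (site, other) and [u.2] the one at (other, site). The orientation
    [o] tells which of them lies above the diagonal and carries the weight [wp]; the other is summed
    out with the weight [wd]. *)
Definition pair_weight (o : bool) (u : U * U) : F :=
  (if o then wp else wd) u.1 * (if o then wd else wp) u.2.
Definition pair_row (o : bool) (u : U * U) := if o then zp u.1 else zm u.2.
Definition pair_col (o : bool) (u : U * U) := if o then zm u.1 else zp u.2.

(* The orientation of the pair formed by a site [i] and its [j]-th other site. *)
Definition before n (i : 'I_n.+1) (j : 'I_n) := (i < lift i j)%N.

Definition site_mean n (i : 'I_n.+1)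
    (f : F -> ('I_n -> F) -> ('I_n -> F) -> F) : F :=
  \sum_o wd o * \sum_(k : {ffun 'I_n -> U * U})
    (\prod_j pair_weight (before i j) (k j)) *
    f (zd o) (fun j => pair_row (before i j) (k j))
             (fun j => pair_col (before i j) (k j)).

(* The site [i] is sampled separately from the model on the remaining sites. *)
Definition split_mean n (i : 'I_n.+1)
    (f : F -> ('I_n -> F) -> ('I_n -> F) -> 'M[F]_n -> F) : F :=
  site_mean i (fun z r s => model_mean (f z r s)).

Lemma ltn_lift n (i : 'I_n.+1) (j k : 'I_n) : (lift i j < lift i k)%N = (j < k)%N.
Proof. by rewrite !ltnNge leq_bump2. Qed.

Lemma lift_ltn n (i : 'I_n.+1) (j : 'I_n) : (lift i j < i)%N = ~~ before i j.
Proof.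
rewrite /before -leqNgt [RHS]leq_eqVlt; case: eqP => // e.
by have := neq_lift i j; rewrite -val_eqE [X in _ != X]e eqxx.
Qed.

Lemma sampleZ_bordered n (i : 'I_n.+1) o (k : {ffun 'I_n -> U * U}) (w : 'M[U]_n) :
  sampleZ (bordered_mx i o (fun j => (k j).1) (fun j => (k j).2) w) =
  bordered_mx i (zd o) (fun j => pair_row (before i j) (k j))
      (fun j => pair_col (before i j) (k j)) (sampleZ w).
Proof.
apply: bordered_mxP => [|l|j|j l]; rewrite [LHS]mxE ?ltnn ?bordered_mxE // ?ltn_lift.
- rewrite -/(before i l) lift_ltn /pair_row.
  by case: (before i l) => //=.
- rewrite -/(before i j) lift_ltn /pair_col.
  by case: (before i j) => //=.
- by rewrite mxE.
Qed.

Lemma weight_bordered n (i : 'I_n.+1) o (k : {ffun 'I_n -> U * U}) (w : 'M[U]_n) :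
  weight (bordered_mx i o (fun j => (k j).1) (fun j => (k j).2) w) =
  wd o * (\prod_j pair_weight (before i j) (k j)) * weight w.
Proof.
rewrite /weight (bigD1_ord i) //= (bigD1_ord i) //= ltnn bordered_mxE -!mulrA.
congr (_ * _); rewrite /pair_weight big_split /= -mulrA.
congr (_ * _); first by apply: eq_bigr => j _; rewrite bordered_mxE.
rewrite -big_split; apply: eq_bigr => j _; rewrite (bigD1_ord i) //= bordered_mxE.
rewrite lift_ltn; congr (_ * _); first by case: (before i j).
by apply: eq_bigr => l _; rewrite bordered_mxE ltn_lift.
Qed.

(** Independence of one site from the rest: a matrix of samples is the same as a corner, a family of
    pairs and a smaller matrix, and the weight factors accordingly. *)
Lemma model_mean_split n (i : 'I_n.+1) (f : 'M[F]_n.+1 -> F) :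
  model_mean f = split_mean i (fun z r s M => f (bordered_mx i z r s M)).
Proof.
pose g (x : U * {ffun 'I_n -> U * U} * 'M[U]_n) : 'M[U]_n.+1 :=
  bordered_mx i x.1.1 (fun j => (x.1.2 j).1) (fun j => (x.1.2 j).2) x.2.
have g_bij : bijective g.
  exists (fun w : 'M[U]_n.+1 => (w i i, [ffun j => (w i (lift i j), w (lift i j) i)],
    \matrix_(k, l) w (lift i k) (lift i l))).
  - case=> -[u k] w; rewrite /g /=; congr (_, _, _); first by rewrite bordered_mxE.
    + by apply/ffunP => j; rewrite ffunE !bordered_mxE -surjective_pairing.
    + by apply/matrixP => a b; rewrite mxE bordered_mxE.
  - move=> w; rewrite /g /=; symmetry; apply: bordered_mxP => [|l|k|k l] //=;
      by rewrite ?ffunE ?mxE.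
rewrite /model_mean (reindex g) /=; last exact: onW_bij.
under eq_bigr => x _ do rewrite /g weight_bordered sampleZ_bordered.
pose t o (k : {ffun 'I_n -> U * U}) (w : 'M[U]_n) :=
  wd o * (\prod_j pair_weight (before i j) (k j)) * weight w *
  f (bordered_mx i (zd o) (fun j => pair_row (before i j) (k j))
      (fun j => pair_col (before i j) (k j)) (sampleZ w)).
rewrite -(pair_bigA _ (fun x w => t x.1 x.2 w)) /=.
rewrite -(pair_bigA _ (fun o k => \sum_w t o k w)) /=.
rewrite /split_mean /site_mean /model_mean; apply: eq_bigr => o _.
rewrite mulr_sumr; apply: eq_bigr => k _.
rewrite mulrA mulr_sumr; apply: eq_bigr => w _.
by rewrite /t !mulrA.
Qed.

Lemma eq_Ex n (f g : 'M[F]_n -> F) : f =1 g -> model_mean f = model_mean g.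
Proof. by move=> fg; apply: eq_bigr => w _; rewrite fg. Qed.

Lemma ExD n (f g : 'M[F]_n -> F) :
  model_mean (fun M => f M + g M) = model_mean f + model_mean g.
Proof. by rewrite -big_split; apply: eq_bigr => w _; rewrite mulrDr. Qed.

Lemma ExZ n c (f : 'M[F]_n -> F) : model_mean (fun M => c * f M) = c * model_mean f.
Proof. by rewrite mulr_sumr; apply: eq_bigr => w _; rewrite mulrCA. Qed.

Lemma Ex_sum n (I : Type) (r : seq I) (P : pred I) (f : I -> 'M[F]_n -> F) :
  model_mean (fun M => \sum_(a <- r | P a) f a M) = \sum_(a <- r | P a)
    model_mean (f a).
Proof.
by rewrite exchange_big; apply: eq_bigr => w _; rewrite mulr_sumr.
Qed.

Section Site.
Variables (n : nat) (i : 'I_n.+1).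
Implicit Types f g : F -> ('I_n -> F) -> ('I_n -> F) -> F.

Lemma eq_ExSite f g : (forall z r s, f z r s = g z r s) ->
  site_mean i f = site_mean i g.
Proof.
move=> fg; apply: eq_bigr => o _; congr (_ * _).
by apply: eq_bigr => k _; rewrite fg.
Qed.

Lemma ExSiteD f g :
  site_mean i (fun z r s => f z r s + g z r s) = site_mean i f + site_mean i g.
Proof.
rewrite -big_split /=; apply: eq_bigr => o _; rewrite -mulrDr -big_split /=.
by congr (_ * _); apply: eq_bigr => k _; rewrite mulrDr.
Qed.

Lemma ExSiteZ f c : site_mean i (fun z r s => f z r s * c) = site_mean i f * c.
Proof.
rewrite mulr_suml; apply: eq_bigr => o _; rewrite -mulrA mulr_suml.
by congr (_ * _); apply: eq_bigr => k _; rewrite mulrA.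
Qed.

Lemma ExSite_sum (I : Type) (l : seq I) (P : pred I)
    (f : I -> F -> ('I_n -> F) -> ('I_n -> F) -> F) :
  site_mean i (fun z r s => \sum_(a <- l | P a) f a z r s) =
  \sum_(a <- l | P a) site_mean i (f a).
Proof.
rewrite exchange_big; apply: eq_bigr => o _; rewrite -mulr_sumr exchange_big.
by congr (_ * _); apply: eq_bigr => k _; rewrite mulr_sumr.
Qed.

Definition pair_moment (o : bool) (p q : nat) : F :=
  \sum_u wp u * (if o then zp u ^+ p * zm u ^+ q else zm u ^+ p * zp u ^+ q).

Definition diag_mean (h : F -> F) : F := \sum_o wd o * h (zd o).

Hypothesis wd1 : \sum_o wd o = 1.

(** Pairs attached to different [j] are independent: a sum over functions of a product is a product
    of sums, and in each pair the sample below the diagonal has total mass 1. *)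
Lemma ExSite_monomial (h : F -> F) (p q : 'I_n -> nat) :
  site_mean i (fun z r s => h z * \prod_j (r j ^+ p j * s j ^+ q j)) =
  diag_mean h * \prod_j pair_moment (before i j) (p j) (q j).
Proof.
rewrite /site_mean /diag_mean mulr_suml; apply: eq_bigr => o _.
under [X in _ * X = _]eq_bigr => k _ do rewrite mulrCA -big_split /=.
rewrite -mulr_sumr mulrA; congr (_ * _).
rewrite -(bigA_distr_bigA (fun j (u : U * U) => pair_weight (before i j) u *
  (pair_row (before i j) u ^+ p j * pair_col (before i j) u ^+ q j))).
apply: eq_bigr => j _; rewrite /pair_moment /pair_weight /pair_row /pair_col.
rewrite -(pair_bigA _ (fun a b => (if before i j then wp else wd) a *
  (if before i j then wd else wp) b *
  ((if before i j then zp a else zm b) ^+ p j *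
   (if before i j then zm a else zp b) ^+ q j))) /=.
case: (before i j).
  apply: eq_bigr => a _; rewrite -[RHS]mulr1 -wd1 mulr_sumr.
  by apply: eq_bigr => b _; rewrite mulrAC.
rewrite exchange_big; apply: eq_bigr => b _; rewrite -[RHS]mul1r -wd1 mulr_suml.
by apply: eq_bigr => a _; rewrite [RHS]mulrA.
Qed.

End Site.
End FiniteModel.

(** * Mixed moments of the row and the column of one site *)

Section SiteMoments.
Variables (F : fieldType) (U : finType) (wp wd zp zm zd : U -> F).
(** For an entry Z above the diagonal these become the means of |Z|^2, Z^2 and |Z|^4. *)
Variables (sg dl m4 : F).
Local Notation Ex := (model_mean wp wd zp zm zd).
Local Notation ExSite := (site_mean wp wd zp zm zd).
Local Notation ExIns := (split_mean wp wd zp zm zd).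
Local Notation mom := (pair_moment wp zp zm).
Local Notation Ed := (diag_mean wd zd).
Hypothesis wd1 : \sum_u wd u = 1.
Hypothesis wp1 : \sum_u wp u = 1.
Hypothesis mom10 : forall o, mom o 1 0 = 0.
Hypothesis mom01 : forall o, mom o 0 1 = 0.
Hypothesis mom11 : forall o, mom o 1 1 = sg.
Hypothesis mom20 : forall o, mom o 2 0 = dl.
Hypothesis mom02 : forall o, mom o 0 2 = dl.
Hypothesis mom22 : forall o, mom o 2 2 = m4.

Lemma mom00 o : mom o 0 0 = 1.
Proof.
rewrite -wp1; apply: eq_bigr => u _; rewrite !expr0 mulr1.
by case: o; rewrite mulr1.
Qed.

Section Fixed.
Variables (n : nat) (i : 'I_n.+1).

Lemma prod_mom_single j0 (p q : 'I_n -> nat) :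
  (forall j, j != j0 -> p j = 0%N /\ q j = 0%N) ->
  \prod_j mom (before i j) (p j) (q j) = mom (before i j0) (p j0) (q j0).
Proof.
move=> pq0; rewrite (bigD1 j0) //= big1 ?mulr1 // => j /pq0[-> ->].
exact: mom00.
Qed.

(** The vanishing principle behind all the site means below: an index met exactly once contributes a
    first moment. *)
Lemma prod_mom_zero j0 (p q : 'I_n -> nat) :
  (p j0 + q j0 = 1)%N -> \prod_j mom (before i j) (p j) (q j) = 0.
Proof.
move=> pq1; rewrite (bigD1 j0) //=; suff -> : mom (before i j0) (p j0) (q j0) = 0.
  by rewrite mul0r.
by case: (p j0) (q j0) pq1 => [|[|?]] [|[|?]] // _; rewrite ?mom10 ?mom01.
Qed.

Lemma prod_mom_double j0 j1 (p q : 'I_n -> nat) : j0 != j1 ->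
  (forall j, j != j0 -> j != j1 -> p j = 0%N /\ q j = 0%N) ->
  \prod_j mom (before i j) (p j) (q j) =
  mom (before i j0) (p j0) (q j0) * mom (before i j1) (p j1) (q j1).
Proof.
move=> j01 pq0; rewrite (bigD1 j0) //= (bigD1 j1) ?(eq_sym j1) //=.
rewrite big1 ?mulr1 // => j /andP[jj0 jj1].
by have [-> ->] := pq0 _ jj0 jj1; exact: mom00.
Qed.

Lemma prod_delta (r : 'I_n -> F) a : \prod_j r j ^+ (j == a) = r a.
Proof.
by rewrite (bigD1 a) //= eqxx big1 ?mulr1 // => j /negbTE ->.
Qed.

Lemma prod_exps (r s : 'I_n -> F) (p q : 'I_n -> nat) :
  \prod_j (r j ^+ p j * s j ^+ q j) = (\prod_j r j ^+ p j) * \prod_j s j ^+ q j.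
Proof. exact: big_split. Qed.

Lemma prod_delta2 (r : 'I_n -> F) a b :
  \prod_j r j ^+ ((j == a) + (j == b)) = r a * r b.
Proof.
rewrite -[in RHS](prod_delta r a) -[in RHS](prod_delta r b) -big_split.
by apply: eq_bigr => j _; rewrite exprD.
Qed.

Lemma prod_delta0 (r : 'I_n -> F) : \prod_j r j ^+ 0 = 1.
Proof. by rewrite big1. Qed.

Lemma site_h (h : F -> F) : ExSite i (fun z r s => h z) = Ed h.
Proof.
rewrite -[RHS]mulr1; transitivity (ExSite i (fun z r s => h z * \prod_j (r j ^+ 0 * s
  j ^+ 0))).
  by apply: eq_ExSite => z r s; rewrite big1 ?mulr1 // => j _; rewrite !expr0 mulr1.
rewrite (ExSite_monomial wp zp zm zd i wd1 h (fun=> 0%N) (fun=> 0%N))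
  big1 ?mulr1 // => j _.
exact: mom00.
Qed.

Lemma site_s (h : F -> F) a : ExSite i (fun z r s => h z * s a) = 0.
Proof.
transitivity (ExSite i (fun z r s => h z * \prod_j (r j ^+ 0 * s j ^+ (j == a)))).
  by apply: eq_ExSite => z r s; rewrite prod_exps prod_delta0 mul1r prod_delta.
rewrite (ExSite_monomial wp zp zm zd i wd1 h (fun=> 0%N) (fun j => (j == a) : nat)).
by rewrite (@prod_mom_zero a) ?mulr0 // eqxx.
Qed.

Lemma site_r (h : F -> F) a : ExSite i (fun z r s => h z * r a) = 0.
Proof.
transitivity (ExSite i (fun z r s => h z * \prod_j (r j ^+ (j == a) * s j ^+ 0))).
  by apply: eq_ExSite => z r s; rewrite prod_exps prod_delta0 mulr1 prod_delta.
rewrite (ExSite_monomial wp zp zm zd i wd1 h (fun j => (j == a) : nat) (fun=> 0%N)).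
by rewrite (@prod_mom_zero a) ?mulr0 // eqxx.
Qed.

Lemma site_rs (h : F -> F) a b : ExSite i (fun z r s => h z * (r a * s b)) =
  Ed h * (sg *+ (a == b)).
Proof.
transitivity (ExSite i (fun z r s => h z * \prod_j (r j ^+ (j == a)
  * s j ^+ (j == b)))).
  by apply: eq_ExSite => z r s; rewrite prod_exps !prod_delta.
rewrite (ExSite_monomial wp zp zm zd i wd1 h (fun j => (j == a) : nat)
  (fun j => (j == b) : nat)).
have [<-|ab] := eqVneq a b.
  rewrite (@prod_mom_single a) => [|j /negbTE -> //].
  by rewrite eqxx mom11.
by rewrite (@prod_mom_zero a) // eqxx (negbTE ab).
Qed.

Lemma site_ss (h : F -> F) a b : ExSite i (fun z r s => h z * (s a * s b)) =
  Ed h * (dl *+ (a == b)).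
Proof.
transitivity (ExSite i (fun z r s => h z * \prod_j (r j ^+ 0 * s j ^+ ((j == a)
  + (j == b))))).
  by apply: eq_ExSite => z r s; rewrite prod_exps prod_delta2 prod_delta0 mul1r.
rewrite (ExSite_monomial wp zp zm zd i wd1 h (fun=> 0%N) (fun j => ((j == a)
  + (j == b))%N)).
have [<-|ab] := eqVneq a b.
  rewrite (@prod_mom_single a) => [|j /negbTE -> //].
  by rewrite eqxx mom02.
by rewrite (@prod_mom_zero a) // eqxx (negbTE ab).
Qed.

(** Three factors survive only at one common index, and their moment still depends on the
    orientation of the pair. *)
Lemma site_srs (h : F -> F) a b c :
  ExSite i (fun z r s => h z * (s a * (r b * s c))) =
  Ed h * (mom (before i a) 1 2 *+ ((b == a) && (c == a))).
Proof.
transitivity (ExSite i (fun z r s => h z * \prod_j (r j ^+ (j == b)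
  * s j ^+ ((j == a) + (j == c))))).
  apply: eq_ExSite => z r s; rewrite prod_exps prod_delta2 prod_delta.
  by ring.
rewrite (ExSite_monomial wp zp zm zd i wd1 h (fun j => (j == b) : nat)
  (fun j => ((j == a) + (j == c))%N)).
have [->|ba] := eqVneq b a.
  have [->|ca] := eqVneq c a.
    by rewrite (@prod_mom_single a) => [|j /negbTE -> //]; rewrite eqxx.
  by rewrite (@prod_mom_zero c) // eqxx (negbTE ca).
have [->|ca] := eqVneq c a.
  by rewrite (@prod_mom_zero b) // eqxx (negbTE ba).
by rewrite (@prod_mom_zero a) // eqxx !(eq_sym a) (negbTE ba) (negbTE ca).
Qed.

(** The three ways to pair four factors, and the coincidence of all four indices. The inequalities
    make the four cases disjoint. *)
Lemma site_rsrs (h : F -> F) a b c e :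
  ExSite i (fun z r s => h z * ((r a * s b) * (r c * s e))) =
  Ed h * ((sg ^+ 2 *+ [&& a == b, c == e & a != c])
        + (sg ^+ 2 *+ [&& a == e, b == c & a != c])
        + (dl ^+ 2 *+ [&& a == c, b == e & a != b])
        + (m4 *+ [&& a == b, b == c & c == e])).
Proof.
transitivity (ExSite i (fun z r s => h z *
   \prod_j (r j ^+ ((j == a) + (j == c)) * s j ^+ ((j == b) + (j == e))))).
  apply: eq_ExSite => z r s; rewrite prod_exps !prod_delta2.
  by rewrite [in RHS]mulrACA.
rewrite (ExSite_monomial wp zp zm zd i wd1 h (fun j => ((j == a) + (j == c))%N)
  (fun j => ((j == b) + (j == e))%N)).
congr (_ * _).
have [<-|ab] := eqVneq a b.
  have [<-|ce] := eqVneq c e.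
    have [<-|ac] := eqVneq a c; rewrite ?eqxx /= ?mulr0n ?add0r ?mulr1n.
      by rewrite (@prod_mom_single a) => [|j /negbTE -> //]; rewrite eqxx.
    rewrite (@prod_mom_double a c) // => [|j /negbTE -> /negbTE -> //].
    by rewrite !eqxx (eq_sym c) (negbTE ac) /= !addr0 !mom11.
  have [ea|ea] := eqVneq e a.
    subst e; rewrite (@prod_mom_zero c) ?eqxx ?(negbTE ce) //.
    by rewrite eq_sym (negbTE ce) /= !mulr0n !addr0.
  rewrite (@prod_mom_zero e) ?eqxx ?(eq_sym e) ?(negbTE ce) ?(negbTE ea) //.
  by rewrite !andbF /= !mulr0n !addr0.
  by rewrite (eq_sym a) (negbTE ea).
have [<-|ac] := eqVneq a c.
  have [<-|be] := eqVneq b e.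
    rewrite (@prod_mom_double a b) // => [|j /negbTE -> /negbTE -> //].
    by rewrite !eqxx (eq_sym b) (negbTE ab)
      /= ?andbF /= mom20 mom02 ?mulr0n ?add0r ?addr0.
  rewrite (@prod_mom_zero b) ?eqxx ?(eq_sym b) ?(negbTE ab) ?(negbTE be) //=.
  by rewrite ?andbF ?mulr0n ?addr0.
  by rewrite (eq_sym e) (negbTE be).
have [<-|ae] := eqVneq a e.
  have [<-|bc] := eqVneq b c.
    rewrite (@prod_mom_double a b) // => [|j /negbTE -> /negbTE -> //].
    by rewrite !eqxx (eq_sym b) (negbTE ab) /= ?mom11 ?mulr0n ?add0r ?addr0.
  rewrite (@prod_mom_zero b) ?eqxx ?(eq_sym b) ?(negbTE ab) ?(negbTE bc) //=.
    by rewrite ?mulr0n ?addr0.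
  by rewrite (eq_sym c) (negbTE bc).
by rewrite (@prod_mom_zero a) ?eqxx ?(negbTE ab) ?(negbTE ac) ?(negbTE ae)
  //= ?mulr0n ?addr0.
Qed.

Implicit Types g : 'M[F]_n -> F.
Implicit Types f : F -> ('I_n -> F) -> ('I_n -> F) -> 'M[F]_n -> F.

Lemma eq_ExIns f f' : (forall z r s M, f z r s M = f' z r s M) ->
  ExIns i f = ExIns i f'.
Proof. by move=> ff; apply: eq_ExSite => z r s; apply: eq_Ex. Qed.

Lemma ExInsD f f' :
  ExIns i (fun z r s M => f z r s M + f' z r s M) = ExIns i f + ExIns i f'.
Proof. by rewrite -ExSiteD; apply: eq_ExSite => z r s; rewrite ExD. Qed.

Lemma ExInsN f : ExIns i (fun z r s M => - f z r s M) = - ExIns i f.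
Proof.
rewrite -mulN1r mulrC -ExSiteZ; apply: eq_ExSite => z r s.
by rewrite mulrN1 -mulN1r -ExZ; apply: eq_Ex => M; rewrite mulN1r.
Qed.

Lemma ExIns_sum (I : Type) (l : seq I) (P : pred I)
    (f : I -> F -> ('I_n -> F) -> ('I_n -> F) -> 'M[F]_n -> F) :
  ExIns i (fun z r s M => \sum_(a <- l | P a) f a z r s M) =
  \sum_(a <- l | P a) ExIns i (f a).
Proof. by rewrite -ExSite_sum; apply: eq_ExSite => z r s; rewrite Ex_sum. Qed.

Lemma ExIns_sep (f : F -> ('I_n -> F) -> ('I_n -> F) -> F) g :
  ExIns i (fun z r s M => f z r s * g M) = ExSite i f * Ex g.
Proof. by rewrite -ExSiteZ; apply: eq_ExSite => z r s; rewrite ExZ. Qed.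

Lemma ins_h (h : F -> F) g : ExIns i (fun z r s M => h z * g M) = Ed h * Ex g.
Proof. by rewrite (ExIns_sep (fun z r s => h z)) site_h. Qed.

Lemma ins_s (h : F -> F) (g : 'I_n -> 'M[F]_n -> F) :
  ExIns i (fun z r s M => h z * \sum_l s l * g l M) = 0.
Proof.
transitivity (\sum_l ExIns i (fun z r s M => h z * s l * g l M)).
  rewrite -ExIns_sum; apply: eq_ExIns => z r s M; rewrite mulr_sumr.
  by apply: eq_bigr => l _; rewrite mulrA.
by rewrite big1 // => l _; rewrite (ExIns_sep (fun z r s => h z * s l)) site_s mul0r.
Qed.

Lemma ins_r (h : F -> F) (g : 'I_n -> 'M[F]_n -> F) :
  ExIns i (fun z r s M => h z * \sum_l r l * g l M) = 0.
Proof.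
transitivity (\sum_l ExIns i (fun z r s M => h z * r l * g l M)).
  rewrite -ExIns_sum; apply: eq_ExIns => z r s M; rewrite mulr_sumr.
  by apply: eq_bigr => l _; rewrite mulrA.
by rewrite big1 // => l _; rewrite (ExIns_sep (fun z r s => h z * r l)) site_r mul0r.
Qed.

Lemma sum_delta_cond (P : pred 'I_n) (G : 'I_n -> F) k (c : F) :
  \sum_(l | P l) (c *+ (k == l)) * G l = if P k then c * G k else 0.
Proof.
case: ifPn => Pk.
  rewrite (bigD1 k) //= eqxx mulr1n big1 ?addr0 // => l /andP[_ /negbTE lk].
  by rewrite eq_sym lk mulr0n mul0r.
rewrite big1 // => l Pl; case: eqP => [e|_]; last by rewrite mulr0n mul0r.
by rewrite e Pl in Pk.
Qed.

Lemma ins_rs (h : F -> F) (P : pred 'I_n) (g : 'I_n -> 'I_n -> 'M[F]_n -> F) :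
  ExIns i (fun z r s M => h z * \sum_k \sum_(l | P l) r k * s l * g k l M) =
  Ed h * (sg * \sum_(k | P k) Ex (g k k)).
Proof.
transitivity (\sum_k \sum_(l | P l) ExIns i (fun z r s M => h z * (r k * s l)
  * g k l M)).
  under eq_bigr do rewrite -ExIns_sum.
  rewrite -ExIns_sum; apply: eq_ExIns => z r s M; rewrite mulr_sumr.
  apply: eq_bigr => l _; rewrite mulr_sumr.
  by apply: eq_bigr => k _; rewrite mulrA.
rewrite 2!mulr_sumr [RHS]big_mkcond /=; apply: eq_bigr => k _.
under eq_bigr => l _ do
  rewrite (ExIns_sep (fun z r s => h z * (r k * s l))) site_rs -mulrA.
by rewrite -mulr_sumr sum_delta_cond; case: ifP => // _; rewrite mulr0.
Qed.

Lemma ins_ss (h : F -> F) (g g' : 'I_n -> 'M[F]_n -> F) :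
  ExIns i (fun z r s M => h z * ((\sum_l s l * g l M) * \sum_l s l * g' l M)) =
  Ed h * (dl * \sum_l Ex (fun M => g l M * g' l M)).
Proof.
transitivity (\sum_k \sum_l ExIns i (fun z r s M => h z * (s k * s l)
  * (g k M * g' l M))).
  under eq_bigr do rewrite -ExIns_sum.
  rewrite -ExIns_sum; apply: eq_ExIns => z r s M; rewrite mulr_suml mulr_sumr.
  apply: eq_bigr => l _; rewrite 2!mulr_sumr.
  by apply: eq_bigr => k _; ring.
rewrite 2!mulr_sumr; apply: eq_bigr => k _.
under eq_bigr => l _ do
  rewrite (ExIns_sep (fun z r s => h z * (s k * s l))) site_ss -mulrA.
by rewrite -mulr_sumr sum_delta_cond.
Qed.

Lemma ins_sr (h : F -> F) (g g' : 'I_n -> 'M[F]_n -> F) :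
  ExIns i (fun z r s M => h z * ((\sum_l s l * g l M) * \sum_l r l * g' l M)) =
  Ed h * (sg * \sum_l Ex (fun M => g l M * g' l M)).
Proof.
transitivity (ExIns i (fun z r s M => h z * \sum_k \sum_(l | predT l)
  r k * s l * (g l M * g' k M))).
  apply: eq_ExIns => z r s M; congr (_ * _).
  rewrite mulrC mulr_suml; apply: eq_bigr => l _; rewrite mulr_sumr.
  by apply: eq_bigr => k _; ring.
exact: ins_rs.
Qed.

Lemma ins_srs (h : F -> F) (P : pred 'I_n) (g : 'I_n -> 'M[F]_n -> F)
    (g' : 'I_n -> 'I_n -> 'M[F]_n -> F) :
  ExIns i (fun z r s M => h z * ((\sum_m s m * g m M) *
    \sum_k \sum_(l | P l) r k * s l * g' k l M)) =
  Ed h * \sum_(m | P m) mom (before i m) 1 2 * Ex (fun M => g m M * g' m m M).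
Proof.
transitivity (\sum_m \sum_k \sum_(l | P l) ExIns i (fun z r s M =>
    h z * (s m * (r k * s l)) * (g m M * g' k l M))).
  under eq_bigr => m _ do under eq_bigr => k _ do rewrite -ExIns_sum.
  under eq_bigr => m _ do rewrite -ExIns_sum.
  rewrite -ExIns_sum; apply: eq_ExIns => z r s M; rewrite mulr_suml mulr_sumr.
  apply: eq_bigr => m _; rewrite 2!mulr_sumr; apply: eq_bigr => k _.
  by rewrite 2!mulr_sumr; apply: eq_bigr => l _; ring.
rewrite mulr_sumr [RHS]big_mkcond /=; apply: eq_bigr => m _.
under eq_bigr => k _ do under eq_bigr => l _ do
  rewrite (ExIns_sep (fun z r s => h z * (s m * (r k * s l)))) site_srs.
rewrite (bigD1 m) //= eqxx /= [X in _ + X]big1 ?addr0; last first.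
  by move=> k /negbTE ->; rewrite big1 // => l _; rewrite /= mulr0n mulr0 mul0r.
under eq_bigr => l _ do rewrite -mulrA (eq_sym l).
by rewrite -mulr_sumr sum_delta_cond; case: ifP => // _; rewrite mulr0.
Qed.

Lemma ins_rsrs (h : F -> F) (g g' : 'I_n -> 'I_n -> 'M[F]_n -> F) :
  ExIns i (fun z r s M => h z * ((\sum_k \sum_l r k * s l * g k l M) *
    \sum_k \sum_l r k * s l * g' k l M)) =
  Ed h * (sg ^+ 2 * (\sum_k \sum_(l | l != k) Ex (fun M => g k k M * g' l l M))
        + sg ^+ 2 * (\sum_k \sum_(l | l != k) Ex (fun M => g k l M * g' l k M))
        + dl ^+ 2 * (\sum_k \sum_(l | l != k) Ex (fun M => g k l M * g' k l M))
        + m4 * \sum_k Ex (fun M => g k k M * g' k k M)).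
Proof.
transitivity (\sum_a \sum_b \sum_c \sum_e ExIns i (fun z r s M =>
    h z * ((r a * s b) * (r c * s e)) * (g a b M * g' c e M))).
  under eq_bigr => m _ do under eq_bigr => k _ do under eq_bigr => l _ do rewrite
    -ExIns_sum.
  under eq_bigr => m _ do under eq_bigr => k _ do rewrite -ExIns_sum.
  under eq_bigr => m _ do rewrite -ExIns_sum.
  rewrite -ExIns_sum; apply: eq_ExIns => z r s M; rewrite mulr_suml mulr_sumr.
  apply: eq_bigr => a _; rewrite mulr_suml mulr_sumr; apply: eq_bigr => b _.
  rewrite 2!mulr_sumr; apply: eq_bigr => c _; rewrite 2!mulr_sumr.
  by apply: eq_bigr => e _; ring.
pose G a b c e := Ex (fun M => g a b M * g' c e M).
transitivity (Ed h * (\sum_a \sum_b \sum_c \sum_e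
   ((sg ^+ 2 *+ [&& a == b, c == e & a != c]) * G a b c e
  + (sg ^+ 2 *+ [&& a == e, b == c & a != c]) * G a b c e
  + (dl ^+ 2 *+ [&& a == c, b == e & a != b]) * G a b c e
  + (m4 *+ [&& a == b, b == c & c == e]) * G a b c e))).
  rewrite mulr_sumr; apply: eq_bigr => a _.
  rewrite mulr_sumr; apply: eq_bigr => b _.
  rewrite mulr_sumr; apply: eq_bigr => c _.
  rewrite mulr_sumr; apply: eq_bigr => e _.
  rewrite (ExIns_sep (fun z r s => h z * (r a * s b * (r c * s e)))) site_rsrs.
  by rewrite -mulrA /G; congr (_ * _); rewrite !mulrDl.
congr (_ * _); rewrite !mulr_sumr.
have collapse2 (x : F) (K : 'I_n -> F) (k : 'I_n) (Q : pred 'I_n) :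
   \sum_l (x *+ ((k == l) && Q l)) * K l = (x *+ Q k) * K k.
  rewrite (bigD1 k) //= eqxx /= big1 ?addr0 // => l /negbTE lk.
  by rewrite eq_sym lk mulr0n mul0r.
rewrite -!big_split /=; apply: eq_bigr => a _.
under eq_bigr => b _ do under eq_bigr => c _ do rewrite !big_split /=.
under eq_bigr => b _ do rewrite !big_split /=.
rewrite !big_split /=; congr (_ + _ + _ + _).
- rewrite (bigD1 a) //= [X in _ + X]big1 ?addr0.
    rewrite eqxx /= mulr_sumr [RHS]big_mkcond; apply: eq_bigr => c _.
    rewrite collapse2 eq_sym; case: (_ == _) => //=; by rewrite mulr0n mul0r.
  move=> b /negbTE ba; rewrite big1 // => c _; rewrite big1 // => e _.
  by rewrite eq_sym ba mulr0n mul0r.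
- rewrite mulr_sumr [RHS]big_mkcond; apply: eq_bigr => b _.
  transitivity (\sum_c (sg ^+ 2 *+ ((b == c) && (a != c))) * G a b c a).
    by apply: eq_bigr => c _; rewrite collapse2.
  rewrite collapse2 eq_sym; case: (_ == _) => //=; by rewrite mulr0n mul0r.
- rewrite mulr_sumr [RHS]big_mkcond; apply: eq_bigr => b _.
  rewrite (bigD1 a) //= [X in _ + X]big1 ?addr0.
    rewrite eqxx /= collapse2 eq_sym; case: (_ == _) => //=; by rewrite mulr0n mul0r.
  move=> c /negbTE ca; rewrite big1 // => e _.
  by rewrite eq_sym ca mulr0n mul0r.
- rewrite (bigD1 a) //= [X in _ + X]big1 ?addr0.
    rewrite eqxx /=.
    transitivity (\sum_c (m4 *+ ((a == c) && true)) * G a a c c).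
      apply: eq_bigr => c _; rewrite andbT.
      transitivity (\sum_e (m4 *+ ((c == e) && (a == c))) * G a a c e).
        by apply: eq_bigr => e _; rewrite andbC.
      by rewrite collapse2.
    by rewrite collapse2.
  move=> b /negbTE ba; rewrite big1 // => c _; rewrite big1 // => e _.
  by rewrite eq_sym ba mulr0n mul0r.
Qed.

End Fixed.
End SiteMoments.

(** * Means of products of minors when one site is removed *)

Section Recurrences.
Variables (F : fieldType) (U : finType) (wp wd zp zm zd : U -> F).
Variables (sg dl m4 k2 : F).
Local Notation Ex := (model_mean wp wd zp zm zd).
Local Notation ExIns := (split_mean wp wd zp zm zd).
Local Notation mom := (pair_moment wp zp zm).
Local Notation Ed := (diag_mean wd zd).
Hypothesis wd1 : \sum_u wd u = 1.
Hypothesis wdz : \sum_u wd u * zd u = 0.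
Hypothesis wdz2 : \sum_u wd u * zd u ^+ 2 = k2.
Hypothesis wp1 : \sum_u wp u = 1.
Hypothesis mom10 : forall o, mom o 1 0 = 0.
Hypothesis mom01 : forall o, mom o 0 1 = 0.
Hypothesis mom11 : forall o, mom o 1 1 = sg.
Hypothesis mom20 : forall o, mom o 2 0 = dl.
Hypothesis mom02 : forall o, mom o 0 2 = dl.
Hypothesis mom22 : forall o, mom o 2 2 = m4.

Lemma Ed_1 : Ed (fun=> 1) = 1.
Proof. by rewrite -[RHS]wd1; apply: eq_bigr => o _; rewrite mulr1. Qed.

Lemma Ed_shift c : Ed (fun z => z + c) = c.
Proof.
rewrite /diag_mean; under eq_bigr do rewrite mulrDr.
by rewrite big_split /= wdz add0r -mulr_suml wd1 mul1r.
Qed.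

Lemma Ed_shift2 c c' : Ed (fun z => (z + c) * (z + c')) = k2 + c * c'.
Proof.
transitivity (\sum_u (wd u * zd u ^+ 2 + wd u * zd u * (c + c') + wd u * (c * c'))).
  by apply: eq_bigr => u _; ring.
by rewrite !big_split /= -!mulr_suml wdz2 wdz wd1 mul0r addr0 mul1r.
Qed.

Lemma sum2_lift n (i : 'I_n.+1) (K : 'I_n.+1 -> 'I_n.+1 -> F) :
  \sum_k \sum_l K k l = K i i + \sum_l K i (lift i l) + \sum_k K (lift i k) i
    + \sum_k \sum_l K (lift i k) (lift i l).
Proof.
rewrite (bigD1_ord i) //= (bigD1_ord i) //= -!addrA; congr (_ + (_ + _)).
by rewrite -big_split; apply: eq_bigr => k _; rewrite (bigD1_ord i).
Qed.

Lemma big_neq_lift n (i : 'I_n.+1) (K : 'I_n.+1 -> F) :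
  \sum_(k | k != i) K k = \sum_k K (lift i k).
Proof.
apply: (@addrI _ (K i)); rewrite -(bigD1_ord i (P := predT)) //.
by rewrite [RHS](bigD1 i).
Qed.

Section OneSite.
Variables (n : nat) (i : 'I_n.+1) (c c' : F).
Implicit Types j k l : 'I_n.

Let A (M : 'M[F]_n.+1) := M + c%:M.
Let B (M : 'M[F]_n.+1) := M + c'%:M.
Let a (M : 'M[F]_n) := M + c%:M.
Let b (M : 'M[F]_n) := M + c'%:M.

Let ins_1 g := @ins_h F U wp wd zp zm zd wd1 wp1 n i (fun=> 1) g.
Let ins_h := ins_h zp zm zd wd1 wp1.
Let ins_r0 (g : 'I_n -> 'M[F]_n -> F) :
  ExIns i (fun z r s M => \sum_l r l * g l M) = 0.
Proof.
rewrite -[RHS](@ins_r F U wp wd zp zm zd wd1 mom10 mom01 n i (fun=> 1) g).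
by apply: eq_ExIns => * /=; rewrite mul1r.
Qed.
Let ins_s0 (g : 'I_n -> 'M[F]_n -> F) :
  ExIns i (fun z r s M => \sum_l s l * g l M) = 0.
Proof.
rewrite -[RHS](@ins_s F U wp wd zp zm zd wd1 mom10 mom01 n i (fun=> 1) g).
by apply: eq_ExIns => * /=; rewrite mul1r.
Qed.
Let ins_rs := ins_rs zd wd1 wp1 mom10 mom01 mom11.

Definition siteE := (bordered_mx_add_scalar, cof_site00, cof_site0l, cof_sitel0,
  cof_sitell, cof2_site00ll, det_site).

Lemma ex_cof00_00 :
  Ex (fun M => cof (A M) i i * cof (B M) i i) =
  Ex (fun M => \det (a M) * \det (b M)).
Proof.
rewrite (model_mean_split _ _ _ _ _ i).
transitivity (ExIns i (fun z r s M => 1 * (\det (a M) * \det (b M)))).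
  by apply: eq_ExIns => z r s M; rewrite /A /B !siteE mul1r.
by rewrite ins_1 Ed_1 mul1r.
Qed.

Lemma ex_cof00_0l l : Ex (fun M => cof (A M) i i * cof (B M) i (lift i l)) = 0.
Proof.
rewrite (model_mean_split _ _ _ _ _ i)
  -[RHS]oppr0 -[X in _ = - X](ins_s0 (fun p M => \det (a M) * cof (b M) p l)).
rewrite -ExInsN; apply: eq_ExIns => z r s M; rewrite /A /B !siteE.
by rewrite mulrN mulr_sumr; congr (- _); apply: eq_bigr => p _; ring.
Qed.

Lemma ex_cof00_l0 k : Ex (fun M => cof (A M) i i * cof (B M) (lift i k) i) = 0.
Proof.
rewrite (model_mean_split _ _ _ _ _ i)
  -[RHS]oppr0 -[X in _ = - X](ins_r0 (fun p M => \det (a M) * cof (b M) k p)).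
rewrite -ExInsN; apply: eq_ExIns => z r s M; rewrite /A /B !siteE.
by rewrite mulrN mulr_sumr; congr (- _); apply: eq_bigr => p _; ring.
Qed.

(** The first factor no longer contains the site, so averaging the second keeps the mean of the
    corner and the diagonal of the bilinear form. *)
Lemma ex_cof00_ll k l : Ex (fun M => cof (A M) i i * cof (B M) (lift i k) (lift i l)) =
  c' * Ex (fun M => \det (a M) * cof (b M) k l) -
  sg * \sum_(p | p != k) Ex (fun M => \det (a M) * cof2 (b M) p p k l).
Proof.
rewrite (model_mean_split _ _ _ _ _ i).
transitivity (ExIns i (fun z r s M => (z + c') * (\det (a M) * cof (b M) k l) -
   1 * \sum_p \sum_(q | q != k) r p * s q * (\det (a M) * cof2 (b M) q p k l))).
  apply: eq_ExIns => z r s M; rewrite /A /B !siteE mulrBr mulrCA; congr (_ - _).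
  rewrite mul1r mulr_sumr; apply: eq_bigr => p _; rewrite mulr_sumr.
  by apply: eq_bigr => q _; rewrite mulrCA.
rewrite ExInsD ExInsN; congr (_ - _); first by rewrite ins_h Ed_shift.
by rewrite (ins_rs i (fun=> 1) (fun q => q != k) (fun p q M => \det (a M)
  * cof2 (b M) q p k l)) Ed_1 mul1r.
Qed.

Lemma ex_det_cof2 k l :
  Ex (fun M => \det (A M) * cof2 (B M) i i (lift i k) (lift i l)) =
  c * Ex (fun M => \det (a M) * cof (b M) k l) -
  sg * \sum_p Ex (fun M => cof (a M) p p * cof (b M) k l).
Proof.
rewrite (model_mean_split _ _ _ _ _ i).
transitivity (ExIns i (fun z r s M => (z + c) * (\det (a M) * cof (b M) k l) -
   1 * \sum_p \sum_(q | predT q) r p * s q * (cof (a M) q p * cof (b M) k l))).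
  apply: eq_ExIns => z r s M; rewrite /A /B !siteE mulrBl mulrA; congr (_ - _).
  rewrite mul1r mulr_suml; apply: eq_bigr => p _; rewrite mulr_suml.
  by apply: eq_bigr => q _; rewrite mulrA.
rewrite ExInsD ExInsN; congr (_ - _); first by rewrite ins_h Ed_shift.
by rewrite (ins_rs i (fun=> 1) predT (fun p q M => cof (a M) q p * cof (b M) k l))
  Ed_1 mul1r.
Qed.

Lemma ex_det_cof00 :
  Ex (fun M => \det (A M) * cof (B M) i i) =
  c * Ex (fun M => \det (a M) * \det (b M)) -
  sg * \sum_p Ex (fun M => cof (a M) p p * \det (b M)).
Proof.
rewrite (model_mean_split _ _ _ _ _ i).
transitivity (ExIns i (fun z r s M => (z + c) * (\det (a M) * \det (b M)) -
   1 * \sum_p \sum_(q | predT q) r p * s q * (cof (a M) q p * \det (b M)))).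
  apply: eq_ExIns => z r s M; rewrite /A /B !siteE mulrBl mulrA; congr (_ - _).
  rewrite mul1r mulr_suml; apply: eq_bigr => p _; rewrite mulr_suml.
  by apply: eq_bigr => q _; rewrite mulrA.
rewrite ExInsD ExInsN; congr (_ - _); first by rewrite ins_h Ed_shift.
by rewrite (ins_rs i (fun=> 1) predT (fun p q M => cof (a M) q p * \det (b M)))
  Ed_1 mul1r.
Qed.

Lemma ex_cof0l_0l j l :
  Ex (fun M => cof (A M) i (lift i j) * cof (B M) i (lift i l)) =
  dl * \sum_p Ex (fun M => cof (a M) p j * cof (b M) p l).
Proof.
rewrite (model_mean_split _ _ _ _ _ i).
have := ins_ss zd wd1 wp1 mom10 mom01 mom02 i (fun=> 1)
  (fun p M => cof (a M) p j) (fun p M => cof (b M) p l).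
rewrite Ed_1 mul1r => <-; apply: eq_ExIns => z r s M.
by rewrite /A /B !siteE mulrNN mul1r.
Qed.

Lemma ex_cof0l_l0 j k :
  Ex (fun M => cof (A M) i (lift i j) * cof (B M) (lift i k) i) =
  sg * \sum_p Ex (fun M => cof (a M) p j * cof (b M) k p).
Proof.
rewrite (model_mean_split _ _ _ _ _ i).
have := ins_sr zd wd1 wp1 mom10 mom01 mom11 i (fun=> 1)
  (fun p M => cof (a M) p j) (fun p M => cof (b M) k p).
rewrite Ed_1 mul1r => <-; apply: eq_ExIns => z r s M.
by rewrite /A /B !siteE mulrNN mul1r.
Qed.

Lemma ex_cof0l_00 j : Ex (fun M => cof (A M) i (lift i j) * cof (B M) i i) = 0.
Proof.
rewrite (model_mean_split _ _ _ _ _ i)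
  -[RHS]oppr0 -[X in _ = - X](ins_s0 (fun p M => cof (a M) p j * \det (b M))).
rewrite -ExInsN; apply: eq_ExIns => z r s M; rewrite /A /B !siteE.
by rewrite mulNr mulr_suml; congr (- _); apply: eq_bigr => p _; ring.
Qed.

(** The first factor is linear in the column of the site. Against the corner term of the second it
    averages to 0; against the bilinear term all three indices must meet at some [m]. *)
Lemma ex_cof0l_ll j k l :
  Ex (fun M => cof (A M) i (lift i j) * cof (B M) (lift i k) (lift i l)) =
  \sum_(m | m != k) mom (before i m) 1 2 *
     Ex (fun M => cof (a M) m j * cof2 (b M) m m k l).
Proof.
rewrite (model_mean_split _ _ _ _ _ i).
have := ins_srs zd wd1 wp1 mom10 mom01 i (fun=> 1) (fun q => q != k)
  (fun p M => cof (a M) p j) (fun p q M => cof2 (b M) q p k l).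
rewrite Ed_1 mul1r => <-.
have := ins_s zd wd1 mom10 mom01 i (fun z => z + c')
  (fun p M => cof (a M) p j * cof (b M) k l).
move=> s0; rewrite -[RHS]subr0 -[X in _ = _ - X]s0 -ExInsN -ExInsD.
apply: eq_ExIns => z r s M; rewrite /A /B !siteE.
rewrite mulNr mulrBr opprB mul1r; congr (_ - _).
by rewrite mulrCA mulr_suml; congr (_ * _); apply: eq_bigr => p _; rewrite mulrA.
Qed.

Lemma ex_cof0l_det l :
  Ex (fun M => cof (A M) i (lift i l) * \det (B M)) =
  \sum_m mom (before i m) 1 2 * Ex (fun M => cof (a M) m l * cof (b M) m m).
Proof.
rewrite (model_mean_split _ _ _ _ _ i).
have := ins_srs zd wd1 wp1 mom10 mom01 i (fun=> 1) predT
  (fun p M => cof (a M) p l) (fun p q M => cof (b M) q p).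
rewrite Ed_1 mul1r => <-.
have := ins_s zd wd1 mom10 mom01 i (fun z => z + c')
  (fun p M => cof (a M) p l * \det (b M)).
move=> s0; rewrite -[RHS]subr0 -[X in _ = _ - X]s0 -ExInsN -ExInsD.
apply: eq_ExIns => z r s M; rewrite /A /B !siteE.
rewrite mulNr mulrBr opprB mul1r; congr (_ - _).
by rewrite mulrCA mulr_suml; congr (_ * _); apply: eq_bigr => p _; rewrite mulrA.
Qed.

Lemma ex_cof00_cof2 k l :
  Ex (fun M => cof (A M) i i * cof2 (B M) i i (lift i k) (lift i l)) =
  Ex (fun M => \det (a M) * cof (b M) k l).
Proof.
rewrite (model_mean_split _ _ _ _ _ i).
transitivity (ExIns i (fun z r s M => 1 * (\det (a M) * cof (b M) k l))).
  by apply: eq_ExIns => z r s M; rewrite /A /B !siteE mul1r.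
by rewrite ins_1 Ed_1 mul1r.
Qed.

Lemma ex_cof0l_cof2 j k l :
  Ex (fun M => cof (A M) i (lift i j) * cof2 (B M) i i (lift i k) (lift i l)) = 0.
Proof.
rewrite (model_mean_split _ _ _ _ _ i)
  -[RHS]oppr0 -[X in _ = - X](ins_s0 (fun p M => cof (a M) p j * cof (b M) k l)).
rewrite -ExInsN; apply: eq_ExIns => z r s M; rewrite /A /B !siteE.
by rewrite mulNr mulr_suml; congr (- _); apply: eq_bigr => p _; ring.
Qed.

Lemma ex_cof2_same k (K : 'M[F]_n.+1 -> F) :
  Ex (fun M => K M * cof2 (B M) i i (lift i k) i) = 0.
Proof.
rewrite /model_mean big1 // => w _.
by rewrite cof2_same_col ?neq_lift // !mulr0.
Qed.

(** Each determinant is a corner term minus a bilinear form in the row and the column. The four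
    products give the corner moments, two mixed terms and, from the two forms, the cases of
    [ins_rsrs]. *)
Lemma ex_det_det :
  Ex (fun M => \det (A M) * \det (B M)) =
  (k2 + c * c') * Ex (fun M => \det (a M) * \det (b M))
  - c * (sg * \sum_k Ex (fun M => \det (a M) * cof (b M) k k))
  - c' * (sg * \sum_k Ex (fun M => cof (a M) k k * \det (b M)))
  + (sg ^+ 2 * (\sum_k \sum_(l | l != k) Ex (fun M => cof (a M) k k * cof (b M) l l))
   + sg ^+ 2 * (\sum_k \sum_(l | l != k) Ex (fun M => cof (a M) l k * cof (b M) k l))
   + dl ^+ 2 * (\sum_k \sum_(l | l != k) Ex (fun M => cof (a M) l k * cof (b M) l k))
   + m4 * \sum_k Ex (fun M => cof (a M) k k * cof (b M) k k)).
Proof.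
rewrite (model_mean_split _ _ _ _ _ i).
have rsrs := ins_rsrs zd wd1 wp1 mom10 mom01 mom11 mom20 mom02 mom22 i (fun=> 1)
  (fun p q M => cof (a M) q p) (fun p q M => cof (b M) q p).
rewrite Ed_1 mul1r in rsrs; rewrite -{}rsrs.
have rs1 := ins_rs i (fun z => z + c) predT (fun p q M => \det (a M) * cof (b M) q p).
rewrite Ed_shift in rs1; rewrite -{}rs1.
have rs2 := ins_rs i (fun z => z + c') predT (fun p q M => cof (a M) q p * \det (b M)).
rewrite Ed_shift in rs2; rewrite -{}rs2.
rewrite -Ed_shift2 -(ins_h i) -!ExInsN -!ExInsD.
apply: eq_ExIns => z r s M; rewrite /A /B !siteE.
set x := \sum_k _; set y := \sum_k _.
have -> : \sum_k \sum_l r k * s l * (\det (a M) * cof (b M) l k) = \det (a M) * y.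
  rewrite mulr_sumr; apply: eq_bigr => k _; rewrite mulr_sumr.
  by apply: eq_bigr => l _; rewrite mulrCA.
have -> : \sum_k \sum_l r k * s l * (cof (a M) l k * \det (b M)) = x * \det (b M).
  rewrite mulr_suml; apply: eq_bigr => k _; rewrite mulr_suml.
  by apply: eq_bigr => l _; rewrite mulrA.
by rewrite -/x -/y /a /b; ring.
Qed.

End OneSite.
End Recurrences.

(** * Recurrences in the size *)

Section Sequences.
Variables (F : fieldType) (U : finType) (wp wd zp zm zd : U -> F).
Variables (sg dl m3 m4 k2 : F).
Local Notation Ex := (model_mean wp wd zp zm zd).
Local Notation mom := (pair_moment wp zp zm).
Hypothesis two0 : (2 : F) != 0.
Hypothesis wd1 : \sum_u wd u = 1.
Hypothesis wdz : \sum_u wd u * zd u = 0.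
Hypothesis wdz2 : \sum_u wd u * zd u ^+ 2 = k2.
Hypothesis wp1 : \sum_u wp u = 1.
Hypothesis mom10 : forall o, mom o 1 0 = 0.
Hypothesis mom01 : forall o, mom o 0 1 = 0.
Hypothesis mom11 : forall o, mom o 1 1 = sg.
Hypothesis mom20 : forall o, mom o 2 0 = dl.
Hypothesis mom02 : forall o, mom o 0 2 = dl.
Hypothesis mom22 : forall o, mom o 2 2 = m4.
(* The two orientations contribute mu_3 -/+ i nu_3.  Only their sum enters, because
   the third moments appear in sums over ordered pairs: this is why nu_3 drops out. *)
Hypothesis mom12 : mom true 1 2 + mom false 1 2 = m3 *+ 2.

(* [probe 1 0] sums over all pairs of sites and [probe 0 1] over the diagonal; both
   are preserved when a site is removed, so one recurrence serves both. *)
Definition probe (al be : F) n (k l : 'I_n) : F := al + be *+ (k == l).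

Definition det_det (c c' : F) n : F :=
  Ex (fun M : 'M[F]_n => \det (M + c%:M) * \det (M + c'%:M)).
Definition det_cof al be c c' n : F := \sum_k \sum_l probe al be k l *
  Ex (fun M : 'M[F]_n => \det (M + c%:M) * cof (M + c'%:M) k l).
Definition diag_cof_cof al be c c' n : F := \sum_i \sum_k \sum_l probe al be k l *
  Ex (fun M : 'M[F]_n => cof (M + c%:M) i i * cof (M + c'%:M) k l).
(** The companion of [diag_cof_cof]: up to known terms, removing a site turns each of the two into
    the other. *)
Definition det_cof2 al be c c' n : F := \sum_k \sum_l probe al be k l *
  \sum_(m | m != k) Ex (fun M : 'M[F]_n => \det (M + c%:M) * cof2 (M + c'%:M) m m k l).
(** This sum and [cof_cof_cross] differ in where the common index [m] stands: pairing within the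
    column of a removed site reproduces the first with [dl], pairing its column with its row
    reproduces the second with [sg]. *)
Definition cof_cof_row al be c c' n : F := \sum_m \sum_j \sum_l probe al be j l *
  Ex (fun M : 'M[F]_n => cof (M + c%:M) m j * cof (M + c'%:M) m l).
Definition cof_cof_cross al be c c' n : F := \sum_m \sum_j \sum_l probe al be j l *
  Ex (fun M : 'M[F]_n => cof (M + c%:M) m j * cof (M + c'%:M) l m).
(** Diagonal and off-diagonal cofactors are kept apart, because removing the site [i] from
    [cof M i j] with [j != i] leaves a linear form in its column, which is what produces third
    moments. *)
Definition off_cof_det c c' n : F := \sum_i \sum_(j | j != i)
  Ex (fun M : 'M[F]_n => cof (M + c%:M) i j * \det (M + c'%:M)).
Definition off_cof_cof c c' n : F := \sum_i \sum_(j | j != i) \sum_k \sum_l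
  Ex (fun M : 'M[F]_n => cof (M + c%:M) i j * cof (M + c'%:M) k l).

Lemma probe_lift al be n (i : 'I_n.+1) (k l : 'I_n) :
  probe al be (lift i k) (lift i l) = probe al be k l.
Proof. by rewrite /probe (inj_eq lift_inj). Qed.

Lemma probe_diag al be n (k : 'I_n) : probe al be k k = al + be.
Proof. by rewrite /probe eqxx. Qed.

Lemma det_det_sym c c' n : det_det c c' n = det_det c' c n.
Proof. by apply: eq_Ex => M; rewrite mulrC. Qed.

Lemma sum_probe_diag n (K : 'I_n -> 'I_n -> F) :
  \sum_k \sum_l probe 0 1 k l * K k l = \sum_k K k k.
Proof.
apply: eq_bigr => k _; rewrite (bigD1 k) //= probe_diag add0r mul1r.
rewrite big1 ?addr0 // => l /negbTE lk.
by rewrite /probe eq_sym lk addr0 mul0r.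
Qed.

Lemma sum_probe_all n (K : 'I_n -> 'I_n -> F) :
  \sum_k \sum_l probe 1 0 k l * K k l = \sum_k \sum_l K k l.
Proof.
by apply: eq_bigr => k _; apply: eq_bigr => l _; rewrite /probe mul0rn addr0 mul1r.
Qed.

Lemma det_cof_diag c c' n : det_cof 0 1 c c' n =
  \sum_k Ex (fun M : 'M[F]_n => \det (M + c%:M) * cof (M + c'%:M) k k).
Proof. exact: (sum_probe_diag (fun k l => _)). Qed.

Lemma det_cof_diagC c c' n : det_cof 0 1 c c' n =
  \sum_k Ex (fun M : 'M[F]_n => cof (M + c'%:M) k k * \det (M + c%:M)).
Proof.
by rewrite det_cof_diag; apply: eq_bigr => k _; apply: eq_Ex => M; rewrite mulrC.
Qed.

Lemma diag_cof_cof_coincide c c' n :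
  \sum_k Ex (fun M : 'M[F]_n.+1 => cof (M + c%:M) k k * cof (M + c'%:M) k k) =
  n.+1%:R * det_det c c' n.
Proof.
rewrite (eq_bigr (fun=> det_det c c' n)) => [|k _]; last exact: ex_cof00_00.
by rewrite sumr_const card_ord mulr_natl.
Qed.

(** Removing the site moves the cofactor to the other factor, so [c] and [c'] are exchanged and two
    such steps close the system. *)
Lemma det_cof_rec c c' n :
  det_cof 0 1 c c' n.+1 = n.+1%:R * (c * det_det c c' n - sg * det_cof 0 1 c' c n).
Proof.
rewrite det_cof_diag (eq_bigr (fun=> c * det_det c c' n - sg * det_cof 0 1 c' c n)).
  by rewrite sumr_const card_ord mulr_natl.
by move=> k _; rewrite (ex_det_cof00 wd1 wdz wp1 mom10 mom01 mom11) det_cof_diagC.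
Qed.

Lemma diag_cof_cof_rec al be c c' n : diag_cof_cof al be c c' n.+1 = n.+1%:R *
  ((al + be) * det_det c c' n + c' * det_cof al be c c' n - sg * det_cof2 al be c c' n).
Proof.
rewrite /diag_cof_cof (eq_bigr (fun=> (al + be)
  * det_det c c' n + c' * det_cof al be c c' n
  - sg * det_cof2 al be c c' n)); first by rewrite sumr_const card_ord mulr_natl.
move=> i _; rewrite (sum2_lift i) probe_diag ex_cof00_00 //.
rewrite [X in _ + X + _ + _]big1 ?addr0 => [|l _]; last by rewrite ex_cof00_0l ?mulr0.
rewrite [X in _ + X + _]big1 ?addr0 => [|l _]; last by rewrite ex_cof00_l0 ?mulr0.
rewrite -addrA; congr (_ + _); rewrite /det_cof /det_cof2 !mulr_sumr -sumrB.
apply: eq_bigr => k _; rewrite !mulr_sumr -sumrB; apply: eq_bigr => l _.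
by rewrite probe_lift (ex_cof00_ll wd1 wdz wp1 mom10 mom01 mom11); ring.
Qed.

Lemma det_cof2_rec al be c c' n : det_cof2 al be c c' n.+1 = n.+1%:R *
  (c * det_cof al be c c' n - sg * diag_cof_cof al be c c' n).
Proof.
pose K m k l := probe al be k l *
  Ex (fun M : 'M[F]_n.+1 => \det (M + c%:M) * cof2 (M + c'%:M) m m k l).
(* The site to remove is [m], so its sum goes outside; the terms with [l = m] then vanish by
   [ex_cof2_same]. *)
transitivity (\sum_m \sum_(k | k != m) \sum_l K m k l).
  rewrite (exchange_big_dep predT) //=; apply: eq_bigr => k _.
  rewrite exchange_big /=; apply: eq_bigr => l _; rewrite mulr_sumr.
  by apply: eq_bigl => m; rewrite eq_sym.
rewrite (eq_bigr (fun=> c * det_cof al be c c' n - sg * diag_cof_cof al be c c' n)).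
  by rewrite sumr_const card_ord mulr_natl.
move=> m _; rewrite big_neq_lift /det_cof /diag_cof_cof [X in sg * X]exchange_big /=.
rewrite !mulr_sumr -sumrB; apply: eq_bigr => k _.
rewrite (bigD1_ord m) //= /K ex_cof2_same mulr0 add0r.
rewrite [X in sg * X]exchange_big /= !mulr_sumr -sumrB; apply: eq_bigr => l _.
by rewrite probe_lift (ex_det_cof2 wd1 wdz wp1 mom10 mom01 mom11) -mulr_sumr; ring.
Qed.

Lemma cof_cof_row_rec al be c c' n : cof_cof_row al be c c' n.+1 = n.+1%:R *
  ((al + be) * det_det c c' n + dl * cof_cof_row al be c c' n).
Proof.
rewrite /cof_cof_row (eq_bigr (fun=> (al + be)
  * det_det c c' n + dl * cof_cof_row al be c c' n)).
  by rewrite sumr_const card_ord mulr_natl.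
move=> m _; rewrite (sum2_lift m) probe_diag ex_cof00_00 //.
rewrite [X in _ + X + _ + _]big1 ?addr0 => [|l _]; last by rewrite ex_cof00_0l ?mulr0.
rewrite [X in _ + X + _]big1 ?addr0 => [|l _]; last by rewrite ex_cof0l_00 ?mulr0.
congr (_ + _); rewrite /cof_cof_row [X in dl * X]exchange_big /= mulr_sumr.
apply: eq_bigr => j _; rewrite [X in dl * X]exchange_big mulr_sumr.
apply: eq_bigr => l _; rewrite probe_lift -mulr_sumr.
by rewrite (ex_cof0l_0l zd wd1 wp1 mom10 mom01 mom02) mulrCA.
Qed.

Lemma cof_cof_cross_rec al be c c' n : cof_cof_cross al be c c' n.+1 = n.+1%:R *
  ((al + be) * det_det c c' n + sg * cof_cof_cross al be c c' n).
Proof.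
rewrite /cof_cof_cross (eq_bigr (fun=> (al + be)
  * det_det c c' n + sg * cof_cof_cross al be c c' n)).
  by rewrite sumr_const card_ord mulr_natl.
move=> m _; rewrite (sum2_lift m) probe_diag ex_cof00_00 //.
rewrite [X in _ + X + _ + _]big1 ?addr0 => [|l _]; last by rewrite ex_cof00_l0 ?mulr0.
rewrite [X in _ + X + _]big1 ?addr0 => [|l _]; last by rewrite ex_cof0l_00 ?mulr0.
congr (_ + _); rewrite /cof_cof_cross [X in sg * X]exchange_big /= mulr_sumr.
apply: eq_bigr => j _; rewrite [X in sg * X]exchange_big mulr_sumr.
apply: eq_bigr => l _; rewrite probe_lift -mulr_sumr.
by rewrite (ex_cof0l_l0 zd wd1 wp1 mom10 mom01 mom11) mulrCA.
Qed.

Lemma sum_diag_off n (K : 'I_n -> 'I_n -> F) :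
  \sum_k \sum_(l | l != k) K k l = \sum_k \sum_l K k l - \sum_k K k k.
Proof.
rewrite -sumrB; apply: eq_bigr => k _; rewrite [in RHS](bigD1 k) //=.
by rewrite addrC addrK.
Qed.

(** Each sum over distinct sites in [ex_det_det] is completed to a full one. All three corrections
    are the same coincident sum, which joins the [m4] term. Any site may be removed; [ord0] is
    one. *)
Lemma det_det_rec c c' n : det_det c c' n.+1 =
  (k2 + c * c') * det_det c c' n - c * sg * det_cof 0 1 c c' n
  - c' * sg * det_cof 0 1 c' c n
  + sg ^+ 2 * (diag_cof_cof 0 1 c c' n + cof_cof_cross 0 1 c c' n)
    + dl ^+ 2 * cof_cof_row 0 1 c c' n
  + (m4 - 2 * sg ^+ 2 - dl ^+ 2) *
    \sum_k Ex (fun M : 'M[F]_n => cof (M + c%:M) k k * cof (M + c'%:M) k k).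
Proof.
rewrite /det_det (ex_det_det wd1 wdz wdz2 wp1 mom10 mom01 mom11 mom20 mom02 mom22 ord0).
rewrite !sum_diag_off -det_cof_diag -det_cof_diagC.
have -> : diag_cof_cof 0 1 c c' n = \sum_k \sum_l Ex (fun M : 'M[F]_n => cof (M +
  c%:M) k k * cof (M + c'%:M) l l).
  by apply: eq_bigr => k _; exact: (sum_probe_diag (fun k l => _)).
have -> : cof_cof_cross 0 1 c c' n = \sum_k \sum_l Ex (fun M : 'M[F]_n => cof (M +
  c%:M) l k * cof (M + c'%:M) k l).
  rewrite [RHS]exchange_big; apply: eq_bigr => m _;
    exact: (sum_probe_diag (fun k l => _)).
have -> : cof_cof_row 0 1 c c' n = \sum_k \sum_l Ex (fun M : 'M[F]_n => cof (M +
  c%:M) l k * cof (M + c'%:M) l k).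
  rewrite [RHS]exchange_big; apply: eq_bigr => m _;
    exact: (sum_probe_diag (fun k l => _)).
by ring.
Qed.

(** Reversing the order of the sites exchanges the two orientations, so twice the sum has the
    constant summand [m3 *+ 2]. *)
Lemma sum_mom_before n :
  \sum_(i < n.+1) \sum_(m < n) mom (before i m) 1 2 = n.+1%:R * n%:R * m3.
Proof.
have flip : \sum_(i < n.+1) \sum_(m < n) mom (before i m) 1 2 =
            \sum_(i < n.+1) \sum_(m < n) mom (~~ before i m) 1 2.
  rewrite (reindex_inj rev_ord_inj); apply: eq_bigr => i _.
  rewrite (reindex_inj rev_ord_inj); apply: eq_bigr => m _.
  congr (pair_moment _ _ _ _ _ _).
  rewrite -!lift_ltn /before /= /bump; case: i m => i /= ? [m /= ?].
  by do 2!case: leqP; lia.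
apply: (mulfI two0); rewrite [LHS]mulr_natl mulr2n [X in _ + X]flip -big_split /=.
under eq_bigr => i _.
  rewrite -big_split /=; under eq_bigr => m _.
    have -> : mom (before i m) 1 2 + mom (~~ before i m) 1 2 = 2 * m3.
      by rewrite mulr_natl -mom12; case: (before i m) => //=; rewrite addrC.
    over.
  rewrite sumr_const card_ord; over.
rewrite sumr_const card_ord -mulrnA -[LHS]mulr_natl natrM; ring.
Qed.

(** Removing [i] leaves a third moment at a site [m]. Removing [m] as well kills every term but the
    one where both cofactors are at (m, m): hence the step of two in the size. *)
Lemma off_cof_det_rec c c' n :
  off_cof_det c c' n.+2 = n.+2%:R * n.+1%:R * m3 * det_det c c' n.
Proof.
rewrite -sum_mom_before mulr_suml; apply: eq_bigr => i _.
rewrite big_neq_lift mulr_suml.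
under eq_bigr => l _ do rewrite (ex_cof0l_det zd wd1 wp1 mom10 mom01).
rewrite exchange_big; apply: eq_bigr => m _.
rewrite (bigD1_ord m) //= ex_cof00_00 // big1 ?addr0 // => l _.
by rewrite ex_cof0l_00 ?mulr0.
Qed.

(** There are no two distinct sites. These are the initial values that a recurrence of step two
    needs. *)
Lemma off_cof_det_small c c' n : (n < 2)%N -> off_cof_det c c' n = 0.
Proof.
case: n => [|[|//]] _; rewrite /off_cof_det; first by rewrite big_ord0.
by rewrite big1 // => i _; rewrite big1 // => j; rewrite !ord1 eqxx.
Qed.

(** The second cofactor (k, l) is sorted by its contact with the site [i]: at (i, i) the mean is 0,
    in row [i] the columns pair up, in column [i] the column pairs with the row, and elsewhere a
    third moment arises at a site [m] that is removed next. *)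
Lemma off_cof_cof_rec c c' n : off_cof_cof c c' n.+2 =
  n.+2%:R * (dl * cof_cof_row 1 0 c c' n.+1 + sg * cof_cof_cross 1 0 c c' n.+1)
  + n.+2%:R * n.+1%:R * m3 * det_cof 1 0 c c' n.
Proof.
rewrite -sum_mom_before mulr_suml.
have cst x : n.+2%:R * x = \sum_(i < n.+2) x by rewrite sumr_const card_ord mulr_natl.
rewrite cst -big_split /=.
apply: eq_bigr => i _; rewrite big_neq_lift.
under [LHS]eq_bigr => j _ do rewrite (sum2_lift i) ex_cof0l_00 // add0r.
rewrite !big_split /= -!addrA; congr (_ + (_ + _)).
- rewrite /cof_cof_row [X in dl * X]exchange_big /= mulr_sumr; apply: eq_bigr => j _.
  rewrite [X in dl * X]exchange_big mulr_sumr; apply: eq_bigr => l _.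
  rewrite (ex_cof0l_0l zd wd1 wp1 mom10 mom01 mom02); congr (_ * _).
  by apply: eq_bigr => m _; rewrite /probe mul0rn addr0 mul1r.
- rewrite /cof_cof_cross [X in sg * X]exchange_big /= mulr_sumr; apply: eq_bigr => j _.
  rewrite [X in sg * X]exchange_big mulr_sumr; apply: eq_bigr => l _.
  rewrite (ex_cof0l_l0 zd wd1 wp1 mom10 mom01 mom11); congr (_ * _).
  by apply: eq_bigr => m _; rewrite /probe mul0rn addr0 mul1r.
rewrite mulr_suml.
under eq_bigr => j _ do under eq_bigr => k _ do under eq_bigr => l _ do
  rewrite (ex_cof0l_ll zd wd1 wp1 mom10 mom01).
pose K j k l m := mom (before i m) 1 2 *
  Ex (fun M : 'M[F]_n.+1 => cof (M + c%:M) m j * cof2 (M + c'%:M) m m k l).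
transitivity (\sum_m \sum_j \sum_(k | k != m) \sum_l K j k l m).
  rewrite [RHS]exchange_big; apply: eq_bigr => j _.
  rewrite [RHS](exchange_big_dep predT) //=; apply: eq_bigr => k _.
  rewrite [RHS]exchange_big /=; apply: eq_bigr => l _.
  by apply: eq_bigl => m; rewrite eq_sym.
apply: eq_bigr => m _; rewrite (bigD1_ord m) //= [X in _ + X]big1 ?addr0; last first.
  move=> j _; rewrite big_neq_lift big1 // => k _; rewrite (bigD1_ord m) //=.
  rewrite /K ex_cof2_same mulr0 add0r big1 // => l _.
  by rewrite ex_cof0l_cof2 ?mulr0.
rewrite big_neq_lift /det_cof mulr_sumr; apply: eq_bigr => k _.
rewrite (bigD1_ord m) //= /K ex_cof2_same mulr0 add0r mulr_sumr.
apply: eq_bigr => l _; rewrite ex_cof00_cof2 // /probe mul0rn addr0 mul1r.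
by [].
Qed.

Lemma off_cof_cof_small c c' n : (n < 2)%N -> off_cof_cof c c' n = 0.
Proof.
case: n => [|[|//]] _; rewrite /off_cof_cof; first by rewrite big_ord0.
by rewrite big1 // => i _; rewrite big1 // => j; rewrite !ord1 eqxx.
Qed.

End Sequences.

(** * Power series *)

Section FpsCoef.
Variable F : fieldType.
Implicit Types f g : fps F.

Lemma coefsD f g n : coefs (f + g) n = coefs f n + coefs g n.
Proof. by []. Qed.
Lemma coefsN f n : coefs (- f) n = - coefs f n.
Proof. by []. Qed.
Lemma coefsM f g n : coefs (f * g) n = \sum_(i < n.+1) coefs f i * coefs g (n - i).
Proof. by []. Qed.
Lemma coefs1 n : coefs (1 : fps F) n = (n == 0%N)%:R.
Proof. by rewrite /=; case: eqP. Qed.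
Lemma coefs0M f g : coefs (f * g) 0 = coefs f 0 * coefs g 0.
Proof. by rewrite coefsM big_ord1. Qed.
Lemma coefsCM c f n : coefs (fpsC c * f) n = c * coefs f n.
Proof.
rewrite coefsM big_ord_recl /= subn0 big1 ?addr0 // => i _.
by rewrite mul0r.
Qed.

Lemma fpsC_is_zmod_morphism : zmod_morphism (@fpsC F).
Proof. by move=> x y; apply: fpsP => -[|n] //=; rewrite subr0. Qed.
Lemma fpsC_is_monoid_morphism : monoid_morphism (@fpsC F).
Proof.
split; first by [].
by move=> x y; apply: fpsP => -[|n]; rewrite coefsCM //= mulr0.
Qed.
HB.instance Definition _ := GRing.isZmodMorphism.Build F (fps F) (@fpsC F)
  fpsC_is_zmod_morphism.
HB.instance Definition _ := GRing.isMonoidMorphism.Build F (fps F) (@fpsC F)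
  fpsC_is_monoid_morphism.

Lemma coefsXM f n : coefs (fpsX F * f) n = if n is m.+1 then coefs f m else 0.
Proof.
rewrite coefsM; case: n => [|n]; first by rewrite big_ord1 /= mul0r.
rewrite 2!big_ord_recl /= mul0r add0r mul1r subSS subn0 big1 ?addr0 // => i _.
by rewrite mul0r.
Qed.

Lemma fps_unitE f : (f \is a GRing.unit) = (coefs f 0 != 0).
Proof. by []. Qed.

Definition fps_deriv f : fps F := FPS (fun n => n.+1%:R * coefs f n.+1).

Lemma fps_derivD f g : fps_deriv (f + g) = fps_deriv f + fps_deriv g.
Proof. by apply: fpsP => n /=; rewrite mulrDr. Qed.
Lemma fps_derivN f : fps_deriv (- f) = - fps_deriv f.
Proof. by apply: fpsP => n /=; rewrite mulrN. Qed.
Lemma fps_derivC c : fps_deriv (fpsC c) = 0.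
Proof. by apply: fpsP => n /=; rewrite mulr0. Qed.
Lemma fps_derivX : fps_deriv (fpsX F) = 1.
Proof. by apply: fpsP => -[|n] /=; rewrite ?mulr1 ?mulr0. Qed.

Lemma coef_deriv_trunc n f i : (i <= n)%N ->
  ((fps_trunc n.+1 f)^`())`_i = coefs (fps_deriv f) i.
Proof. by move=> lein; rewrite coef_deriv coef_fps_trunc //= mulr_natl. Qed.

Lemma fps_derivM f g :
  fps_deriv (f * g) = fps_deriv f * g + f * fps_deriv g.
Proof.
apply: fpsP => n; rewrite coefsD.
transitivity (((fps_trunc n.+1 f * fps_trunc n.+1 g)^`())`_n).
  by rewrite coef_deriv -(coef_fps_mul f g (leqnn n.+1)) -mulr_natl.
rewrite derivM coefD !coefM; congr (_ + _); apply: eq_bigr => i _.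
  by rewrite coef_deriv_trunc -1?ltnS // coef_fps_trunc // ltnW // ltnS leq_subr.
rewrite coef_deriv_trunc ?leq_subr // coef_fps_trunc //.
by rewrite ltnW // ltnS -ltnS.
Qed.

Lemma fps_deriv1 : fps_deriv 1 = 0.
Proof. exact: (fps_derivC 1). Qed.

Lemma fps_derivX_exp f n : fps_deriv (f ^+ n.+1) = n.+1%:R * f ^+ n * fps_deriv f.
Proof.
elim: n => [|n IHn]; first by rewrite expr0 expr1 !mul1r.
by rewrite exprS fps_derivM {}IHn exprS -!natr1; ring.
Qed.

Lemma fps_deriv_inv f : f \is a GRing.unit ->
  fps_deriv f^-1 = - f^-1 ^+ 2 * fps_deriv f.
Proof.
move=> fu; apply: (mulrI fu).
have /eqP := congr1 fps_deriv (mulrV fu).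
rewrite fps_derivM fps_deriv1 addrC addr_eq0 => /eqP ->.
by rewrite expr2 mulNr mulrN !mulrA mulrV // mul1r mulrC.
Qed.

Lemma coefs_exp_low f k n : coefs f 0 = 0 -> (n < k)%N -> coefs (f ^+ k) n = 0.
Proof.
move=> f0; elim: k n => // k IHk n; rewrite ltnS => lenk.
rewrite exprS coefsM big1 // => -[i lti] _ /=.
case: i lti => [|i] lti; first by rewrite f0 mul0r.
by rewrite IHk ?mulr0 //; lia.
Qed.

End FpsCoef.

(** * Differential equations and exponential generating functions *)

Section FpsAnalysis.
Variable F : numFieldType.
Implicit Types f g : fps F.

(** Termwise, (f^k / k!)' = f' f^(k-1) / (k-1)!. The two sides truncate the sum over k at different
    degrees; the surplus terms vanish because f^k starts in degree k. *)
Lemma fps_deriv_exp f : coefs f 0 = 0 ->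
  fps_deriv (fps_exp f) = fps_deriv f * fps_exp f.
Proof.
move=> f0; apply: fpsP => n.
transitivity (\sum_(k < n.+1) coefs (fps_deriv f * f ^+ k) n / (k`!)%:R).
  rewrite /= big_ord_recl expr0 coefs1 /= mul0r add0r mulr_sumr.
  apply: eq_bigr => k _.
  have := congr1 (fun h => coefs h n) (fps_derivX_exp f k).
  rewrite -mulrA (mulrC (f ^+ k)) -(rmorph_nat (@fpsC F)) coefsCM => /= e.
  rewrite /bump add1n mulrA e factS natrM invfM mulrACA.
  by rewrite mulfV ?mul1r // pnatr_eq0.
rewrite coefsM /=.
transitivity (\sum_(i < n.+1) \sum_(k < n.+1)
   coefs (fps_deriv f) i * (coefs (f ^+ k) (n - i) / (k`!)%:R)).
  rewrite exchange_big; apply: eq_bigr => k _; rewrite mulr_suml.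
  by apply: eq_bigr => i _; rewrite mulrA.
apply: eq_bigr => i _; rewrite -mulr_sumr; congr (_ * _).
rewrite [RHS](big_ord_widen n.+1 (fun k => coefs (f ^+ k) (n - i) / (k`!)%:R));
  last by lia.
rewrite [LHS](bigID (fun k : 'I_n.+1 => (k < (n - i).+1)%N)) /=.
rewrite [X in _ + X]big1 ?addr0 // => k; rewrite ltnS -ltnNge => lt_k.
by rewrite coefs_exp_low // mul0r.
Qed.

Lemma fps_exp0 f : coefs (fps_exp f) 0 = 1.
Proof. by rewrite /= big_ord1 expr0 /= fact0 divr1. Qed.

(** The equation gives n+1 times the coefficient n+1 in terms of the earlier ones. *)
Lemma fps_ode_unique (r f g : fps F) : coefs f 0 = coefs g 0 ->
  fps_deriv f = r * f -> fps_deriv g = r * g -> f = g.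
Proof.
move=> fg0 df dg; apply: fpsP; elim/ltn_ind => -[//|n] IHn.
apply: (@mulfI _ n.+1%:R); first by rewrite pnatr_eq0.
have := congr1 (fun h => coefs h n) df; have := congr1 (fun h => coefs h n) dg.
rewrite !coefsM /= => -> ->; apply: eq_bigr => i _; rewrite IHn //; lia.
Qed.

Definition egf (u : nat -> F) : fps F := FPS (fun n => u n / (n`!)%:R).

Lemma egf_deriv u : fps_deriv (egf u) = egf (fun n => u n.+1).
Proof.
apply: fpsP => n /=; rewrite factS natrM invfM mulrCA.
by rewrite mulVKf ?pnatr_eq0.
Qed.

Lemma egfD u v : egf (fun n => u n + v n) = egf u + egf v.
Proof. by apply: fpsP => n /=; rewrite mulrDl. Qed.
Lemma egfB u v : egf (fun n => u n - v n) = egf u - egf v.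
Proof. by apply: fpsP => n /=; rewrite mulrBl. Qed.
Lemma egfZ c u : egf (fun n => c * u n) = fpsC c * egf u.
Proof. by apply: fpsP => n; rewrite coefsCM /= mulrA. Qed.

(** The factor n+1, the number of sites that can be removed, cancels against the factorial: the loss
    of one site becomes a multiplication by the variable. *)
Lemma egf_shift u v : u 0%N = 0 -> (forall n, u n.+1 = n.+1%:R * v n) ->
  egf u = fpsX F * egf v.
Proof.
move=> u0 uv; apply: fpsP => -[|n]; rewrite coefsXM /= ?u0 ?mul0r // uv.
by rewrite factS natrM invfM mulrACA mulfV ?mul1r ?pnatr_eq0.
Qed.

End FpsAnalysis.

(** * Closed form of the generating function *)

(** [M + a J] is the Schur complement of the corner in the matrix bordering [M] with corner 1, row
    [- a] and column 1; [det_site] expands the same determinant along its border. *)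
Lemma det_rank_one (F : fieldType) n (M : 'M[F]_n) a :
  \det (M + a *: const_mx 1) = \det M + a * \sum_i \sum_j cof M i j.
Proof.
have := det_site ord0 1 (fun=> - a) (fun=> 1) M.
have -> : \det (bordered_mx ord0 1 (fun=> - a) (fun=> 1) M)
  = \det (M + a *: const_mx 1).
  (* Multiplying by this matrix on the left subtracts the border row from all others: it clears the
     column and adds [a] to every entry of the block. *)
  have d1 : \det (bordered_mx ord0 (1 : F) (fun=> 0) (fun=> - 1) (1%:M : 'M[F]_n)) = 1.
    by rewrite det_bordered_row0 // det1 mulr1.
  rewrite -[LHS]mul1r -{1}d1 -det_mulmx mul_bordered_mx det_bordered_col0 => [|k /=].
    rewrite big1 ?addr0 ?mulr1 ?mul1r => [|j _]; last by rewrite ?mul0r.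
    congr (\det _); rewrite mul1mx addrC; congr (_ + _).
    by apply/matrixP => k l; rewrite !mxE mulrNN mul1r mulr1.
  rewrite (bigD1 k) //= mxE eqxx !mulr1 big1 ?addr0 ?addNr // => j /negbTE jk.
  by rewrite mxE eq_sym jk mul0r.
move=> ->; rewrite mul1r exchange_big mulr_sumr -sumrN; congr (_ + _).
apply: eq_bigr => i _; rewrite mulr_sumr -sumrN; apply: eq_bigr => j _.
by rewrite mulr1 mulNr opprK.
Qed.

Section ClosedForm.
Variable F : numFieldType.
Local Notation T := (fpsX F).
Implicit Types (s d e x y : fps F).

Lemma fps_unit_subX (f : fps F) : 1 - f * T \is a GRing.unit.
Proof.
by rewrite fps_unitE coefsD coefsN coefs0M /= mulr0 subr0 oner_eq0.
Qed.

Lemma fps_unit_subX2 (f : fps F) : 1 - f * T ^+ 2 \is a GRing.unit.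
Proof. by rewrite expr2 mulrA fps_unit_subX. Qed.

Lemma fps_two_unit : (2 : fps F) \is a GRing.unit.
Proof. by rewrite -(rmorph_nat (@fpsC F)) fps_unitE /= pnatr_eq0. Qed.

Lemma unit_solve (f x y : fps F) : f \is a GRing.unit -> f * x = y -> x = y * f^-1.
Proof. by move=> fu <-; rewrite mulrC mulKr. Qed.

(** The exchange of [c1] and [c2] makes a two by two system, whose determinant is the denominator
    [1 - s ^+ 2 * T ^+ 2] of the closed form. *)
Lemma solve_swap s c1 c2 x y e :
  x = T * (c2 * e - s * y) -> y = T * (c1 * e - s * x) ->
  x = (c2 * T - s * c1 * T ^+ 2) * (1 - s ^+ 2 * T ^+ 2)^-1 * e.
Proof.
move=> ex ey; rewrite mulrAC; apply: unit_solve (fps_unit_subX2 _) _.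
by rewrite mulrBl mul1r {1}ex {1}ey; ring.
Qed.

Lemma solve_swap_source s c1 c2 k g x y e :
  x = T * (k * e + c2 * g - s * y) -> y = T * (c1 * g - s * x) ->
  x = (k * T * e + (c2 * T - s * c1 * T ^+ 2) * g) * (1 - s ^+ 2 * T ^+ 2)^-1.
Proof.
move=> ex ey; apply: unit_solve (fps_unit_subX2 _) _.
by rewrite mulrBl mul1r {1}ex {1}ey; ring.
Qed.

(** For the two values of [s] in use this gives the linear factors of 1 - 2 mu_2 t + (mu_2^2 -
    nu_2^2) t^2. *)
Lemma solve_loop s k x e :
  x = T * (k * e + s * x) -> x = k * T * (1 - s * T)^-1 * e.
Proof.
move=> ex; rewrite mulrAC; apply: unit_solve (fps_unit_subX _) _.
by rewrite mulrBl mul1r {1}ex; ring.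
Qed.

Lemma fps_deriv_nat n : fps_deriv (n%:R : fps F) = 0.
Proof. by rewrite -(rmorph_nat (@fpsC F)) fps_derivC. Qed.

Lemma fps_deriv_half : fps_deriv (2^-1 : fps F) = 0.
Proof. by rewrite fps_deriv_inv ?fps_two_unit // fps_deriv_nat mulr0. Qed.

Lemma fps_deriv_sqrt (f : fps F) : coefs f 0 = 1 ->
  2 * fps_sqrt f * fps_deriv (fps_sqrt f) = fps_deriv f.
Proof.
move=> f0; have two0 : (2 : F) != 0 by rewrite pnatr_eq0.
by rewrite -[in RHS](fps_sqrtK two0 f0) fps_derivX_exp expr1.
Qed.

(** * The logarithmic derivative of Q and the partial fractions of P *)

Section LogDerivative.
Variables mu2 mu3 mu4 nu2 nu4 k2 a1 a2 c1 c2 : F.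
Local Notation C := (@fpsC F).
Let s := C (mu2 + nu2).
Let d := C (mu2 - nu2).
Let u := (1 - s ^+ 2 * T ^+ 2)^-1.
Let v := (1 - d * T)^-1.
Let w := (1 - s * T)^-1.
Let m4 := C (mu4 + 2 * mu2 * nu2 + nu4).

Let u_def : u * (s ^+ 2 * T ^+ 2) = u - 1.
Proof.
have := mulVr (fps_unit_subX2 (s ^+ 2)).
by rewrite -/u mulrBr mulr1 => <-; ring.
Qed.

Let v_def : v * (d * T) = v - 1.
Proof. by have := mulVr (fps_unit_subX d); rewrite -/v mulrBr mulr1 => <-; ring. Qed.

Let w_def : w * (s * T) = w - 1.
Proof. by have := mulVr (fps_unit_subX s); rewrite -/w mulrBr mulr1 => <-; ring. Qed.

Let du : fps_deriv u = u ^+ 2 * (2 * s ^+ 2 * T).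
Proof.
rewrite fps_deriv_inv ?fps_unit_subX2 // -/u.
rewrite fps_derivD fps_deriv1 fps_derivN fps_derivM -rmorphXn fps_derivC.
by rewrite expr2 fps_derivM fps_derivX rmorphXn -/s; ring.
Qed.

Let L := T * (C c1 * C c2 + C k2 - 2 * C mu2)
  + T ^+ 2 / 2 * (C mu4 - 3 * C nu2 ^+ 2 - 3 * C mu2 ^+ 2 + C nu4)
  - T ^+ 2 / 2 * ((C c1 ^+ 2 + C c2 ^+ 2) * s * u)
  + C c1 * C c2 * s ^+ 2 * T ^+ 3 * u.

Let half : (2 : fps F) * 2^-1 = 1.
Proof. by rewrite mulrV ?fps_two_unit. Qed.

Let dL : fps_deriv L = C c1 * C c2 + C k2 - 2 * C mu2
  + T * (C mu4 - 3 * C nu2 ^+ 2 - 3 * C mu2 ^+ 2 + C nu4)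
  - T * ((C c1 ^+ 2 + C c2 ^+ 2) * s * u)
  - T ^+ 2 * ((C c1 ^+ 2 + C c2 ^+ 2) * s * (u ^+ 2 * (s ^+ 2 * T)))
  + C c1 * C c2 * s ^+ 2 * (3 * T ^+ 2 * u + T ^+ 3 * (u ^+ 2 * (2 * s ^+ 2 * T))).
Proof.
(* Constants are gathered under [C] and the halves pulled out in front, so that [fps_derivC] and
   [fps_deriv_half] apply. *)
have -> : L = T * C (c1 * c2 + k2 - 2 * mu2)
  + 2^-1 * (T ^+ 2 * C (mu4 - 3 * nu2 ^+ 2 - 3 * mu2 ^+ 2 + nu4))
  + 2^-1 * (- T ^+ 2 * (C ((c1 ^+ 2 + c2 ^+ 2) * (mu2 + nu2)) * u))
  + C (c1 * c2 * (mu2 + nu2) ^+ 2) * (T ^+ 3 * u).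
  by rewrite /L /s; ring.
have e1 k : fps_deriv (2^-1 * (T ^+ 2 * C k)) = T * C k.
  rewrite !(fps_derivM, fps_derivC, fps_deriv_half, fps_derivX).
  by transitivity (2 * 2^-1 * (T * C k)); [ring | rewrite half mul1r].
have e2 k : fps_deriv (2^-1 * (- T ^+ 2 * (C k * u))) =
    - (T * (C k * u)) - T ^+ 2 * (C k * (u ^+ 2 * (s ^+ 2 * T))).
  rewrite !(fps_derivM, fps_derivN, fps_derivC, fps_deriv_half, fps_derivX, du).
  transitivity (2 * 2^-1 *
    (- (T * (C k * u)) - T ^+ 2 * (C k * (u ^+ 2 * (s ^+ 2 * T))))).
    by ring.
  by rewrite half mul1r.
rewrite !fps_derivD e1 e2 !(fps_derivM, fps_derivC, fps_derivX_exp, fps_derivX, du).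
by rewrite /s; ring.
Qed.

(* The logarithmic derivative of [H2_Q]. *)
Definition rate := C k2 + C c1 * C c2
  - C c1 * s * ((C c1 * T - s * C c2 * T ^+ 2) * u)
  - C c2 * s * ((C c2 * T - s * C c1 * T ^+ 2) * u)
  + s ^+ 2 * ((T + (C c2 * T - s * C c1 * T ^+ 2) *
                   ((C c1 * T - s * C c2 * T ^+ 2) * u)) * u + T * w)
  + d ^+ 2 * (T * v) + (m4 - 2 * s ^+ 2 - d ^+ 2) * T.

(** The four terms are the logarithmic derivatives of the exponential, of the two linear
    denominators and of the inverse square root. *)
Lemma rateE : rate = fps_deriv L + s * w + d * v + s ^+ 2 * T * u.
Proof.
rewrite dL /rate /m4.
have sw : s ^+ 2 * (T * w) = s * w - s by rewrite -[X in _ - X]mulr1 -mulrBr -w_def;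
  ring.
have dv : d ^+ 2 * (T * v) = d * v - d by rewrite -[X in _ - X]mulr1 -mulrBr -v_def;
  ring.
rewrite mulrDr sw dv.
have m4E : C (mu4 + 2 * mu2 * nu2 + nu4) - 2 * s ^+ 2 - d ^+ 2 =
    C mu4 - 3 * C nu2 ^+ 2 - 3 * C mu2 ^+ 2 + C nu4 by rewrite /s /d; ring.
have sd : 2 * C mu2 = s + d by rewrite /s /d; ring.
rewrite m4E sd; move: (C mu4 - _ - _ + _) u_def => K.
(* With the series generalised, the only relation left is the one that defines the inverse [u]. *)
move: s d u v w (C k2) (C c1) (C c2) T => s' d' u' v' w' k' x y t hu.
have hu' : u' * s' ^+ 2 * t ^+ 2 = u' - 1 by rewrite -mulrA.
ring: hu'.
Qed.

Let D := 1 - s ^+ 2 * T ^+ 2.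
Let q := fps_exp L * (v * w * (fps_sqrt D)^-1).

Let D0 : coefs D 0 = 1.
Proof. by rewrite coefsD coefsN coefs0M [coefs (T ^+ 2) 0]coefs0M /= !mulr0 subr0. Qed.

Let dvE : fps_deriv v = v ^+ 2 * d.
Proof.
rewrite fps_deriv_inv ?fps_unit_subX // -/v.
by rewrite !(fps_derivD, fps_deriv1, fps_derivN, fps_derivM, fps_derivC, fps_derivX);
  ring.
Qed.

Let dwE : fps_deriv w = w ^+ 2 * s.
Proof.
rewrite fps_deriv_inv ?fps_unit_subX // -/w.
by rewrite !(fps_derivD, fps_deriv1, fps_derivN, fps_derivM, fps_derivC, fps_derivX);
  ring.
Qed.

Let sqrt_unit : fps_sqrt D \is a GRing.unit.
Proof. by rewrite fps_unitE fps_sqrt0 oner_eq0. Qed.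

Let drE : fps_deriv (fps_sqrt D)^-1 = (fps_sqrt D)^-1 * (s ^+ 2 * T * u).
Proof.
have two0 : (2 : F) != 0 by rewrite pnatr_eq0.
have uE : u = (fps_sqrt D)^-1 ^+ 2 by rewrite exprVn (fps_sqrtK two0 D0).
have dr : fps_deriv (fps_sqrt D) = (fps_sqrt D)^-1 * (- (s ^+ 2 * T)).
  apply: (mulrI sqrt_unit); rewrite mulrA mulrV // mul1r.
  apply: (mulrI fps_two_unit); rewrite mulrA fps_deriv_sqrt // /D expr2.
  rewrite !(fps_derivD, fps_deriv1, fps_derivN, fps_derivM, fps_derivC, fps_derivX).
  by ring.
by rewrite fps_deriv_inv // dr uE; ring.
Qed.

Let q_ode : fps_deriv q = rate * q.
Proof.
rewrite rateE /q fps_derivM fps_deriv_exp; last first.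
  by rewrite /L !(coefsD, coefsN, coefs0M) /= !(mul0r, mulr0, addr0, oppr0).
by rewrite !fps_derivM dvE dwE drE; ring.
Qed.

Let q0 : coefs q 0 = 1.
Proof.
rewrite /q coefs0M fps_exp0 !coefs0M mul1r.
have inv0 (f : fps F) : coefs f 0 = 1 -> coefs f^-1 0 = 1.
  move=> f0; have fu : f \is a GRing.unit by rewrite fps_unitE f0 oner_eq0.
  by rewrite -[LHS]mul1r -{1}f0 -coefs0M mulrV.
rewrite !inv0 ?mulr1 //; rewrite coefsD coefsN coefs0M /= mulr0 subr0 //.
Qed.

Lemma H2_QE : H2_Q T (C mu2) (C mu4) (C nu2) (C nu4) (C k2) (C c1) (C c2) = q.
Proof.
rewrite /H2_Q /q -[C mu2 + C nu2]rmorphD -/s -/D -/u -/L; congr (_ * _).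
have -> : 1 - 2 * C mu2 * T + (C mu2 ^+ 2 - C nu2 ^+ 2) * T ^+ 2 =
          (1 - d * T) * (1 - s * T) by rewrite /d /s; ring.
by rewrite !invrM ?unitrM ?fps_unit_subX //= mulrC (mulrC w).
Qed.

Lemma H2_Q_unique e : coefs e 0 = 1 -> fps_deriv e = rate * e ->
  e = H2_Q T (C mu2) (C mu4) (C nu2) (C nu4) (C k2) (C c1) (C c2).
Proof.
by move=> e0 e_ode; rewrite H2_QE; apply: fps_ode_unique q_ode; rewrite ?e0 ?q0.
Qed.

(** P in the shape in which the recurrences deliver it: [g1] and [g2] belong to one determinant
    times all cofactors of the other matrix, the last bracket to the product of two cofactor
    sums. *)
Lemma H2_PE : H2_P T (C mu2) (C mu3) (C nu2) (C a1) (C a2) (C c1) (C c2) =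
  let y1 := (C c2 * T - s * C c1 * T ^+ 2) * u in
  let y2 := (C c1 * T - s * C c2 * T ^+ 2) * u in
  let g1 := y1 + C mu3 * T ^+ 2 in
  let g2 := y2 + C mu3 * T ^+ 2 in
  1 + C a1 * g1 + C a2 * g2 + C a1 * C a2 *
   ((T + (C c2 * T - s * C c1 * T ^+ 2) * g2) * u
    + T * (d * (T * v) + s * (T * w)) + C mu3 * T ^+ 2 * g2).
Proof.
rewrite /H2_P -[C mu2 + C nu2]rmorphD -/s -/u /=.
have -> : 1 - 2 * C mu2 * T + (C mu2 ^+ 2 - C nu2 ^+ 2) * T ^+ 2 =
          (1 - d * T) * (1 - s * T) by rewrite /d /s; ring.
rewrite !invrM ?unitrM ?fps_unit_subX //= -/v -/w.
(* Partial fractions: 2 mu_2 = s + d and mu_2^2 - nu_2^2 = s d. *)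
have vwE : 2 * T ^+ 2 * (C mu2 - C mu2 ^+ 2 * T + C nu2 ^+ 2 * T) * (w * v) =
   T * (d * (T * v) + s * (T * w)).
  have -> : 2 * T ^+ 2 * (C mu2 - C mu2 ^+ 2 * T + C nu2 ^+ 2 * T) =
    T ^+ 2 * (d * (1 - s * T) + s * (1 - d * T)) by rewrite /d /s; ring.
  have wK : (1 - s * T) * w = 1 by rewrite mulrV // fps_unit_subX.
  have vK : (1 - d * T) * v = 1 by rewrite mulrV // fps_unit_subX.
  transitivity (T ^+ 2 * (d * v * ((1 - s * T) * w) + s * w * ((1 - d * T) * v))).
    by ring.
  by rewrite wK vK; ring.
rewrite vwE.
by rewrite /s; ring.
Qed.

End LogDerivative.

End ClosedForm.

(** * From the recurrences to P and Q *)

Section GeneratingFunction.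
Variables (F : numFieldType) (U : finType) (wp wd zp zm zd : U -> F).
Variables (mu2 mu3 mu4 nu2 nu4 k2 : F).
Local Notation T := (fpsX F).
Local Notation K := (@fpsC F).
Local Notation Ex := (model_mean wp wd zp zm zd).
Local Notation mom := (pair_moment wp zp zm).
Let sg := mu2 + nu2.
Let dl := mu2 - nu2.
Let m4 := mu4 + 2 * mu2 * nu2 + nu4.
Hypothesis wd1 : \sum_u wd u = 1.
Hypothesis wdz : \sum_u wd u * zd u = 0.
Hypothesis wdz2 : \sum_u wd u * zd u ^+ 2 = k2.
Hypothesis wp1 : \sum_u wp u = 1.
Hypothesis mom10 : forall o, mom o 1 0 = 0.
Hypothesis mom01 : forall o, mom o 0 1 = 0.
Hypothesis mom11 : forall o, mom o 1 1 = sg.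
Hypothesis mom20 : forall o, mom o 2 0 = dl.
Hypothesis mom02 : forall o, mom o 0 2 = dl.
Hypothesis mom22 : forall o, mom o 2 2 = m4.
Hypothesis mom12 : mom true 1 2 + mom false 1 2 = mu3 *+ 2.

Local Notation seqE := (det_det wp wd zp zm zd).
Local Notation seqG := (det_cof wp wd zp zm zd).
Local Notation seqS := (diag_cof_cof wp wd zp zm zd).
Local Notation seqX := (det_cof2 wp wd zp zm zd).
Local Notation seqV := (cof_cof_row wp wd zp zm zd).
Local Notation seqW := (cof_cof_cross wp wd zp zm zd).
Local Notation seqGoff := (off_cof_det wp wd zp zm zd).
Local Notation seqBoff := (off_cof_cof wp wd zp zm zd).

Let two0 : (2 : F) != 0. Proof. by rewrite pnatr_eq0. Qed.

Variables (c1 c2 : F).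
Let e := egf (seqE c1 c2).
Let s := K sg.
Let d := K dl.
Let u := (1 - s ^+ 2 * T ^+ 2)^-1.
Let y1 := (K c2 * T - s * K c1 * T ^+ 2) * u.
Let y2 := (K c1 * T - s * K c2 * T ^+ 2) * u.

Let egfE_C : egf (seqE c2 c1) = e.
Proof. by apply: fpsP => n /=; rewrite det_det_sym. Qed.

Let egfG1 : egf (seqG 0 1 c2 c1) = T * (K c2 * e - s * egf (seqG 0 1 c1 c2)).
Proof.
rewrite -egfE_C -!egfZ -egfB; apply: egf_shift => [|n].
  by rewrite /det_cof big_ord0.
exact: det_cof_rec.
Qed.

Let egfG2 : egf (seqG 0 1 c1 c2) = T * (K c1 * e - s * egf (seqG 0 1 c2 c1)).
Proof.
rewrite -!egfZ -egfB; apply: egf_shift => [|n].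
  by rewrite /det_cof big_ord0.
exact: det_cof_rec.
Qed.

Let y1E : egf (seqG 0 1 c2 c1) = y1 * e.
Proof. exact: solve_swap egfG1 egfG2. Qed.

Let y2E : egf (seqG 0 1 c1 c2) = y2 * e.
Proof. exact: solve_swap egfG2 egfG1. Qed.

Lemma egfSX al be : egf (seqS al be c1 c2) =
  (K (al + be) * T * e + (K c2 * T - s * K c1 * T ^+ 2) * egf (seqG al be c1 c2)) * u.
Proof.
apply: (@solve_swap_source F s (K c1) (K c2) _ _ _ (egf (seqX al be c1 c2))).
  rewrite -!egfZ -egfD -egfB; apply: egf_shift => [|n]; last exact: diag_cof_cof_rec.
  by rewrite /diag_cof_cof big_ord0.
rewrite -!egfZ -egfB; apply: egf_shift => [|n]; last exact: det_cof2_rec.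
by rewrite /det_cof2 big_ord0.
Qed.

Lemma egfV al be : egf (seqV al be c1 c2) = K (al + be) * T * (1 - d * T)^-1 * e.
Proof.
apply: solve_loop; rewrite -!egfZ -egfD; apply: egf_shift => [|n].
  by rewrite /cof_cof_row big_ord0.
exact: cof_cof_row_rec.
Qed.

Lemma egfW al be : egf (seqW al be c1 c2) = K (al + be) * T * (1 - s * T)^-1 * e.
Proof.
apply: solve_loop; rewrite -!egfZ -egfD; apply: egf_shift => [|n].
  by rewrite /cof_cof_cross big_ord0.
exact: cof_cof_cross_rec.
Qed.

Let seqE_ode : fps_deriv e = rate mu2 mu4 nu2 nu4 k2 c1 c2 * e.
Proof.
pose Q n := \sum_k Ex (fun M : 'M[F]_n => cof (M + c1%:M) k k * cof (M + c2%:M) k k).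
have QE : egf Q = T * e.
  apply: egf_shift => [|n]; first by rewrite /Q big_ord0.
  exact: diag_cof_cof_coincide.
have -> : fps_deriv e = (K k2 + K c1 * K c2) * e - K c1 * s * egf (seqG 0 1 c1 c2)
   - K c2 * s * egf (seqG 0 1 c2 c1)
   + s ^+ 2 * (egf (seqS 0 1 c1 c2) + egf (seqW 0 1 c1 c2))
   + d ^+ 2 * egf (seqV 0 1 c1 c2) + (K m4 - 2 * s ^+ 2 - d ^+ 2) * egf Q.
  have -> : K m4 - 2 * s ^+ 2 - d ^+ 2 = K (m4 - 2 * sg ^+ 2 - dl ^+ 2).
    by rewrite /s /d; ring.
  rewrite /s /d -!rmorphXn -!rmorphM -rmorphD.
  rewrite -egfD -!egfZ -!egfB -!egfD egf_deriv; congr egf.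
  apply/boolp.funext => n.
  by rewrite (det_det_rec wd1 wdz wdz2 wp1 mom10 mom01 mom11 mom20 mom02 mom22).
rewrite egfSX egfV egfW y1E y2E QE /rate add0r rmorph1 -/s -/d -/u /y1 /y2 -/m4.
by rewrite -/sg -/dl -/s -/d -/u; ring.
Qed.

Let seqE0 : coefs e 0 = 1.
Proof.
rewrite /= /det_det /model_mean fact0 divr1.
rewrite (eq_bigr (fun=> 1)) => [|w _]; last first.
  by rewrite /weight big_ord0 !det_mx00 !mulr1.
by rewrite sumr_const (card_mx U 0 0) mul0n expn0.
Qed.

Let eE : e = H2_Q T (K mu2) (K mu4) (K nu2) (K nu4) (K k2) (K c1) (K c2).
Proof. exact: H2_Q_unique. Qed.

Let egfGoff c c' : egf (seqGoff c c') = K mu3 * T ^+ 2 * egf (seqE c c').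
Proof.
apply: fpsP => n; rewrite -mulrA coefsCM expr2 -mulrA coefsXM.
case: n => [|n]; first by rewrite /= (off_cof_det_small _ _ _ _ _ c c' (isT : 0 <
  2)%N) mul0r mulr0.
rewrite coefsXM; case: n => [|n].
  by rewrite /= (off_cof_det_small _ _ _ _ _ c c' (isT : 1 < 2)%N) mul0r mulr0.
rewrite /= (off_cof_det_rec zd two0 wd1 wp1 mom10 mom01 mom12) !factS !natrM.
rewrite !invfM; by field; rewrite nat1r -(natrD _ 2 n) !pnatr_eq0 -lt0n fact_gt0.
Qed.

(** [off_cof_det] has its factors in the opposite order, hence the exchange of [c] and [c']. *)
Let seqG_split c c' n : seqG 1 0 c c' n = seqG 0 1 c c' n + seqGoff c' c n.
Proof.
rewrite /seqGoff sum_diag_off -det_cof_diagC addrCA addrN addr0.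
rewrite /det_cof sum_probe_all; do 2!apply: eq_bigr => ? _.
by apply: eq_Ex => M; rewrite mulrC.
Qed.

Let egfG c c' : egf (seqG 1 0 c c') = egf (seqG 0 1 c c') + egf (seqGoff c' c).
Proof. by apply: fpsP => n /=; rewrite seqG_split mulrDl. Qed.

Let egfBoff : egf (seqBoff c1 c2) = T * (d * egf (seqV 1 0 c1 c2)
  + s * egf (seqW 1 0 c1 c2))
  + K mu3 * T ^+ 2 * egf (seqG 1 0 c1 c2).
Proof.
rewrite -!egfZ -egfD; apply: fpsP => n;
  rewrite coefsD coefsXM -mulrA coefsCM expr2 -mulrA coefsXM.
case: n => [|n].
  by rewrite /= (off_cof_cof_small _ _ _ _ _ c1 c2 (isT : 0 < 2)%N) mul0r mulr0 addr0.
rewrite coefsXM; case: n => [|n].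
  rewrite /= (off_cof_cof_small _ _ _ _ _ c1 c2 (isT : 1 < 2)%N)
    /cof_cof_row /cof_cof_cross !big_ord0.
  by rewrite !mulr0 !addr0 !mul0r.
rewrite /= (off_cof_cof_rec zd two0 wd1 wp1 mom10 mom01 mom11 mom02 mom12)
  !factS !natrM.
by field; rewrite nat1r -(natrD _ 2 n) !pnatr_eq0 -lt0n fact_gt0.
Qed.

Theorem finite_model_egf (a1 a2 : F) :
  egf (fun n => Ex (fun M : 'M[F]_n => \det (M + a1 *: const_mx 1 + c1%:M) *
                                   \det (M + a2 *: const_mx 1 + c2%:M))) =
  H2_P T (K mu2) (K mu3) (K nu2) (K a1) (K a2) (K c1) (K c2) *
  H2_Q T (K mu2) (K mu4) (K nu2) (K nu4) (K k2) (K c1) (K c2).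
Proof.
transitivity (e + K a1 * egf (seqG 1 0 c2 c1) + K a2 * egf (seqG 1 0 c1 c2)
  + K a1 * K a2 * (egf (seqS 1 0 c1 c2) + egf (seqBoff c1 c2))).
  rewrite -rmorphM -egfD -!egfZ -!egfD; congr egf; apply/boolp.funext => n.
  transitivity (Ex (fun M : 'M[F]_n => \det (M + c1%:M) * \det (M + c2%:M)
     + a1 * (\sum_k \sum_l \det (M + c2%:M) * cof (M + c1%:M) k l)
     + a2 * (\sum_k \sum_l \det (M + c1%:M) * cof (M + c2%:M) k l)
     + a1 * a2 * (\sum_i \sum_j \sum_k \sum_l cof (M + c1%:M) i j * cof (M + c2%:M)
       k l))).
    apply: eq_Ex => M; rewrite ![M + _ + _%:M]addrAC !det_rank_one.
    have -> : \sum_k \sum_l \det (M + c2%:M) * cof (M + c1%:M) k l =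
        \det (M + c2%:M) * \sum_k \sum_l cof (M + c1%:M) k l.
      by rewrite mulr_sumr; apply: eq_bigr => k _; rewrite mulr_sumr.
    have -> : \sum_k \sum_l \det (M + c1%:M) * cof (M + c2%:M) k l =
        \det (M + c1%:M) * \sum_k \sum_l cof (M + c2%:M) k l.
      by rewrite mulr_sumr; apply: eq_bigr => k _; rewrite mulr_sumr.
    have -> : \sum_i \sum_j \sum_k \sum_l cof (M + c1%:M) i j * cof (M + c2%:M) k l =
       (\sum_k \sum_l cof (M + c1%:M) k l) * \sum_k \sum_l cof (M + c2%:M) k l.
      rewrite mulr_suml; apply: eq_bigr => i _; rewrite mulr_suml.
      apply: eq_bigr => j _; rewrite mulr_sumr.
      by apply: eq_bigr => k _; rewrite mulr_sumr.
    by ring.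
  rewrite !ExD !ExZ; congr (_ + _ * _ + _ * _ + _ * _).
  - rewrite Ex_sum /det_cof sum_probe_all; apply: eq_bigr => k _.
    by rewrite Ex_sum.
  - rewrite Ex_sum /det_cof sum_probe_all; apply: eq_bigr => k _.
    by rewrite Ex_sum.
  rewrite Ex_sum /diag_cof_cof /off_cof_cof -big_split; apply: eq_bigr => i _ /=.
  rewrite sum_probe_all Ex_sum (bigD1 i) //=; congr (_ + _).
    by rewrite Ex_sum; apply: eq_bigr => k _; rewrite Ex_sum.
  apply: eq_bigr => j _; rewrite Ex_sum; apply: eq_bigr => k _.
  by rewrite Ex_sum.
rewrite -eE H2_PE !egfG !egfGoff egfE_C egfSX egfG egfBoff egfG egfV egfW.
rewrite !egfGoff !egfE_C y1E y2E addr0 rmorph1 -/sg -/dl -/s -/d -/u -/e /y1 /y2 /=.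
by ring.
Qed.

End GeneratingFunction.

(** * Change of coefficient field *)

(** The difference of the two roots is killed by their sum, a unit since its constant term is 2. *)
Lemma fps_sqrt_unique (F : numFieldType) (f g : fps F) :
  coefs g 0 = 1 -> g ^+ 2 = f -> g = fps_sqrt f.
Proof.
move=> g0 gf; have two0 : (2 : F) != 0 by rewrite pnatr_eq0.
have f0 : coefs f 0 = 1 by rewrite -gf [coefs _ 0]coefs0M g0 mulr1.
apply/eqP; rewrite -subr_eq0; apply/eqP.
have gu : g + fps_sqrt f \is a GRing.unit.
  by rewrite fps_unitE coefsD g0 fps_sqrt0.
apply: (mulIr gu); rewrite mul0r -subr_sqr.
by rewrite gf fps_sqrtK // subrr.
Qed.

Section FpsMap.
Variables (F G : numFieldType) (h : {rmorphism F -> G}).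
Implicit Types f g : fps F.

Lemma fps_map_is_zmod_morphism : zmod_morphism (fps_map h).
Proof. by move=> f g; apply: fpsP => n; rewrite /= rmorphB. Qed.

Lemma fps_map_is_monoid_morphism : monoid_morphism (fps_map h).
Proof.
split; first by apply: fpsP => n; rewrite /= (fun_if h) rmorph1 rmorph0.
move=> f g; apply: fpsP => n; rewrite /= rmorph_sum; apply: eq_bigr => i _.
by rewrite rmorphM.
Qed.

HB.instance Definition _ := GRing.isZmodMorphism.Build (fps F) (fps G) (fps_map h)
  fps_map_is_zmod_morphism.
HB.instance Definition _ := GRing.isMonoidMorphism.Build (fps F) (fps G) (fps_map h)
  fps_map_is_monoid_morphism.

Lemma fps_mapC c : fps_map h (fpsC c) = fpsC (h c).
Proof. by apply: fpsP => n; rewrite /= (fun_if h) rmorph0. Qed.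

Lemma fps_mapX : fps_map h (fpsX F) = fpsX G.
Proof. by apply: fpsP => n; rewrite /= rmorph_nat. Qed.

Lemma fps_map_exp f : fps_map h (fps_exp f) = fps_exp (fps_map h f).
Proof.
apply: fpsP => n; rewrite /= rmorph_sum; apply: eq_bigr => k _.
by rewrite fmorph_div rmorph_nat -rmorphXn.
Qed.

Lemma fps_map_sqrt f : coefs f 0 = 1 ->
  fps_map h (fps_sqrt f) = fps_sqrt (fps_map h f).
Proof.
move=> f0; apply: fps_sqrt_unique; first exact: rmorph1.
by rewrite -rmorphXn fps_sqrtK // pnatr_eq0.
Qed.

Let mapE := (fps_mapC, fps_mapX).

Lemma fps_map_H2_P mu2 mu3 nu2 a1 a2 c1 c2 :
  fps_map h (H2_P (fpsX F) (fpsC mu2) (fpsC mu3) (fpsC nu2)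
    (fpsC a1) (fpsC a2) (fpsC c1) (fpsC c2)) =
  H2_P (fpsX G) (fpsC (h mu2)) (fpsC (h mu3)) (fpsC (h nu2))
    (fpsC (h a1)) (fpsC (h a2)) (fpsC (h c1)) (fpsC (h c2)).
Proof.
(* [rmorphV] needs units; both denominators have constant term 1. *)
have u1 := fps_unit_subX2 ((fpsC mu2 + fpsC nu2 : fps F) ^+ 2).
have u2 : 1 - 2 * fpsC mu2 * fpsX F + (fpsC mu2 ^+ 2 - fpsC nu2 ^+ 2) * fpsX F ^+ 2
    \is a GRing.unit.
  by rewrite fps_unitE !(coefsD, coefsN, coefs0M) /= !(mulr0, oppr0, addr0) oner_eq0.
rewrite /H2_P !(rmorphD, rmorphN, rmorphXn, rmorphM, rmorph1, rmorph_nat) /=.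
rewrite !rmorphV //= !(rmorphD, rmorphN, rmorphXn, rmorphM, rmorph1, rmorph_nat) /=.
by rewrite !mapE.
Qed.

Lemma fps_map_H2_Q mu2 mu4 nu2 nu4 k2 c1 c2 :
  fps_map h (H2_Q (fpsX F) (fpsC mu2) (fpsC mu4) (fpsC nu2) (fpsC nu4)
    (fpsC k2) (fpsC c1) (fpsC c2)) =
  H2_Q (fpsX G) (fpsC (h mu2)) (fpsC (h mu4)) (fpsC (h nu2)) (fpsC (h nu4))
    (fpsC (h k2)) (fpsC (h c1)) (fpsC (h c2)).
Proof.
have u1 := fps_unit_subX2 ((fpsC mu2 + fpsC nu2 : fps F) ^+ 2).
have u2 : 1 - 2 * fpsC mu2 * fpsX F + (fpsC mu2 ^+ 2 - fpsC nu2 ^+ 2) * fpsX F ^+ 2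
    \is a GRing.unit.
  by rewrite fps_unitE !(coefsD, coefsN, coefs0M) /= !(mulr0, oppr0, addr0) oner_eq0.
have u3 : (1 - 2 * fpsC mu2 * fpsX F + (fpsC mu2 ^+ 2 - fpsC nu2 ^+ 2) * fpsX F ^+ 2)
    * fps_sqrt (1 - (fpsC mu2 + fpsC nu2) ^+ 2 * fpsX F ^+ 2) \is a GRing.unit.
  by rewrite unitrM u2 fps_unitE fps_sqrt0 oner_eq0.
have u4 := fps_two_unit F.
rewrite /H2_Q rmorphM rmorphV //= fps_map_exp [fps_map h (_ * fps_sqrt _)]rmorphM /=
  fps_map_sqrt; last first.
  by rewrite !(coefsD, coefsN, coefs0M) /= !(mulr0, oppr0, subr0).
have m2 : fps_map h 2^-1 = 2^-1 by rewrite rmorphV // rmorph_nat.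
have mD : fps_map h (1 - (fpsC mu2 + fpsC nu2) ^+ 2 * fpsX F ^+ 2)^-1 =
    (1 - (fpsC (h mu2) + fpsC (h nu2)) ^+ 2 * fpsX G ^+ 2)^-1.
  by rewrite rmorphV // rmorphB rmorph1 rmorphM !rmorphXn rmorphD /= !mapE.
rewrite !(rmorphD, rmorphN, rmorphXn, rmorphM, rmorph1, rmorph_nat) /= m2 mD.
by rewrite !mapE.
Qed.

End FpsMap.

(** * Expectation of products of independent variables *)

Section HasMean.
Local Open Scope classical_set_scope.
Context d (T : measurableType d) (R : realType) (P : {measure set T -> \bar R}).

(** Integrability travels with the value, so that linearity has no side conditions. *)
Definition has_mean (Y : T -> R) (v : R) : Prop :=
  P.-integrable setT (EFin \o Y) /\ (\int[P]_t (Y t)%:E)%E = v%:E.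

Lemma has_meanD Y Z v w : has_mean Y v -> has_mean Z w ->
  has_mean (fun t => Y t + Z t) (v + w).
Proof.
move=> [iY eY] [iZ eZ]; split; first exact: (integrableD measurableT iY iZ).
by rewrite EFinD -eY -eZ -integralD.
Qed.

Lemma has_meanZ c Y v : has_mean Y v -> has_mean (fun t => c * Y t) (c * v).
Proof.
move=> [iY eY]; split.
  by under [X in P.-integrable _ X]eq_fun do rewrite /= EFinM; exact: integrableZl.
by rewrite EFinM -eY -integralZl.
Qed.

Lemma has_meanB Y Z v w : has_mean Y v -> has_mean Z w ->
  has_mean (fun t => Y t - Z t) (v - w).
Proof.
move=> hY hZ; have := has_meanD hY (has_meanZ (-1) hZ).
by rewrite mulN1r; under eq_fun do rewrite mulN1r.
Qed.

End HasMean.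

(** * Factoring out one independent variable *)

Section OneFactor.
Local Open Scope classical_set_scope.
Context d (T : measurableType d) (R : realType) (P : {measure set T -> \bar R}).
Variables (X : T -> measurableTypeR R) (mX : measurable_fun setT X).
Variables (law : {measure set (measurableTypeR R) -> \bar R}).
Variables (G : T -> R) (c : R).

Section Nonneg.
Hypothesis mG : measurable_fun setT G.
Hypothesis G0 : forall t, 0 <= G t.
(** Independence of [X] and [G], tested on indicators of [X]; taking for [B] the whole line gives
    [c] as the integral of [G]. *)
Hypothesis indicG : forall B : set (measurableTypeR R), measurable B ->
  (\int[P]_t (\1_B (X t) * G t)%:E = law B * c%:E)%E.

Import HBNNSimple.

Let mfun_comp (f : measurableTypeR R -> R) : measurable_fun setT f ->
  measurable_fun setT (fun t => (f (X t) * G t)%:E).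
Proof.
move=> mf; apply/measurable_EFinP; apply: measurable_funM => //.
exact: (measurableT_comp mf mX).
Qed.

Let nnsfun_factor (h : {nnsfun (measurableTypeR R) >-> R}) :
  (\int[P]_t (h (X t) * G t)%:E = \int[law]_x (h x)%:E * c%:E)%E.
Proof.
pose A y := h @^-1` [set y].
have mA y : measurable (A y).
  by rewrite -[A y]setTI; apply: (@measurable_funP _ _ _ _ _ h) => //;
    exact: measurable_set1.
have A0 y x : 0 <= y * \1_(A y) x.
  by rewrite -lee_fin EFinM; exact: nnfun_muleindic_ge0.
have mA1 y : measurable_fun setT (\1_(A y) : measurableTypeR R -> R).
  exact: measurable_indic.
have myA1 y : measurable_fun setT (fun x : measurableTypeR R => y * \1_(A y) x : R).
  exact: measurable_funM.
have hE x : h x = \sum_(y <- finmap.enum_fset (fset_set (range h))) y * \1_(A y) x.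
  by rewrite [LHS]fimfunE fsbig_finite.
have y_factor y : (\int[P]_t (y * \1_(A y) (X t) * G t)%:E =
    \int[law]_x (y * \1_(A y) x)%:E * c%:E)%E.
  have [y0|y0] := leP 0 y.
    under eq_integral do rewrite -mulrA EFinM.
    rewrite ge0_integralZl_EFin //; last 2 first.
      - by move=> t _; rewrite lee_fin mulr_ge0 // indicE.
      - exact: (mfun_comp (mA1 y)).
    under [in RHS]eq_integral do rewrite EFinM.
    rewrite ge0_integralZl_EFin //; last exact/measurable_EFinP.
    by rewrite indicG // integral_indic // setIT muleA.
  (* A non-negative simple function has empty fibres over negative values. *)
  have A_empty : A y = set0.
    by rewrite /A preimage_nnfun0.
  rewrite A_empty !integral0_eq ?mul0e // => x _; by rewrite indic0 mulr0 ?mul0r.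
under eq_integral do rewrite hE mulr_suml -sumEFin.
rewrite ge0_integral_sum //; last 2 first.
  - by move=> y; exact: (mfun_comp (myA1 y)).
  - by move=> y t _; rewrite lee_fin mulr_ge0.
under [in RHS]eq_integral do rewrite hE -sumEFin.
rewrite ge0_integral_sum //; last 2 first.
  - by move=> y; apply/measurable_EFinP; exact: myA1.
  - by move=> y x _; rewrite lee_fin.
rewrite ge0_sume_distrl; last first.
  by move=> y _; apply: integral_ge0 => x _; rewrite lee_fin.
by apply: eq_bigr => y _; exact: y_factor.
Qed.

(** True for simple functions by linearity; both sides pass to increasing limits by monotone
    convergence. *)
Lemma ge0_integral_factor (f : measurableTypeR R -> R) :
  measurable_fun setT f -> (forall x, 0 <= f x) ->
  (\int[P]_t (f (X t) * G t)%:E = \int[law]_x (f x)%:E * c%:E)%E.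
Proof.
move=> mf f0; have mEf : measurable_fun setT (EFin \o f) by exact/measurable_EFinP.
pose f_ := nnsfun_approx measurableT mEf.
have f_cvg x : EFin \o f_^~ x @ \oo --> (f x)%:E.
  have f0' y : setT y -> (0 <= (EFin \o f) y)%E by rewrite /= lee_fin.
  exact: (cvg_nnsfun_approx measurableT mEf f0' (I : setT x)).
have f_nd x : {homo f_^~ x : a b / (a <= b)%N >-> a <= b}.
  by move=> a b ab; exact/lefP/nd_nnsfun_approx.
have cvgL : (\int[P]_t (f_ n (X t) * G t)%:E)%E @[n --> \oo] --> (\int[P]_t (f (X t)
  * G t)%:E)%E.
  rewrite [X in _ --> X](_ : _ = (\int[P]_t limn (fun n => (f_ n (X t)
    * G t)%:E))%E); last first.
    apply: eq_integral => t _; apply/esym/cvg_lim => //.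
    under eq_fun do rewrite EFinM.
    by rewrite EFinM; apply: cvgeZr => //; exact: f_cvg.
  apply: cvg_monotone_convergence => //.
  - by move=> n; apply: mfun_comp.
  - by move=> n t _; rewrite lee_fin mulr_ge0.
  - by move=> t _ a b ab; rewrite lee_fin ler_wpM2r // f_nd.
have cvgR : (\int[law]_x (f_ n x)%:E)%E @[n --> \oo] --> (\int[law]_x (f x)%:E)%E.
  rewrite [X in _ --> X](_ : _ = (\int[law]_x limn (fun n => (f_ n x)%:E))%E);
    last first.
    by apply: eq_integral => x _; apply/esym/cvg_lim => //; exact: f_cvg.
  apply: cvg_monotone_convergence => //.
  - by move=> n; exact/measurable_EFinP.
  - by move=> n x _; rewrite lee_fin.
  - by move=> x _ a b ab; rewrite lee_fin f_nd.
apply: (cvg_unique _ cvgL) => //.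
rewrite (funext (fun n => nnsfun_factor (f_ n))).
exact: cvgeZr.
Qed.

End Nonneg.

Lemma has_mean_factor (f : measurableTypeR R -> R) (m : R) :
  (forall h : measurableTypeR R -> R, measurable_fun setT h ->
     (forall x, 0 <= h x) -> forall v, has_mean law h v ->
     has_mean P (fun t => h (X t) * G t) (v * c)) ->
  has_mean law f m -> has_mean P (fun t => f (X t) * G t) (m * c).
Proof.
move=> H [fi fm].
have mf : measurable_fun setT f by apply/measurable_EFinP; exact: measurable_int fi.
have pos : has_mean law f^\+ (fine (\int[law]_x (f^\+ x)%:E)%E).
  have i : law.-integrable setT (EFin \o f^\+) by exact: integrable_funrpos.
  by split => //; rewrite fineK //; exact: integrable_fin_num.
have neg : has_mean law f^\- (fine (\int[law]_x (f^\- x)%:E)%E).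
  have i : law.-integrable setT (EFin \o f^\-) by exact: integrable_funrneg.
  by split => //; rewrite fineK //; exact: integrable_fin_num.
have fE x : f^\+ x - f^\- x = f x.
  exact: (congr1 (fun g : _ -> R => g x) (funrposBneg f)).
have -> : m = fine (\int[law]_x (f^\+ x)%:E)%E - fine (\int[law]_x (f^\- x)%:E)%E.
  apply: EFin_inj; rewrite -fm -(has_meanB pos neg).2.
  by apply: eq_integral => x _; rewrite fE.
rewrite mulrBl.
rewrite (_ : (fun t => _) = (fun t => f^\+ (X t) * G t - f^\- (X t) * G t)); last first.
  by apply/funext => t; rewrite -mulrBl fE.
exact: has_meanB (H _ (measurable_funrpos mf) (funrpos_ge0 f) _ pos)
                 (H _ (measurable_funrneg mf) (funrneg_ge0 f) _ neg).
Qed.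

End OneFactor.

Section ProductMean.
Local Open Scope classical_set_scope.
Context d (T : measurableType d) (R : realType) (P : probability T R).
Variables (I : finType) (X : I -> T -> measurableTypeR R).
Variables (law : I -> probability (measurableTypeR R) R) (J : {set I}).
Hypothesis mX : forall s, s \in J -> measurable_fun setT (X s).
Hypothesis indepX : forall B : I -> set (measurableTypeR R),
  (forall s, s \in J -> measurable (B s)) ->
  P (\bigcap_(s in [set` J]) (X s @^-1` B s)) = (\prod_(s in J) law s (B s))%E.

Lemma has_mean_ge0 (Y : T -> R) v : measurable_fun setT Y ->
  (forall t, 0 <= Y t) -> (\int[P]_t (Y t)%:E)%E = v%:E -> has_mean P Y v.
Proof.
move=> mY Y0 Yv; split => //; apply/integrableP; split; first exact/measurable_EFinP.
rewrite (_ : (\int[P]_t _)%E = v%:E) ?ltry // -Yv.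
by apply: eq_integral => t _ /=; rewrite ger0_norm.
Qed.

Lemma measurable_prod_cond (Q : pred I) (f : I -> measurableTypeR R -> R) :
  (forall s, Q s -> s \in J) -> (forall s, Q s -> measurable_fun setT (f s)) ->
  measurable_fun setT (fun t => \prod_(s | Q s) f s (X s t)).
Proof.
move=> QJ mf.
rewrite (_ : (fun t => _) = (fun t => \prod_(s <- [seq s <- index_enum I | Q s])
  f s (X s t))).
  apply: measurable_prod => s; rewrite mem_filter => /andP[Qs _].
  exact: measurableT_comp (mf _ Qs) (mX (QJ _ Qs)).
by apply/funext => t; rewrite big_filter.
Qed.

Lemma has_mean_prod_indic (B : I -> set (measurableTypeR R)) :
  (forall s, measurable (B s)) ->
  has_mean P (fun t => \prod_(s in J) \1_(B s) (X s t))
             (\prod_(s in J) fine (law s (B s))).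
Proof.
move=> mB; apply: has_mean_ge0.
- apply: (@measurable_prod_cond (fun s => s \in J) (fun s => \1_(B s))) => //.
- by move=> t; apply: prodr_ge0 => s _; rewrite indicE.
pose A := \bigcap_(s in [set` J]) (X s @^-1` B s).
have mA : measurable A.
  apply: fin_bigcap_measurable => [|s sJ]; first exact: finite_finset.
  by rewrite -[_ @^-1` _]setTI; exact: mX.
transitivity (\int[P]_t (\1_A t)%:E)%E.
  apply: eq_integral => t _; congr EFin; rewrite indicE.
  case: (boolP (t \in A)) => [tA|tA].
    apply: big1 => s sJ; rewrite indicE mem_set //.
    by move/set_mem : tA; exact.
  have /existsNP[s /not_implyP[sJ sB]] : ~ A t by move=> At; move/negP: tA; apply;
    exact: mem_set.
  rewrite (bigD1 s) //= indicE memNset // mul0r //.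
rewrite integral_indic // setIT; transitivity (\prod_(s in J) law s (B s))%E.
  by apply: indepX => s _; exact: mB.
elim/big_rec2: _ => // s x y _ ->.
by rewrite EFinM fineK // fin_num_measure.
Qed.

(** The list [l] holds the factors that have been freed from being indicators. To free one more,
    [ge0_integral_factor] asks for the formula with an indicator in its place, which is the
    induction hypothesis. *)
Lemma has_mean_prod_ge0 (l : seq I) (f : I -> measurableTypeR R -> R)
    (m : I -> R) (B : I -> set (measurableTypeR R)) :
  uniq l -> {subset l <= J} -> (forall s, measurable (B s)) ->
  (forall s, s \in l -> [/\ measurable_fun setT (f s), forall x, 0 <= f s x &
                            has_mean (law s) (f s) (m s)]) ->
  (forall s, s \in J -> s \notin l -> f s = \1_(B s) /\ m s = fine (law s (B s))) ->
  has_mean P (fun t => \prod_(s in J) f s (X s t)) (\prod_(s in J) m s).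
Proof.
elim: l f m B => [|a l IHl] f m B /=.
  move=> _ _ mB _ fB; rewrite (_ : (fun t => _) = (fun t => \prod_(s in J) \1_(B s)
    (X s t))).
    rewrite (eq_bigr (fun s => fine (law s (B s)))); first exact: has_mean_prod_indic.
    by move=> s /fB[].
  by apply/funext => t; apply: eq_bigr => s /fB[] // ->.
case/andP => al ul lJ mB fl fB.
have aJ : a \in J by apply: lJ; rewrite mem_head.
have [mfa fa0 [fai fam]] := fl a (mem_head _ _).
have mf s : s \in J -> measurable_fun setT (f s).
  move=> sJ; have [/fl[]//|sl] := boolP (s \in a :: l).
  by have [-> _] := fB _ sJ sl; exact: measurable_indic.
have f0 s x : s \in J -> 0 <= f s x.
  move=> sJ; have [/fl[]//|sl] := boolP (s \in a :: l).
  by have [-> _] := fB _ sJ sl; rewrite indicE.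
pose G t := \prod_(s in J | s != a) f s (X s t).
pose c := \prod_(s in J | s != a) m s.
rewrite (bigD1 a) //= (_ : (fun t => _) = (fun t => f a (X a t) * G t)); last first.
  by apply/funext => t; rewrite (bigD1 a).
have mG : measurable_fun setT G.
  apply: (@measurable_prod_cond (fun s => (s \in J) && (s != a)) f) => s /andP[] //.
  by move=> /mf.
have G0 t : 0 <= G t by apply: prodr_ge0 => s /andP[sJ _]; exact: f0.
have indicG (B0 : set (measurableTypeR R)) : measurable B0 ->
    (\int[P]_t (\1_B0 (X a t) * G t)%:E = law a B0 * c%:E)%E.
  move=> mB0.
  pose f' s := if s == a then \1_B0 else f s.
  pose m' s := if s == a then fine (law a B0) else m s.
  pose B' s := if s == a then B0 else B s.
  have f'a : f' a = \1_B0 by rewrite /f' eqxx.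
  have m'a : m' a = fine (law a B0) by rewrite /m' eqxx.
  have [||||] := IHl f' m' B' ul.
  - by move=> s sl; apply: lJ; rewrite inE sl orbT.
  - by move=> s; rewrite /B'; case: ifP.
  - move=> s sl; rewrite /f' /m'; case: eqP => [e|_]; first by rewrite -e sl in al.
    by apply: fl; rewrite inE sl orbT.
  - move=> s sJ sl; rewrite /f' /m' /B'; case: eqP => [->//|/eqP sa].
    by apply: fB => //; rewrite inE negb_or sa.
  move=> _; rewrite [in RHS](bigD1 a) //= m'a EFinM => e.
  transitivity ((\int[P]_t (\prod_(s in J) f' s (X s t))%:E)%E).
    apply: eq_integral => t _; congr EFin; rewrite [RHS](bigD1 a) //= f'a.
    by congr (_ * _); apply: eq_bigr => s /andP[_ /negbTE sa]; rewrite /f' sa.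
  rewrite e fineK ?fin_num_measure //; congr (_ * (_)%:E)%E.
  by apply: eq_bigr => s /andP[_ /negbTE sa]; rewrite /m' sa.
apply: has_mean_ge0.
- by apply: measurable_funM => //; exact: (measurableT_comp mfa (mX aJ)).
- by move=> t; rewrite mulr_ge0.
by rewrite (ge0_integral_factor (mX aJ) mG G0 indicG) // fam EFinM.
Qed.

(** The same induction once more: now [l] holds the factors that may change sign, and
    [has_mean_factor] reduces each to its positive and negative parts. *)
Lemma has_mean_prod_aux (l : seq I) (f : I -> measurableTypeR R -> R) (m : I -> R) :
  uniq l -> {subset l <= J} ->
  (forall s, s \in J -> has_mean (law s) (f s) (m s)) ->
  (forall s, s \in J -> s \notin l ->
    measurable_fun setT (f s) /\ forall x, 0 <= f s x) ->
  has_mean P (fun t => \prod_(s in J) f s (X s t)) (\prod_(s in J) m s).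
Proof.
elim: l f m => [|a l IHl] f m.
  move=> _ _ fm f0; apply: (@has_mean_prod_ge0 (enum J) f m (fun=> setT)) => //.
  - exact: enum_uniq.
  - by move=> s; rewrite mem_enum.
  - by move=> s; rewrite mem_enum => sJ; have [] := f0 s sJ isT; split=> //; exact: fm.
  - by move=> s sJ; rewrite mem_enum sJ.
case/andP => al ul lJ fm f0.
have aJ : a \in J by apply: lJ; rewrite mem_head.
rewrite (bigD1 a) //=.
rewrite (_ : (fun t => _) = (fun t => f a (X a t) * \prod_(s in J | s != a)
  f s (X s t))); last first.
  by apply/funext => t; rewrite (bigD1 a).
apply: (@has_mean_factor _ _ _ _ (X a) (law a)) (fm _ aJ) => h mh h0 v hv.
pose f' s := if s == a then h else f s.
pose m' s := if s == a then v else m s.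
have f'a : f' a = h by rewrite /f' eqxx.
have m'a : m' a = v by rewrite /m' eqxx.
have [|||] := IHl f' m' ul.
- by move=> s sl; apply: lJ; rewrite inE sl orbT.
- by move=> s sJ; rewrite /f' /m'; case: eqP => [->//|_]; exact: fm.
- move=> s sJ sl; rewrite /f'; case: eqP => [//|/eqP sa].
  by apply: f0 => //; rewrite inE negb_or sa.
move=> i e.
rewrite (_ : (fun t => _) = (fun t => \prod_(s in J) f' s (X s t))); last first.
  apply/funext => t; rewrite [RHS](bigD1 a) //= f'a; congr (_ * _).
  by apply: eq_bigr => s /andP[_ /negbTE sa]; rewrite /f' sa.
rewrite (_ : v * _ = \prod_(s in J) m' s) //.
rewrite [RHS](bigD1 a) //= m'a.
by congr (_ * _); apply: eq_bigr => s /andP[_ /negbTE sa]; rewrite /m' sa.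
Qed.

Lemma has_mean_prod (f : I -> measurableTypeR R -> R) (m : I -> R) :
  (forall s, s \in J -> has_mean (law s) (f s) (m s)) ->
  has_mean P (fun t => \prod_(s in J) f s (X s t)) (\prod_(s in J) m s).
Proof.
move=> fm; apply: (@has_mean_prod_aux (enum J)) => //.
- exact: enum_uniq.
- by move=> s; rewrite mem_enum.
- by move=> s sJ; rewrite mem_enum sJ.
Qed.

End ProductMean.

(** * Reduction to the finite model *)

(* The real random variables of the model: real parts ([false]) and imaginary parts
   ([true]) of the entries (j, k), and the diagonal entries. *)
Definition slot n : finType := (('I_n * 'I_n * bool) + 'I_n)%type.

Definition used n : pred (slot n) := fun s =>
  match s with inl (jk, _) => (jk.1 < jk.2)%N | inr _ => true end.

(** Regroups the slots by matrix position, the layout of [weight]. *)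
Lemma prod_slots (A : Type) (idx : A) (op : Monoid.com_law idx) n (v : slot n -> A) :
  (forall s, ~~ used s -> v s = idx) ->
  \big[op/idx]_s v s = \big[op/idx]_(i < n) \big[op/idx]_(j < n)
    (if (i < j)%N then op (v (inl (i, j, false))) (v (inl (i, j, true)))
     else if i == j then v (inr i) else idx).
Proof.
move=> v1.
have diag : \big[op/idx]_(i < n) v (inr i) =
    \big[op/idx]_(i < n) \big[op/idx]_(j < n) (if i == j then v (inr i) else idx).
  apply: eq_bigr => i _; rewrite (bigD1 i) //= eqxx big1 ?Monoid.mulm1 // => j.
  by rewrite eq_sym => /negbTE ->.
have upper : \big[op/idx]_p v (inl p)
  = \big[op/idx]_j \big[op/idx]_k \big[op/idx]_b v (inl (j, k, b)).
  rewrite (pair_bigA _ (fun j k => \big[op/idx]_b v (inl (j, k, b)))) /=.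
  rewrite (pair_bigA _ (fun jk b => v (inl (jk.1, jk.2, b)))) /=.
  by apply: eq_bigr => -[[j k] b].
rewrite big_sumType /= diag upper.
rewrite -big_split; apply: eq_bigr => i _; rewrite -big_split; apply: eq_bigr => j _ /=.
rewrite big_bool /=; case: ltngtP => [ij|ji|/val_inj ->].
- by rewrite -val_eqE (ltn_eqF ij) Monoid.mulm1 Monoid.mulmC.
- have vij b : v (inl (i, j, b)) = idx by apply: v1; rewrite /= -leqNgt ltnW.
  by rewrite -val_eqE eq_sym (ltn_eqF ji) !vij !Monoid.mulm1.
have vjj b : v (inl (j, j, b)) = idx by apply: v1; rewrite /= ltnn.
by rewrite eqxx !vjj !Monoid.mul1m.
Qed.

Section Slots.
Local Open Scope classical_set_scope.
Variables (R : realType) (lawRe lawIm lawD : probability (measurableTypeR R) R).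

Definition slot_law n (s : slot n) : probability (measurableTypeR R) R :=
  match s with
  | inl (_, false) => lawRe | inl (_, true) => lawIm | inr _ => lawD
  end.

Section Wigner.
Context d (T : measurableType d) (P : probability T R) n (Z : T -> 'M[R[i]]_n).
Hypothesis hZ : wigner lawRe lawIm lawD P Z.

Definition slot_var (s : slot n) (w : T) : measurableTypeR R :=
  match s with
  | inl (jk, false) => entry_re Z jk w
  | inl (jk, true) => entry_im Z jk w
  | inr j => entry_diag Z j w
  end.

Lemma slot_var_measurable s : used s -> measurable_fun setT (slot_var s).
Proof.
case: s => [[jk [|]]|j] /= us.
- by have [m _ _] := wigner_im hZ; exact: m.
- by have [m _ _] := wigner_re hZ; exact: m.
- by have [m _ _] := wigner_diag hZ; exact: m.
Qed.

Lemma sigma_family_cap (I : finType) (D : {pred I}) (X : I -> T -> R)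
    (B : I -> set (measurableTypeR R)) :
  (forall i, i \in D -> measurable (B i)) ->
  sigma_family D X (\bigcap_(i in [set` D]) (X i @^-1` B i)).
Proof.
move=> mB; rewrite /sigma_family; set G := \bigcup_(i in _) _.
apply: (@fin_bigcap_measurable _ (g_sigma_algebraType G)) => [|i iD].
  exact: finite_finpred.
apply: sub_sigma_algebra; exists i => //; exists (B i); first exact: mB.
by rewrite setTI.
Qed.

Lemma iid_cap (I : finType) (D : {pred I}) (X : I -> T -> R) law
    (B : I -> set (measurableTypeR R)) :
  iid_with_law P D X law -> (forall i, i \in D -> measurable (B i)) ->
  P (\bigcap_(i in [set` D]) (X i @^-1` B i)) = (\prod_(i in D) law (B i))%E.
Proof.
move=> [mX lawX indepX] mB.
pose J : {set I} := finset D.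
have JD i : (i \in J) = (i \in D) by rewrite inE.
have := indepX J B.
rewrite (_ : [set` J] = [set` D]); last by apply/seteqP; split=> i /=; rewrite JD.
move=> -> //; last 2 first.
- by move=> i; rewrite JD.
- by move=> i; rewrite JD; exact: mB.
by apply: eq_big => i; rewrite JD // => iD; exact: lawX (mB _ iD).
Qed.

Let J : {set slot n} := finset (@used n).

(** The event is an intersection of three, one in the sigma-algebra of each family; [wigner_indep]
    separates them and independence within each family does the rest. *)
Lemma slot_indep (B : slot n -> set (measurableTypeR R)) :
  (forall s, s \in J -> measurable (B s)) ->
  P (\bigcap_(s in [set` J]) (slot_var s @^-1` B s)) =
  (\prod_(s in J) slot_law s (B s))%E.
Proof.
move=> mB.
have -> : \bigcap_(s in [set` J]) (slot_var s @^-1` B s) =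
  (\bigcap_(jk in [set` @upper_pair n]) (entry_re Z jk @^-1` B (inl (jk, false)))) `&`
  (\bigcap_(jk in [set` @upper_pair n]) (entry_im Z jk @^-1` B (inl (jk, true)))) `&`
  (\bigcap_(j in [set` (predT : {pred 'I_n})]) (entry_diag Z j @^-1` B (inr j))).
  apply/seteqP; split => w /=.
    move=> H; split; first split.
    - by move=> jk /= ujk; apply: (H (inl (jk, false))); rewrite /= inE.
    - by move=> jk /= ujk; apply: (H (inl (jk, true))); rewrite /= inE.
    - by move=> j _; apply: (H (inr j)); rewrite /= inE.
  move=> [[H1 H2] H3] [[jk [|]]|j] /=; rewrite inE => us.
  - exact: H2.
  - exact: H1.
  - exact: H3.
have mRe jk : jk \in @upper_pair n -> measurable (B (inl (jk, false))).
  by move=> ujk; apply: mB; rewrite inE.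
have mIm jk : jk \in @upper_pair n -> measurable (B (inl (jk, true))).
  by move=> ujk; apply: mB; rewrite inE.
have mDi j : j \in (predT : {pred 'I_n}) -> measurable (B (inr j)).
  by move=> _; apply: mB; rewrite inE.
have sRe := @sigma_family_cap _ _ (entry_re Z) (fun jk => B (inl (jk, false))) mRe.
have sIm := @sigma_family_cap _ _ (entry_im Z) (fun jk => B (inl (jk, true))) mIm.
have sDi := @sigma_family_cap _ _ (entry_diag Z) (fun j => B (inr j)) mDi.
rewrite (wigner_indep hZ sRe sIm sDi).
rewrite (iid_cap (wigner_re hZ) mRe) (iid_cap (wigner_im hZ) mIm)
  (iid_cap (wigner_diag hZ) mDi).
rewrite [RHS]big_mkcond big_sumType /=; congr (_ * _)%E; last first.
  by apply: eq_big => // j _; rewrite inE.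
rewrite (eq_bigr (fun p => if inl (p.1, p.2) \in J then
   slot_law (inl (p.1, p.2) : slot n) (B (inl (p.1, p.2))) else 1%E)) => [|[jk b] //].
rewrite -(pair_bigA _ (fun jk b => if inl (jk, b) \in J then
   slot_law (inl (jk, b) : slot n) (B (inl (jk, b))) else 1%E)) /=.
rewrite [X in (X * _)%E]big_mkcond [X in (_ * X)%E]big_mkcond -big_split.
apply: eq_bigr => jk _; rewrite big_bool /= !inE /=.
by rewrite muleC /upper_pair /in_mem /=; case: ifP.
Qed.

Lemma slot_monomial_mean (e : slot n -> nat) :
  (forall s, ~~ used s -> e s = 0%N) ->
  (forall s, used s -> has_mean (slot_law s) (fun x => x ^+ e s) (moment (slot_law s)
    (e s))) ->
  has_mean P (fun w => \prod_s slot_var s w ^+ e s)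
             (\prod_(s | used s) moment (slot_law s) (e s)).
Proof.
move=> e0 em.
have := @has_mean_prod _ _ _ P _ slot_var (@slot_law n) J _ slot_indep
  (fun s x => x ^+ e s) (fun s => moment (slot_law s) (e s)).
rewrite (_ : (fun t => _) = (fun w => \prod_s slot_var s w ^+ e s)); last first.
  apply/funext => w; rewrite [RHS](bigID (fun s => s \in J))
    /= [X in _ * X]big1 ?mulr1 //.
  by move=> s; rewrite inE => /e0 ->.
rewrite (_ : \prod_(s in J) _ = \prod_(s | used s) moment (slot_law s) (e s));
  last first.
  by apply: eq_bigl => s; rewrite inE.
apply.
- by move=> s; rewrite inE; exact: slot_var_measurable.
- by move=> s; rewrite inE; exact: em.
Qed.

End Wigner.
End Slots.

Section Moments.
Local Open Scope classical_set_scope.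
Variables (R : realType) (law : probability (measurableTypeR R) R).

Lemma moment0 : moment law 0 = 1.
Proof.
transitivity (fine 'E_law[cst 1]); last by rewrite expectation_cst.
by rewrite unlock.
Qed.

(** Domination by 1 + x^(2p): the even exponent makes this bound positive. *)
Lemma has_mean_power q p : (q <= p.*2)%N -> finite_moment law p.*2 ->
  has_mean law (fun x => x ^+ q) (moment law q).
Proof.
move=> qp fp.
have mX k : measurable_fun setT (fun x : measurableTypeR R => x ^+ k : R).
  exact: measurable_funX.
have i : law.-integrable setT (EFin \o (fun x : measurableTypeR R => x ^+ q : R)).
  apply: (@le_integrable _ _ _ law setT measurableT _
    (fun x : measurableTypeR R => (1 + x ^+ p.*2 : R)%:E)).
  - exact/measurable_EFinP.
  - move=> x _ /=; rewrite lee_fin normrX (ger0_norm (_ : 0 <= 1 + x ^+ p.*2));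
    last first.
      by rewrite addr_ge0 // -muln2 exprM sqr_ge0.
    have -> : x ^+ p.*2 = `|x| ^+ p.*2 by rewrite -muln2 exprM -[LHS]ger0_norm
      ?sqr_ge0 // !normrX -exprM.
    have [x1|x1] := leP `|x| 1.
      by rewrite (le_trans (exprn_ile1 _ (normr_ge0 x) x1)) // lerDl exprn_ge0.
    by rewrite (le_trans (ler_weXn2l (ltW x1) qp)) // lerDr.
  - rewrite (_ : (fun x => _) = (fun x => 1%:E + (x ^+ p.*2)%:E)%E) //.
    apply: integrableD => //.
    exact: finite_measure_integrable_cst.
by split => //; rewrite /moment fineK //; exact: integrable_fin_num.
Qed.

End Moments.

Section Nodes.
Local Open Scope classical_set_scope.
Local Open Scope complex_scope.
Variable R : realType.

Definition node (k : 'I_5) : R := k%:R - 2.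

(* The Lagrange interpolation weights: a signed measure on the nodes -2, ..., 2 with
   moments [m 0], ..., [m 4]. *)
Definition node_weight (m : nat -> R) (k : 'I_5) : R :=
  nth 0 [:: (m 4%N - m 2%N) / 24 - (m 3%N - m 1%N) / 12;
            (4 * m 2%N - m 4%N) / 6 - (4 * m 1%N - m 3%N) / 6;
            m 0%N - 5 * m 2%N / 4 + m 4%N / 4;
            (4 * m 2%N - m 4%N) / 6 + (4 * m 1%N - m 3%N) / 6;
            (m 4%N - m 2%N) / 24 + (m 3%N - m 1%N) / 12] k.

Lemma node_moment m q : (q <= 4)%N -> \sum_k node_weight m k * node k ^+ q = m q.
Proof.
rewrite !big_ord_recl big_ord0 /node /node_weight /= /bump /= !(add0n, add1n, addn0).
by case: q => [|[|[|[|[|//]]]]] _; rewrite ?expr0; field.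
Qed.

End Nodes.

(** * Determinants as polynomials in the slots *)

Section SlotPolynomials.
Local Open Scope classical_set_scope.
Local Open Scope complex_scope.
Variables (R : realType) (n : nat).
Implicit Types (deg : slot n -> nat) (phi : (slot n -> R) -> R[i]).

Definition monomial (x : slot n -> R) (e : {ffun slot n -> nat}) : R :=
  \prod_s x s ^+ e s.

(* Polynomials in the slots with degree at most [deg s] in the slot [s]. *)
Definition polyfun deg phi : Prop :=
  exists2 l : seq (R[i] * {ffun slot n -> nat}),
    all (fun p : R[i] * {ffun slot n -> nat} => [forall s, (p.2 s <= deg s)%N]) l &
    forall x, phi x = \sum_(p <- l) p.1 * (monomial x p.2)%:C.

Lemma monomialM x (e e' : {ffun slot n -> nat}) :
  monomial x [ffun s => (e s + e' s)%N] = monomial x e * monomial x e'.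
Proof.
by rewrite /monomial -big_split; apply: eq_bigr => s _; rewrite ffunE exprD.
Qed.

Lemma eq_polyfun deg phi psi : phi =1 psi -> polyfun deg phi -> polyfun deg psi.
Proof. by move=> e [l ll pl]; exists l => // x; rewrite -e. Qed.

Lemma polyfun_le deg deg' phi : (forall s, deg s <= deg' s)%N ->
  polyfun deg phi -> polyfun deg' phi.
Proof.
move=> le_deg [l /allP ll pl]; exists l => //; apply/allP => p /ll /forallP pd.
by apply/forallP => s; exact: leq_trans (pd s) (le_deg s).
Qed.

Lemma polyfun_cst c deg : polyfun deg (fun=> c).
Proof.
exists [:: (c, [ffun=> 0%N])] => [|x].
  by rewrite /= andbT; apply/forallP => s; rewrite ffunE.
rewrite big_seq1 /monomial /= big1 ?mulr1 // => s _; by rewrite ffunE expr0.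
Qed.

Lemma polyfun_var deg s c : (0 < deg s)%N -> polyfun deg (fun x => c * (x s)%:C).
Proof.
move=> ds; exists [:: (c, [ffun t => (t == s) : nat])] => [|x].
  by rewrite /= andbT; apply/forallP => t; rewrite ffunE; case: eqP => // ->.
rewrite big_seq1 /monomial /= (bigD1 s) //= ffunE eqxx expr1 big1 ?mulr1 // => t.
by rewrite ffunE => /negbTE ->.
Qed.

Lemma polyfunD deg phi psi : polyfun deg phi -> polyfun deg psi ->
  polyfun deg (fun x => phi x + psi x).
Proof.
move=> [l ll pl] [l' ll' pl']; exists (l ++ l') => [|x].
  by rewrite all_cat ll ll'.
by rewrite big_cat /= pl pl'.
Qed.

Lemma polyfunM deg deg' phi psi : polyfun deg phi -> polyfun deg' psi ->
  polyfun (fun s => deg s + deg' s)%N (fun x => phi x * psi x).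
Proof.
move=> [l /allP ll pl] [l' /allP ll' pl'].
exists [seq (p.1 * q.1, [ffun s => (p.2 s + q.2 s)%N] : {ffun slot n ->
  nat}) | p : R[i] * {ffun slot n -> nat} <- l, q : R[i] * {ffun slot n ->
  nat} <- l'] => [|x].
  apply/allP => _ /allpairsP[[p q] [/ll/forallP pd /ll'/forallP qd ->]] /=.
  by apply/forallP => s; rewrite ffunE leq_add.
rewrite big_allpairs_dep /= pl pl' mulr_suml; apply: eq_bigr => p _.
rewrite mulr_sumr; apply: eq_bigr => q _.
by rewrite monomialM rmorphM mulrACA.
Qed.

Lemma polyfun_sum (I : Type) (r : seq I) (Q : pred I) deg
    (phi : I -> (slot n -> R) -> R[i]) :
  (forall a, Q a -> polyfun deg (phi a)) ->
  polyfun deg (fun x => \sum_(a <- r | Q a) phi a x).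
Proof.
move=> H; elim: r => [|a r IHr].
  by apply: eq_polyfun (polyfun_cst 0 deg) => x; rewrite big_nil.
case Qa : (Q a).
  by apply: eq_polyfun (polyfunD (H a Qa) IHr) => x; rewrite big_cons Qa.
by apply: eq_polyfun IHr => x; rewrite big_cons Qa.
Qed.

Lemma polyfun_prod (I : Type) (r : seq I) (deg : I -> slot n -> nat)
    (phi : I -> (slot n -> R) -> R[i]) :
  (forall a, polyfun (deg a) (phi a)) ->
  polyfun (fun s => \sum_(a <- r) deg a s)%N (fun x => \prod_(a <- r) phi a x).
Proof.
move=> H; elim: r => [|a r IHr].
  by apply: eq_polyfun (polyfun_cst 1 _) => x; rewrite big_nil.
apply: (@polyfun_le (fun s => deg a s + \sum_(b <- r) deg b s)%N) => [s|].
  by rewrite big_cons.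
by apply: eq_polyfun (polyfunM (H a) IHr) => x; rewrite big_cons.
Qed.

Definition slotZ (x : slot n -> R) : 'M[R[i]]_n := \matrix_(i, j)
  if (i < j)%N then Complex (x (inl (i, j, false))) (x (inl (i, j, true)))
  else if (j < i)%N then Complex (x (inl (j, i, false))) (- x (inl (j, i, true)))
  else (x (inr i))%:C.

Definition entry_deg (i j : 'I_n) (s : slot n) : nat :=
  match s with
  | inl (jk, _) => (jk.1 < jk.2)%N && ((jk == (i, j)) || (jk == (j, i)))
  | inr k => (i == j) && (k == i)
  end.

Lemma polyfun_entry (i j : 'I_n) c :
  polyfun (entry_deg i j) (fun x => slotZ x i j + c).
Proof.
apply: polyfunD; last exact: polyfun_cst.
have [ij|ji|ij] := ltngtP i j.
- apply: (eq_polyfun _ (polyfunD (@polyfun_var (entry_deg i j) (inl (i, j, false)) 1 _)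
                                (@polyfun_var (entry_deg i j) (inl (i, j,
                                  true)) 'i _))).
  + move=> x; rewrite mxE ij; apply/eqP; rewrite eq_complex /=.
    by rewrite !(mul1r, mul0r, mulr0, mulr1, subr0, addr0, add0r, subrr) !eqxx.
  + by rewrite /= ij eqxx.
  + by rewrite /= ij eqxx.
- apply: (eq_polyfun _ (polyfunD (@polyfun_var (entry_deg i j) (inl (j, i, false)) 1 _)
                                (@polyfun_var (entry_deg i j) (inl (j, i,
                                  true)) (- 'i) _))).
  + move=> x; rewrite mxE ltnNge (ltnW ji) ji /=; apply/eqP; rewrite eq_complex /=.
    by rewrite !(mul1r, mul0r, mulr0, mulr1, mulN1r, mulNr, oppr0, subr0, addr0,
      add0r, subrr) !eqxx.
  + by rewrite /= ji eqxx orbT.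
  + by rewrite /= ji eqxx orbT.
move/val_inj: ij => <-.
apply: (eq_polyfun _ (@polyfun_var (entry_deg i i) (inr i) 1 _)).
  by move=> x; rewrite mxE ltnn mul1r.
by rewrite /= !eqxx.
Qed.

Definition det_deg (s : slot n) : nat :=
  if used s then (if s is inl _ then 2 else 1)%N else 0%N.

(** A term of the Leibniz formula uses each row once, and the slots of a pair j < k occur only in
    the rows j and k. *)
Lemma entry_deg_perm (p : 'S_n) s : (\sum_i entry_deg i (p i) s <= det_deg s)%N.
Proof.
case: s => [[[j k] b]|k] /=; rewrite /det_deg /=; last first.
  rewrite (bigD1 k) //= eqxx andbT big1 => [|i /negbTE ik];
    last by rewrite (eq_sym k) ik andbF.
  by rewrite addn0; case: eqP.
case: ifP => jk; last by rewrite big1.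
apply: leq_trans (_ : (\sum_i ((i == j) + (i == k)) <= 2)%N).
  apply: leq_sum => i _ /=; rewrite !xpair_eqE (eq_sym i j) (eq_sym i k).
  by case: (j == i) (k == i) (j == p i) (k == p i) => -[] [] [].
rewrite big_split /= (bigD1 j) //= eqxx [X in (_ + X + _)%N]big1 => [|i /negbTE -> //].
by rewrite (bigD1 k) //= eqxx big1 // => i /negbTE ->.
Qed.

Lemma polyfun_det (N : 'M[R[i]]_n) : polyfun det_deg (fun x => \det (slotZ x + N)).
Proof.
rewrite /determinant; apply: polyfun_sum => p _.
apply: (@polyfun_le (fun s => 0 + \sum_i entry_deg i (p i) s)%N) => [s|].
  exact: entry_deg_perm.
apply: polyfunM; first exact: polyfun_cst.
apply: polyfun_prod => i.
by apply: eq_polyfun (polyfun_entry i (p i) (N i (p i))) => x; rewrite !mxE.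
Qed.

End SlotPolynomials.

Section ComplexMean.
Local Open Scope classical_set_scope.
Local Open Scope complex_scope.
Context d (T : measurableType d) (R : realType) (P : probability T R).

Definition has_cmean (Y : T -> R[i]) (v : R[i]) : Prop :=
  has_mean P (fun w => complex.Re (Y w)) (complex.Re v) /\
  has_mean P (fun w => complex.Im (Y w)) (complex.Im v).

Lemma has_cmean_integrable Y v : has_cmean Y v -> complex_integrable P Y.
Proof. by move=> [[? _] [? _]]. Qed.

Lemma has_cmean_expectation Y v : has_cmean Y v -> complex_expectation P Y = v.
Proof.
move=> [[_ r] [_ i]]; rewrite /complex_expectation unlock r i /=.
by case: v {r i}.
Qed.

Lemma has_cmean0 : has_cmean (fun=> 0) 0.
Proof.
suff h : has_mean P (fun=> 0) 0 by [].
split; first exact: integrable0.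
by rewrite integral0.
Qed.

Lemma has_cmeanD Y Z v w : has_cmean Y v -> has_cmean Z w ->
  has_cmean (fun t => Y t + Z t) (v + w).
Proof.
move=> [rY iY] [rZ iZ]; split.
- rewrite (_ : (fun t => _) = (fun t => complex.Re (Y t) + complex.Re (Z t))).
    by rewrite raddfD; exact: has_meanD.
  by apply/funext => t; rewrite raddfD.
- rewrite (_ : (fun t => _) = (fun t => complex.Im (Y t) + complex.Im (Z t))).
    by rewrite raddfD; exact: has_meanD.
  by apply/funext => t; rewrite raddfD.
Qed.

Lemma has_cmeanZ c (Y : T -> R) v : has_mean P Y v ->
  has_cmean (fun t => c * (Y t)%:C) (c * v%:C).
Proof.
move=> hY; have Re_c y : complex.Re (c * y%:C) = complex.Re c * y.
  by case: c => a b /=; rewrite mulr0 subr0.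
have Im_c y : complex.Im (c * y%:C) = complex.Im c * y.
  by case: c {Re_c} => a b /=; rewrite mulr0 add0r.
split.
- by rewrite Re_c; under eq_fun do rewrite Re_c; exact: has_meanZ.
- by rewrite Im_c; under eq_fun do rewrite Im_c; exact: has_meanZ.
Qed.

End ComplexMean.

(** * The signed measure on the nodes *)

Section FiniteModelLaw.
Local Open Scope classical_set_scope.
Local Open Scope complex_scope.
Variables (R : realType) (lawRe lawIm lawD : probability (measurableTypeR R) R).
Local Notation C := R[i].

Definition node_pair : finType := ('I_5 * 'I_5)%type.

Definition off_weight (u : node_pair) : C :=
  (node_weight (moment lawRe) u.1 * node_weight (moment lawIm) u.2)%:C.
(** All positions share one sample type, so a diagonal sample has a second coordinate too; the
    weights on it sum to 1. *)
Definition diag_weight (u : node_pair) : C :=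
  (node_weight (moment lawD) u.1 * node_weight (moment lawIm) u.2)%:C.
Definition off_entry (u : node_pair) : C := Complex (node R u.1) (node R u.2).
Definition off_entry_conj (u : node_pair) : C := Complex (node R u.1) (- node R u.2).
Definition diag_entry (u : node_pair) : C := (node R u.1)%:C.

Lemma off_moment p q : (p <= 4)%N -> (q <= 4)%N ->
  \sum_u off_weight u * (node R u.1 ^+ p * node R u.2 ^+ q)%:C =
  (moment lawRe p * moment lawIm q)%:C.
Proof.
move=> p4 q4; rewrite -(node_moment _ p4) -(node_moment _ q4).
rewrite mulr_suml rmorph_sum.
rewrite -(pair_bigA _ (fun a b => (node_weight (moment lawRe)
  a * node_weight (moment lawIm) b)%:C *
  (node R a ^+ p * node R b ^+ q)%:C)) /=.
apply: eq_bigr => a _; rewrite mulr_sumr rmorph_sum; apply: eq_bigr => b _.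
by rewrite -rmorphM; congr (_ %:C); rewrite mulrACA.
Qed.

Lemma diag_moment p : (p <= 4)%N ->
  \sum_u diag_weight u * (node R u.1 ^+ p)%:C = (moment lawD p)%:C.
Proof.
move=> p4; rewrite -(node_moment _ p4) rmorph_sum.
rewrite -(pair_bigA _ (fun a b => (node_weight (moment lawD)
  a * node_weight (moment lawIm) b)%:C *
  (node R a ^+ p)%:C)) /=.
apply: eq_bigr => a _; rewrite -mulr_suml -rmorph_sum -rmorphM -mulr_sumr.
congr (_ %:C); have := node_moment (moment lawIm) (isT : 0 <= 4)%N.
by under eq_bigr do rewrite expr0 mulr1; rewrite moment0 => ->; rewrite mulr1.
Qed.

Definition sample_slot n (w : 'M[node_pair]_n) (s : slot n) : R :=
  match s with
  | inl (jk, false) => node R (w jk.1 jk.2).1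
  | inl (jk, true) => node R (w jk.1 jk.2).2
  | inr j => node R (w j j).1
  end.

Lemma sampleZ_slot n (w : 'M[node_pair]_n) :
  sampleZ off_entry off_entry_conj diag_entry w = slotZ (sample_slot w).
Proof. by apply/matrixP => i j; rewrite !mxE. Qed.

Local Notation Ew := (weight off_weight diag_weight).

(** Summing over samples distributes over the positions, and the degree bound keeps every exponent
    within the moments that [node_moment] reproduces. *)
Lemma sample_monomial n (e : {ffun slot n -> nat}) :
  (forall s, (e s <= det_deg s + det_deg s)%N) ->
  \sum_(w : 'M[node_pair]_n) Ew w * (monomial (sample_slot w) e)%:C =
  (\prod_(s | used s) moment (slot_law lawRe lawIm lawD s) (e s))%:C.
Proof.
move=> e_le.
have e0 s : ~~ used s -> e s = 0%N.
  by move=> us; have := e_le s; rewrite /det_deg (negbTE us) leqn0 => /eqP.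
pose g (i j : 'I_n) (u : node_pair) : C :=
  (if (i < j)%N then node R u.1 ^+ e (inl (i, j, false)) * node R u.2 ^+ e (inl (i,
    j, true))
   else if i == j then node R u.1 ^+ e (inr i) else 1)%:C.
pose wt (i j : 'I_n) := if (i < j)%N then off_weight else diag_weight.
transitivity (\sum_(w : 'M[node_pair]_n) \prod_i \prod_j (wt i j (w i j)
  * g i j (w i j))).
  apply: eq_bigr => w _; rewrite /weight /monomial.
  rewrite (@prod_slots _ _ _ n (fun s => sample_slot w s ^+ e s)) ?rmorph_prod;
    last first.
    by move=> s /e0 ->; rewrite expr0.
  rewrite -big_split; apply: eq_bigr => i _; rewrite rmorph_prod -big_split.
  apply: eq_bigr => j _; rewrite /wt /g /=; case: ifP => // _.
  by case: eqP => [->|].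
have bij : bijective (fun f : {ffun 'I_n * 'I_n ->
  node_pair} => \matrix_(i, j) f (i, j)).
  exists (fun w : 'M[node_pair]_n => [ffun p => w p.1 p.2]) => [f|w].
    by apply/ffunP => -[i j]; rewrite ffunE mxE.
  by apply/matrixP => i j; rewrite mxE ffunE.
rewrite (reindex _ (onW_bij _ bij)) /=.
transitivity (\sum_(f : {ffun 'I_n * 'I_n ->
  node_pair}) \prod_p (wt p.1 p.2 (f p) * g p.1 p.2 (f p))).
  apply: eq_bigr => f _; rewrite (pair_bigA _ (fun i j => wt i j _ * g i j _)) /=.
  by apply: eq_bigr => -[i j] _; rewrite !mxE.
rewrite -(bigA_distr_bigA (fun p u => wt p.1 p.2 u * g p.1 p.2 u)).
rewrite [in RHS]big_mkcond (@prod_slots _ _ _ n (fun s => if used s then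
  moment (slot_law lawRe lawIm lawD s) (e s) else 1)); last by move=> s /negbTE ->.
rewrite rmorph_prod -(pair_bigA _ (fun i j => \sum_u wt i j u * g i j u)) /=.
apply: eq_bigr => i _; rewrite rmorph_prod; apply: eq_bigr => j _ /=.
rewrite /wt /g; case: ifP => ij.
  have e4 b : (e (inl (i, j, b)) <= 4)%N.
    by have := e_le (inl (i, j, b)); rewrite /det_deg /= ij.
  by rewrite off_moment.
case: eqP => _.
  rewrite diag_moment //; have := e_le (inr i); rewrite /det_deg /=; lia.
transitivity (\sum_u diag_weight u * (node R u.1 ^+ 0)%:C).
  by apply: eq_bigr => u _; rewrite expr0.
by rewrite diag_moment // moment0.
Qed.

End FiniteModelLaw.

(** * Mixed moments of the model *)

Section ModelMoments.
Local Open Scope classical_set_scope.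
Local Open Scope complex_scope.
Variables (R : realType) (lawRe lawIm lawD : probability (measurableTypeR R) R).
Hypotheses (hRe1 : moment lawRe 1 = 0) (hIm1 : moment lawIm 1 = 0)
  (hD1 : moment lawD 1 = 0).
Local Notation mu q := (moment lawRe q)%:C.
Local Notation nu q := (moment lawIm q)%:C.
Local Notation wp := (off_weight lawRe lawIm).
Local Notation wd := (diag_weight lawIm lawD).
Local Notation zp := (@off_entry R).
Local Notation zm := (@off_entry_conj R).
Local Notation zd := (@diag_entry R).
Local Notation mom := (pair_moment wp zp zm).

Let x (u : node_pair) : R[i] := (node R u.1)%:C.
Let y (u : node_pair) : R[i] := (node R u.2)%:C.

Let I : R[i] := Complex 0 1.

Let zpE u : zp u = x u + I * y u.
Proof.
apply/eqP; rewrite eq_complex /=.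
by rewrite !(mul1r, mul0r, mulr0, mulr1, subr0, addr0, add0r, subrr) !eqxx.
Qed.

Let zmE u : zm u = x u - I * y u.
Proof.
apply/eqP; rewrite eq_complex /=.
by rewrite !(mul1r, mul0r, mulr0, mulr1, subr0, addr0, add0r, subrr, oppr0) !eqxx.
Qed.

Let xy p q : (p <= 4)%N -> (q <= 4)%N ->
  \sum_u wp u * (x u ^+ p * y u ^+ q) = mu p * nu q.
Proof.
move=> p4 q4; transitivity ((moment lawRe p * moment lawIm q)%:C);
  last by rewrite rmorphM.
rewrite -off_moment //; apply: eq_bigr => u _.
by rewrite rmorphM !rmorphXn.
Qed.

Let mu0 : mu 0 = 1. Proof. by rewrite moment0. Qed.
Let nu0 : nu 0 = 1. Proof. by rewrite moment0. Qed.
Let mu1 : mu 1 = 0. Proof. by rewrite hRe1. Qed.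
Let nu1 : nu 1 = 0. Proof. by rewrite hIm1. Qed.

Let i2 : I * I = -1.
Proof.
apply/eqP; rewrite eq_complex /=.
by rewrite !(mul1r, mul0r, mulr0, mulr1, subr0, addr0, sub0r, oppr0) !eqxx.
Qed.

Lemma model_wp1 : \sum_u wp u = 1.
Proof.
transitivity (mu 0 * nu 0); last by rewrite mu0 nu0 mulr1.
by rewrite -xy //; apply: eq_bigr => u _; rewrite !expr0 !mulr1.
Qed.

Lemma model_wd1 : \sum_u wd u = 1.
Proof.
transitivity ((moment lawD 0)%:C : R[i]); last by rewrite moment0.
by rewrite -(diag_moment lawIm lawD (isT : 0 <= 4)%N); apply: eq_bigr => u _;
  rewrite expr0 mulr1.
Qed.

Lemma model_wdz : \sum_u wd u * zd u = 0.
Proof.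
transitivity ((moment lawD 1)%:C : R[i]); last by rewrite hD1.
by rewrite -(diag_moment lawIm lawD (isT : 1 <= 4)%N); apply: eq_bigr => u _;
  rewrite expr1.
Qed.

Lemma model_wdz2 : \sum_u wd u * zd u ^+ 2 = (moment lawD 2)%:C.
Proof.
rewrite -(diag_moment lawIm lawD (isT : 2 <= 4)%N); apply: eq_bigr => u _.
by rewrite rmorphXn.
Qed.

(** An element (c, (a, b)) of the list stands for c x^a y^b. Each mixed moment then reduces to a
    polynomial identity modulo [I * I = -1]. *)
Let momE o p q (l : seq (R[i] * (nat * nat))) :
  all (fun t => (t.2.1 <= 4) && (t.2.2 <= 4))%N l ->
  (forall u, (if o then zp u ^+ p * zm u ^+ q else zm u ^+ p * zp u ^+ q) =
    \sum_(t <- l) t.1 * (x u ^+ t.2.1 * y u ^+ t.2.2)) ->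
  mom o p q = \sum_(t <- l) t.1 * (mu t.2.1 * nu t.2.2).
Proof.
move=> /allP lb lE.
transitivity (\sum_u \sum_(t <- l) t.1 * (wp u * (x u ^+ t.2.1 * y u ^+ t.2.2))).
  apply: eq_bigr => u _; rewrite lE mulr_sumr; apply: eq_bigr => t _.
  by rewrite mulrCA.
rewrite exchange_big /= !big_seq; apply: eq_bigr => t /lb /andP[p4 q4].
by rewrite -mulr_sumr xy.
Qed.

Lemma model_mom10 o : mom o 1 0 = 0.
Proof.
rewrite (@momE o 1 0 [:: (1, (1%N, 0%N)); (if o then I else - I, (0%N, 1%N))]) //.
  by rewrite !big_cons big_nil /= mu1 nu1 !(mul0r, mulr0, addr0).
move=> u; rewrite !big_cons big_nil /= zpE zmE; case: o => /=; ring.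
Qed.

Lemma model_mom01 o : mom o 0 1 = 0.
Proof.
rewrite (@momE o 0 1 [:: (1, (1%N, 0%N)); (if o then - I else I, (0%N, 1%N))]) //.
  by rewrite !big_cons big_nil /= mu1 nu1 !(mul0r, mulr0, addr0).
move=> u; rewrite !big_cons big_nil /= zpE zmE; case: o => /=; ring.
Qed.

Lemma model_mom11 o : mom o 1 1 = mu 2 + nu 2.
Proof.
rewrite (@momE o 1 1 [:: (1, (2%N, 0%N)); (1, (0%N, 2%N))]) //.
  by rewrite !big_cons big_nil /= mu0 nu0 !(mul1r, mulr1, addr0).
move=> u; rewrite !big_cons big_nil /= zpE zmE.
case: o => /=.
  transitivity (x u ^+ 2 - I * I * y u ^+ 2); [ring | rewrite i2; ring].
transitivity (x u ^+ 2 - I * I * y u ^+ 2); [ring | rewrite i2; ring].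
Qed.

Lemma model_mom20 o : mom o 2 0 = mu 2 - nu 2.
Proof.
rewrite (@momE o 2 0 [:: (1, (2%N, 0%N)); (-1, (0%N, 2%N));
  ((if o then 2 else -2) * I, (1%N, 1%N))]) //.
  rewrite !big_cons big_nil /= mu0 nu0 mu1; ring.
move=> u; rewrite !big_cons big_nil /= zpE zmE.
case: o => /=.
  transitivity (x u ^+ 2 + I * I * y u ^+ 2 + 2 * I * x u * y u); [ring | rewrite i2;
    ring].
transitivity (x u ^+ 2 + I * I * y u ^+ 2 - 2 * I * x u * y u); [ring | rewrite i2;
  ring].
Qed.

Lemma model_mom02 o : mom o 0 2 = mu 2 - nu 2.
Proof.
rewrite -(model_mom20 (~~ o)); apply: eq_bigr => u _; congr (_ * _).
by case: o; rewrite /= !expr0 mulr1 mul1r.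
Qed.

Lemma model_mom22 o : mom o 2 2 = mu 4 + 2 * mu 2 * nu 2 + nu 4.
Proof.
rewrite (@momE o 2 2 [:: (1, (4%N, 0%N)); (2, (2%N, 2%N)); (1, (0%N, 4%N))]) //.
  rewrite !big_cons big_nil /= mu0 nu0; ring.
move=> u; rewrite !big_cons big_nil /= zpE zmE.
case: o => /=; transitivity ((x u ^+ 2 - I * I * y u ^+ 2) ^+ 2);
  by [ring | rewrite i2; ring].
Qed.

Lemma model_mom12 : mom true 1 2 + mom false 1 2 = mu 3 *+ 2.
Proof.
rewrite (@momE true 1 2 [:: (1, (3%N, 0%N)); (1, (1%N, 2%N)); (- I, (2%N, 1%N));
  (- I, (0%N, 3%N))]) //; last first.
  move=> u; rewrite !big_cons big_nil /= zpE zmE.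
  transitivity ((x u ^+ 2 - I * I * y u ^+ 2) * (x u - I * y u)); first ring.
  by rewrite i2; ring.
rewrite (@momE false 1 2 [:: (1, (3%N, 0%N)); (1, (1%N, 2%N)); (I, (2%N, 1%N));
  (I, (0%N, 3%N))]) //; last first.
  move=> u; rewrite !big_cons big_nil /= zpE zmE.
  transitivity ((x u ^+ 2 - I * I * y u ^+ 2) * (x u + I * y u)); first ring.
  by rewrite i2; ring.
by rewrite !big_cons !big_nil /= mu0 nu0 mu1 nu1; ring.
Qed.

End ModelMoments.

(** * Equality of the two means *)

Section Comparison.
Local Open Scope classical_set_scope.
Local Open Scope complex_scope.
Variables (R : realType) (lawRe lawIm lawD : probability (measurableTypeR R) R).
Hypotheses (hRe4 : finite_moment lawRe 4) (hIm4 : finite_moment lawIm 4)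
  (hD2 : finite_moment lawD 2).
Context d (T : measurableType d) (P : probability T R) n (Z : T -> 'M[R[i]]_n).
Hypothesis hZ : wigner lawRe lawIm lawD P Z.

Lemma wigner_slotZ w : Z w = slotZ (fun s => slot_var Z s w).
Proof.
apply/matrixP => i j; rewrite mxE; case: ltngtP => [ij|ji|/val_inj ->].
- by rewrite /= /entry_re /entry_im; case: (Z w i j).
- have := wigner_re_sym hZ ji w; have := wigner_im_sym hZ ji w.
  by rewrite /= /entry_re /entry_im /= => <- <-; case: (Z w i j).
- have := wigner_diag_im hZ j w.
  rewrite /= /entry_diag /entry_im /=; case: (Z w j j) => a b /= ->.
  by [].
Qed.

(** The degree bounds, 4 off the diagonal and 2 on it, are exactly the moments assumed finite. *)
Lemma slot_law_power (s : slot n) q : (q <= det_deg s + det_deg s)%N ->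
  has_mean (slot_law lawRe lawIm lawD s) (fun x => x ^+ q)
           (moment (slot_law lawRe lawIm lawD s) q).
Proof.
move=> qs; have q4 : (q <= 4)%N.
  by apply: leq_trans qs _; rewrite /det_deg; case: ifP => //; case: s.
case: s qs => [[jk [|]]|j] qs /=.
- exact: (@has_mean_power _ _ q 2).
- exact: (@has_mean_power _ _ q 2).
- exact: (@has_mean_power _ _ q 1).
Qed.

(** Both means are linear and give every monomial the same product of moments. *)
Lemma polyfun_mean phi : polyfun (fun s => det_deg s + det_deg s)%N phi ->
  has_cmean P (fun w => phi (fun s => slot_var Z s w))
    (\sum_(w : 'M[node_pair]_n)
       weight (off_weight lawRe lawIm) (diag_weight lawIm lawD)
         w * phi (sample_slot R w)).
Proof.
move=> [l ll phiE].
rewrite (_ : (fun w => _) = (fun w => \sum_(p <- l)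
  p.1 * (monomial (fun s => slot_var Z s w) p.2)%:C)); last first.
  by apply/funext => w; rewrite phiE.
rewrite (_ : \sum_w _ = \sum_(p <- l) p.1 *
    (\prod_(s | used s) moment (slot_law lawRe lawIm lawD s) (p.2 s))%:C); last first.
  transitivity (\sum_(w : 'M[node_pair]_n) \sum_(p <- l) p.1 *
      (weight (off_weight lawRe lawIm) (diag_weight lawIm lawD) w *
      (monomial (sample_slot R w) p.2)%:C)).
    apply: eq_bigr => w _; rewrite phiE mulr_sumr; apply: eq_bigr => p _.
    by rewrite mulrCA.
  rewrite exchange_big /= !big_seq; apply: eq_bigr => p pl; rewrite -mulr_sumr.
  rewrite sample_monomial // => s.
  by move/allP: ll => /(_ p pl) /forallP.
elim: l ll {phi phiE} => [|p l IHl] /=.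
  rewrite big_nil; under eq_fun do rewrite big_nil; move=> _; exact: has_cmean0.
case/andP => /forallP pd ll; rewrite big_cons.
under eq_fun do rewrite big_cons.
apply: has_cmeanD; last exact: IHl.
apply: has_cmeanZ; apply: (slot_monomial_mean hZ) => s us.
  by have := pd s; rewrite /det_deg (negbTE us) leqn0 => /eqP.
exact: slot_law_power.
Qed.

Lemma det_prod_mean a1 a2 c1 c2 :
  has_cmean P (fun w => det_prod a1 a2 c1 c2 (Z w))
   (model_mean (off_weight lawRe lawIm) (diag_weight lawIm lawD) (@off_entry R)
      (@off_entry_conj R) (@diag_entry R)
      (fun M : 'M[R[i]]_n => \det (M + a1%:C *: const_mx 1 + c1%:C%:M) *
                            \det (M + a2%:C *: const_mx 1 + c2%:C%:M))).
Proof.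
pose phi (x : slot n -> R) := det_prod a1 a2 c1 c2 (slotZ x).
have phi_poly : polyfun (fun s => det_deg s + det_deg s)%N phi.
  have := polyfunM (polyfun_det (a1%:C *: const_mx 1 + c1%:C *: 1%:M))
                   (polyfun_det (a2%:C *: const_mx 1 + c2%:C *: 1%:M)).
  by move=> h; apply: eq_polyfun (h n) => x; rewrite /phi /det_prod !addrA.
have := polyfun_mean phi_poly.
rewrite (_ : (fun w => _) = (fun w => det_prod a1 a2 c1 c2 (Z w))); last first.
  by apply/funext => w; rewrite wigner_slotZ.
congr (has_cmean _ _ _); apply: eq_bigr => w _.
by rewrite sampleZ_slot /phi /det_prod !scalemx1.
Qed.

End Comparison.

Theorem theorem10 (R : realType)
    (lawRe lawIm lawD : probability (measurableTypeR R) R)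
    (d : nat -> measure_display) (T : forall n : nat, measurableType (d n))
    (P : forall n : nat, probability (T n) R)
    (Z : forall n : nat, T n -> 'M[R[i]]_n)
    (hRe4 : finite_moment lawRe 4) (hIm4 : finite_moment lawIm 4)
    (hD2 : finite_moment lawD 2)
    (hRe1 : moment lawRe 1 = 0) (hIm1 : moment lawIm 1 = 0)
    (hD1 : moment lawD 1 = 0)
    (hZ : forall n : nat, wigner lawRe lawIm lawD (P n) (Z n))
    (a1 a2 c1 c2 : R) :
  let t := fpsX R in
  let mu q := fpsC (moment lawRe q) in
  let nu q := fpsC (moment lawIm q) in
  let kappa q := fpsC (moment lawD q) in
  let A1 := fpsC a1 in let A2 := fpsC a2 in
  let C1 := fpsC c1 in let C2 := fpsC c2 in
  (forall n : nat,
     complex_integrable (P n) (fun w => det_prod a1 a2 c1 c2 (Z n w))) /\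
  H2 P Z a1 a2 c1 c2 =
  fps_map (real_complex R)
    (H2_P t (mu 2%N) (mu 3%N) (nu 2%N) A1 A2 C1 C2
     * H2_Q t (mu 2%N) (mu 4%N) (nu 2%N) (nu 4%N) (kappa 2%N) C1 C2).
Proof.
have mean n := det_prod_mean hRe4 hIm4 hD2 (hZ n) a1 a2 c1 c2.
move=> t mu nu kappa A1 A2 C1 C2; split=> [n|].
  exact: has_cmean_integrable (mean n).
transitivity (egf (fun n => model_mean (off_weight lawRe lawIm)
  (diag_weight lawIm lawD) (@off_entry R)
      (@off_entry_conj R) (@diag_entry R)
      (fun M : 'M[R[i]]_n => \det (M + a1%:C%C *: const_mx 1 + c1%:C%C%:M) *
                            \det (M + a2%:C%C *: const_mx 1 + c2%:C%C%:M)))).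
  by apply: fpsP => n /=; rewrite (has_cmean_expectation (mean n)).
(* The model lives over [R[i]], so the embedding is moved from the real series onto the parameters
   of P and Q. *)
pose h : {rmorphism R -> R[i]} := real_complex R.
transitivity (fps_map h (H2_P t (mu 2%N) (mu 3%N) (nu 2%N) A1 A2 C1 C2) *
  fps_map h (H2_Q t (mu 2%N) (mu 4%N) (nu 2%N) (nu 4%N) (kappa 2%N) C1 C2)); last first.
  exact: (esym (rmorphM (fps_map h) _ _)).
rewrite [X in _ = X * _](fps_map_H2_P h) [X in _ = _ * X](fps_map_H2_Q h).
apply: finite_model_egf.
- exact: model_wd1.
- exact: model_wdz.
- exact: model_wdz2.
- exact: model_wp1.
- exact: model_mom10.
- exact: model_mom01.
- exact: model_mom11.
- exact: model_mom20.
- exact: model_mom02.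
- exact: model_mom22.
- exact: model_mom12.
Qed.
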